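(* Let $\mathcal A=\{\varphi_t\}_{t\in\mathcal N}$ and $\mathcal A'=\{\psi_t\}_{t\in\mathcal N}$ be two sequences of functions in $L^2(\mathscr G)$ such that $\mathcal E^\Gamma(\mathcal A)$ is an $\mathcal S^\Gamma(\mathcal A)$-subspace frame and $\mathcal E^\Gamma(\mathcal A')$ is an $\mathcal S^\Gamma(\mathcal A')$-subspace frame. If $\mathcal S^\Gamma(\mathcal A)=\mathcal S^\Gamma(\mathcal A')$, then the following are equivalent: (i) $\mathcal E^\Gamma(\mathcal A)$ and $\mathcal E^\Gamma(\mathcal A')$ are an orthogonal pair. (ii) $\mathfrak J_{\mathcal A}(\alpha)\,\mathfrak J_{\mathcal A'}(\alpha)^*\,\mathfrak J_{\mathcal A'}(\alpha)=0$ for a.e. $\alpha\in\widehat\Gamma$. (iii) $G_{\mathcal A}(\alpha)\,G_{\mathcal A'}(\alpha)=0$ for a.e. $\alpha\in\widehat\Gamma$. Additionally, when $\mathcal S^\Gamma(\mathcal A)=\mathcal S^\Gamma(\mathcal A')=L^2(\mathscr G)$, then $\mathcal E^\Gamma(\mathcal A)$ and $\mathcal E^\Gamma(\mathcal A')$ are an orthogonal pair if and only if $\tilde G_{\mathcal A,\mathcal A'}(\alpha)=0$ for a.e. $\alpha\in\widehat\Gamma$.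
   Context: $\mathscr G$ is a second countable locally compact group (not necessarily abelian) with left Haar measure, $\Gamma$ is a closed discrete abelian subgroup with counting measure, $\widehat\Gamma$ is its (compact) dual group with normalized Haar measure, and $\mathcal N$ is a countable index set with counting measure. $(L_\gamma f)(x)=f(\gamma^{-1}x)$. For $\mathcal A=\{\varphi_t\}_{t\in\mathcal N}\subset L^2(\mathscr G)$, $\mathcal E^\Gamma(\mathcal A)=\{L_\gamma\varphi_t\}_{\gamma\in\Gamma,t\in\mathcal N}$ and $\mathcal S^\Gamma(\mathcal A)=\overline{\operatorname{span}}\,\mathcal E^\Gamma(\mathcal A)$. $\Gamma\backslash\mathscr G$ is the space of right cosets $\Gamma x$, $\Xi:\Gamma\backslash\mathscr G\to\mathscr G$ is a Borel section, and $\Gamma\backslash\mathscr G$ carries the measure with $\int_{\mathscr G}f=\int_{\Gamma\backslash\mathscr G}\sum_{\gamma\in\Gamma}f(\gamma\,\Xi(\Gamma x))\,d\mu_{\Gamma\backslash\mathscr G}(\Gamma x)$. The Zak transform $\mathcal Z:L^2(\mathscr G)\to L^2(\widehat\Gamma\times\Gamma\backslash\mathscr G)\cong L^2(\widehat\Gamma;L^2(\Gamma\backslash\mathscr G))$ is the unitary extension of $(\mathcal Zf)(\alpha,\Gamma x)=\sum_{\gamma\in\Gamma}f(\gamma\,\Xi(\Gamma x))\,\alpha(\gamma^{-1})$, $f\in L^1\cap L^2$; write $\mathcal Zf(\alpha)=\{\mathcal Zf(\alpha,\Gamma x)\}_{\Gamma x}\in L^2(\Gamma\backslash\mathscr G)$.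 A countable family $\{f_k\}$ in a Hilbert space $\mathcal H$ is a $\mathcal K$-subspace frame ($\mathcal K\subseteq\mathcal H$ a closed subspace) if there are $0<A\le B<\infty$ with $A\|f\|^2\le\sum_k|\langle f,f_k\rangle|^2\le B\|f\|^2$ for all $f\in\mathcal K$; it is Bessel if the upper bound holds for all $f\in\mathcal H$. Bessel families $\mathcal X=\{f_k\}$, $\mathcal Y=\{g_k\}$ are called an orthogonal (Bessel) pair if $\overline{\operatorname{span}}\,\mathcal X=\overline{\operatorname{span}}\,\mathcal Y$ and $\sum_k\langle f,g_k\rangle f_k=0$ for all $f$ in this common closed span. For $\mathcal E^\Gamma(\mathcal A)$ Bessel, the pre-Gramian $\mathfrak J_{\mathcal A}(\alpha):\ell^2(\mathcal N)\to L^2(\Gamma\backslash\mathscr G)$, $\{\eta_t\}\mapsto\sum_t\eta_t\mathcal Z\varphi_t(\alpha)$, is bounded for a.e. $\alpha$, with adjoint $\mathfrak J_{\mathcal A}(\alpha)^*\nu=\{\langle\nu,\mathcal Z\varphi_t(\alpha)\rangle\}_t$. The Gramian is $G_{\mathcal A}(\alpha)=\mathfrak J_{\mathcal A}(\alpha)^*\mathfrak J_{\mathcal A}(\alpha)$ and the mixed dual-Gramian is $\tilde G_{\mathcal A,\mathcal A'}(\alpha)=\mathfrak J_{\mathcal A}(\alpha)\mathfrak J_{\mathcal A'}(\alpha)^*$. *)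

(* Defs.v *)
From HB Require Import structures.
From mathcomp Require Import all_boot all_order all_algebra.
From mathcomp Require Import finmap generic_quotient complex.
From mathcomp Require Import all_classical all_reals all_analysis.
From mathcomp Require Import measurable_realfun.
From mathcomp Require summability.

Set Implicit Arguments.
Unset Strict Implicit.
Unset Printing Implicit Defensive.

Import Order.TTheory GRing.Theory Num.Theory.
Import numFieldNormedType.Exports.

Local Open Scope classical_set_scope.
Local Open Scope ring_scope.
Local Open Scope complex_scope.

(* Vectors of a complex L^2-space are represented by square-integrable
   functions, and identities between vectors are identities almost everywhere.
   Sums over a possibly infinite index type are unconditional: they are limits
   of finite partial sums along [summability.totally], the filter of finite
   subsets ordered by inclusion. *)
Section ComplexL2.
Context d (T : measurableType d) (R : realType).
Variable mu : {measure set T -> \bar R}.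
Implicit Types f g : T -> R[i].

Definition cmeasurable f : Prop :=
  measurable_fun [set: T] (fun x => complex.Re (f x)) /\
  measurable_fun [set: T] (fun x => complex.Im (f x)).

Definition cLnorm (p : \bar R) f : \bar R :=
  Lnorm mu p (fun x => (Normc.normc (f x))%:E).

Definition cL1 : set (T -> R[i]) :=
  [set f | cmeasurable f /\ (cLnorm 1%:E f < +oo)%E].

Definition cL2 : set (T -> R[i]) :=
  [set f | cmeasurable f /\ (cLnorm 2%:E f < +oo)%E].

Definition L2_dist f g : \bar R := cLnorm 2%:E (fun x => f x - g x).

Definition cintegral f : R[i] :=
  (\int[mu]_x complex.Re (f x))%R +i* (\int[mu]_x complex.Im (f x))%R.

Definition inner f g : R[i] := cintegral (fun x => f x * conjc (g x)).

Section Families.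
Variable I : choiceType.
Implicit Types F E : I -> T -> R[i].

Definition L2_has_sum F g : Prop :=
  cL2 g /\
  (fun s : {fset I} => L2_dist (fun x => \sum_(i <- s) F i x) g)
    @ summability.totally --> 0%E.

Definition closed_span F : set (T -> R[i]) :=
  [set f | cL2 f /\ forall e : R, 0 < e ->
     exists (s : {fset I}) (c : I -> R[i]),
       (L2_dist f (fun x => (\sum_(i <- s) c i * F i x)%R) < e%:E)%E].

Definition frame_sum F f : \bar R :=
  (\esum_(i in [set: I]) ((Normc.normc (inner f (F i))) ^+ 2)%:E)%E.

Definition subspace_frame (K : set (T -> R[i])) F : Prop :=
  exists A B : R, [/\ 0 < A, A <= B &
    forall f, K f ->
      (A%:E * cLnorm 2%:E f ^+ 2 <= frame_sum F f <=
       B%:E * cLnorm 2%:E f ^+ 2)%E].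

Definition bessel F : Prop :=
  exists2 B : R, 0 < B &
    forall f, cL2 f -> (frame_sum F f <= B%:E * cLnorm 2%:E f ^+ 2)%E.

Definition orthogonal_pair F E : Prop :=
  [/\ bessel F, bessel E, closed_span F = closed_span E &
    forall f, closed_span F f ->
      L2_has_sum (fun i x => inner f (E i) * F i x) (fun=> 0)].

Definition ell2 : set (I -> R[i]) :=
  [set eta | (\esum_(i in [set: I]) ((Normc.normc (eta i)) ^+ 2)%:E < +oo)%E].

(* The bounded operator ell^2(I) -> L^2 attached to a Bessel family F; the
   value is the zero function where the series does not converge in L^2, which
   does not happen on ell^2(I) when F is Bessel. *)
Definition synthesis F (eta : I -> R[i]) : T -> R[i] :=
  xget (fun=> 0) [set g | L2_has_sum (fun i x => eta i * F i x) g].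

Definition analysis F (f : T -> R[i]) : I -> R[i] := fun i => inner f (F i).

End Families.
End ComplexL2.

#[short(type="preTopologicalGroupType")]
HB.structure Definition PreTopologicalGroup :=
  {G of Group G & PointedTopological G}.

HB.mixin Record PreTopologicalGroup_isTopologicalGroup G
    & PreTopologicalGroup G := {
  mulg_continuous : continuous (fun xy : G * G => (xy.1 * xy.2)%g);
  invg_continuous : continuous (fun x : G => x^-1%g)
}.

#[short(type="topologicalGroupType")]
HB.structure Definition TopologicalGroup :=
  {G of PreTopologicalGroup G & PreTopologicalGroup_isTopologicalGroup G}.

Notation borel T := (g_sigma_algebraType (@open T)).

Record left_haar (R : realType) (G : preTopologicalGroupType)
    (mu : {measure set (borel G) -> \bar R}) : Prop := LeftHaar {
  haar_neq0 : mu [set: G] != 0%E;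
  haar_compact : forall K : set G, compact K -> (mu K < +oo)%E;
  haar_outer : forall A : set (borel G), measurable A ->
    mu A = ereal_inf [set mu U | U in [set U : set G | open U /\ A `<=` U]];
  haar_inner : forall U : set G, open U ->
    mu U = ereal_sup [set mu K | K in [set K : set G | compact K /\ K `<=` U]];
  haar_invariant : forall (g : G) (A : set (borel G)), measurable A ->
    mu [set (g * x)%g | x in (A : set G)] = mu A
}.

Record closedDiscreteAbelianSubgroup (G : topologicalGroupType) :=
  ClosedDiscreteAbelianSubgroup {
  subgroup_set :> set G;
  subgroup_closed_under : group_closed (fun x => x \in subgroup_set);
  subgroup_closed : closed subgroup_set;
  subgroup_discrete : forall x : subgroup_set, open [set x];
  subgroup_abelian : forall x y : G,
    subgroup_set x -> subgroup_set y -> (x * y = y * x)%g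
}.

Definition subgroup_type (G : topologicalGroupType)
  (Gam : closedDiscreteAbelianSubgroup G) : Type := set_type Gam.

Section Subgroup.
Context (G : topologicalGroupType) (Gam : closedDiscreteAbelianSubgroup G).
Local Notation gT := (subgroup_type Gam).

HB.instance Definition _ := SubChoice.copy gT (set_type Gam).
HB.instance Definition _ := Topological.copy gT (set_type Gam).
HB.instance Definition _ :=
  SubChoice_isSubGroup.Build G (fun x => x \in subgroup_set Gam) gT
    (subgroup_closed_under Gam).

End Subgroup.

Section Dual.
Context (R : realType) (G : topologicalGroupType)
  (Gam : closedDiscreteAbelianSubgroup G).
Local Notation gT := (subgroup_type Gam).

Definition is_character (a : gT -> R[i]^o) : Prop :=
  [/\ continuous a, forall x, `|a x| = 1 &
      forall x y, a (x * y)%g = a x * a y].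

Definition characters : set {compact-open, gT -> R[i]^o} :=
  [set a | is_character a].

(* The dual group, with the compact-open topology and pointwise product. *)
Definition dual : Type := set_type characters.

HB.instance Definition _ := SubChoice.copy dual (set_type characters).
HB.instance Definition _ := Topological.copy dual (set_type characters).

Definition char_eval (a : dual) : gT -> R[i] := val a.

Lemma subgroup_continuous (a : gT -> R[i]^o) : continuous a.
Proof.
move=> x A Aax.
have xs := open_nbhs_nbhs (conj (subgroup_discrete x) erefl).
apply: (filterS _ xs).
by move=> y ->; exact: nbhs_singleton Aax.
Qed.

Definition trivial_char_fun : {compact-open, gT -> R[i]^o} := fun=> 1.
Definition mul_char_fun (a b : dual) : {compact-open, gT -> R[i]^o} :=
  fun x => char_eval a x * char_eval b x.
Definition inv_char_fun (a : dual) : {compact-open, gT -> R[i]^o} :=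
  fun x => char_eval a (x^-1)%g.

Lemma charP (a : dual) : is_character (char_eval a).
Proof. exact: set_mem (valP a). Qed.

Lemma trivial_char_subproof : trivial_char_fun \in characters.
Proof.
apply/mem_set; split; first exact: subgroup_continuous.
- by move=> x; rewrite normr1.
- by move=> x y; rewrite mulr1.
Qed.

Lemma mul_char_subproof a b : mul_char_fun a b \in characters.
Proof.
have [_ a1 aM] := charP a; have [_ b1 bM] := charP b.
apply/mem_set; split; first exact: subgroup_continuous.
- by move=> x; rewrite normrM a1 b1 mulr1.
- by move=> x y; rewrite /mul_char_fun aM bM mulrACA.
Qed.

Lemma inv_char_subproof a : inv_char_fun a \in characters.
Proof.
have [_ a1 aM] := charP a.
apply/mem_set; split; first exact: subgroup_continuous.
- by move=> x; exact: a1.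
- by move=> x y; rewrite /inv_char_fun invgM aM mulrC.
Qed.

Definition trivial_char : dual :=
  exist (fun u => u \in characters) _ trivial_char_subproof.
Definition mul_char a b : dual :=
  exist (fun u => u \in characters) _ (mul_char_subproof a b).
Definition inv_char a : dual :=
  exist (fun u => u \in characters) _ (inv_char_subproof a).

Lemma char_inj (a b : dual) : char_eval a =1 char_eval b -> a = b.
Proof. by move=> ab; apply: val_inj; exact/funext. Qed.

Lemma mul_charA : associative mul_char.
Proof. by move=> a b c; apply: char_inj => x; exact: mulrA. Qed.

Lemma mul1_char : left_id trivial_char mul_char.
Proof. by move=> a; apply: char_inj => x; exact: mul1r. Qed.

Lemma mul_char1 : right_id trivial_char mul_char.
Proof. by move=> a; apply: char_inj => x; exact: mulr1. Qed.

Lemma char_eval1 (a : dual) : char_eval a 1%g = 1.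
Proof.
have [_ a1 aM] := charP a.
have a0 : char_eval a 1%g != 0 by rewrite -normr_eq0 a1 oner_eq0.
by apply: (mulfI a0); rewrite -aM mulg1 mulr1.
Qed.

Lemma mulV_char : left_inverse trivial_char inv_char mul_char.
Proof.
move=> a; apply: char_inj => x; have [_ _ aM] := charP a.
by rewrite -[RHS](char_eval1 a) -(mulVg x) aM.
Qed.

Lemma mul_charV : right_inverse trivial_char inv_char mul_char.
Proof.
move=> a; apply: char_inj => x; have [_ _ aM] := charP a.
by rewrite -[RHS](char_eval1 a) -(mulgV x) aM.
Qed.

HB.instance Definition _ :=
  isGroup.Build dual mul_charA mul1_char mul_char1 mulV_char mul_charV.
HB.instance Definition _ := isPointed.Build dual trivial_char.

End Dual.

Section Cosets.
Context (G : topologicalGroupType) (Gam : closedDiscreteAbelianSubgroup G).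

(* [x] and [y] lie in the same right coset of [Gam]. *)
Definition same_coset (x y : G) : bool :=
  `[< exists g : subgroup_type Gam, y = (val g * x)%g >].

Lemma same_coset_equiv : equiv_class_of same_coset.
Proof.
split.
- by move=> x; apply/asboolP; exists 1%g; rewrite val1 mul1g.
- move=> x y; apply/asboolP/asboolP => -[g ->]; exists g^-1%g;
  by rewrite mulgA -valM mulVg val1 mul1g.
- move=> y x z /asboolP[g ->] /asboolP[h ->]; apply/asboolP.
  by exists (h * g)%g; rewrite valM mulgA.
Qed.

Canonical same_coset_equivRel := EquivRelPack same_coset_equiv.

Definition cosets := quotient_topology {eq_quot same_coset_equivRel}%qT.


Definition coset_proj (x : G) : cosets := (\pi_cosets x)%qT.

End Cosets.

Section Zak.
Context (R : realType) (G : topologicalGroupType)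
  (Gam : closedDiscreteAbelianSubgroup G) (N : choiceType).
Variables (mu : {measure set (borel G) -> \bar R})
  (nu : probability (borel (dual R Gam)) R)
  (muQ : {sigma_finite_measure set (borel (cosets Gam)) -> \bar R}).
Local Notation gT := (subgroup_type Gam).

Definition borel_section (Xi : cosets Gam -> G) : Prop :=
  measurable_fun [set: borel (cosets Gam)] (Xi : borel (cosets Gam) -> borel G)
  /\ forall q, coset_proj Gam (Xi q) = q.

(* Weil's formula, for all nonnegative measurable functions; the one for
   integrable functions follows by linearity. *)
Definition is_quotient_measure (Xi : cosets Gam -> G) : Prop :=
  forall f : borel G -> \bar R, measurable_fun [set: borel G] f ->
    (forall x, (0 <= f x)%E) ->
    (\int[mu]_x f x =
     \int[muQ]_q \esum_(g in [set: gT]) f (val g * Xi q)%g)%E.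

Definition translate (g : G) (f : G -> R[i]) : G -> R[i] :=
  fun x => f (g^-1 * x)%g.

Definition orbit_family (phi : N -> G -> R[i]) (i : gT * N) : G -> R[i] :=
  translate (val i.1) (phi i.2).

Definition orbit_span (phi : N -> G -> R[i]) : set (G -> R[i]) :=
  closed_span mu (orbit_family phi).

Local Notation P := (borel (dual R Gam) * borel (cosets Gam))%type.

(* [Z] is the unitary operator from L^2(G) onto L^2(dual x cosets) which
   extends the series formula on the intersection of L^1 and L^2. These clauses
   determine [Z f] almost everywhere for every [f] in L^2(G). *)
Record is_zak_transform (Xi : cosets Gam -> G)
    (Z : (G -> R[i]) -> (dual R Gam * cosets Gam -> R[i])) : Prop := IsZak {
  zak_formula : forall f, cL1 mu f -> cL2 mu f ->
    {ae (nu \x muQ)%E, forall p : P,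
      ((fun s : {fset gT} =>
          \sum_(g <- s)
            f (val g * Xi p.2)%g * char_eval p.1 (g^-1)%g) : {fset gT} -> R[i]^o)
        @ summability.totally --> (Z f p : R[i]^o)};
  zak_linear : forall (a : R[i]) f g, cL2 mu f -> cL2 mu g ->
    Z (fun x => a * f x + g x) = (fun p => a * Z f p + Z g p)
      %[ae (nu \x muQ)%E];
  zak_L2 : forall f, cL2 mu f -> cL2 (nu \x muQ)%E (Z f);
  zak_isometry : forall f, cL2 mu f ->
    cLnorm (nu \x muQ)%E 2%:E (Z f) = cLnorm mu 2%:E f;
  zak_onto : forall F : P -> R[i], cL2 (nu \x muQ)%E F ->
    exists2 f, cL2 mu f & Z f = F %[ae (nu \x muQ)%E]
}.

Variable Z : (G -> R[i]) -> (dual R Gam * cosets Gam -> R[i]).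

Definition zak_fiber (phi : N -> G -> R[i]) (a : dual R Gam) :
    N -> cosets Gam -> R[i] :=
  fun t q => Z (phi t) (a, q).

Definition pre_gramian (phi : N -> G -> R[i]) (a : dual R Gam) :
    (N -> R[i]) -> (cosets Gam -> R[i]) :=
  synthesis muQ (zak_fiber phi a).

Definition pre_gramian_adj (phi : N -> G -> R[i]) (a : dual R Gam) :
    (cosets Gam -> R[i]) -> (N -> R[i]) :=
  analysis muQ (zak_fiber phi a).

Definition gramian (phi : N -> G -> R[i]) (a : dual R Gam) :
    (N -> R[i]) -> (N -> R[i]) :=
  pre_gramian_adj phi a \o pre_gramian phi a.

Definition mixed_dual_gramian (phi psi : N -> G -> R[i]) (a : dual R Gam) :
    (cosets Gam -> R[i]) -> (cosets Gam -> R[i]) :=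
  pre_gramian phi a \o pre_gramian_adj psi a.

End Zak.

Arguments orbit_family [R G] Gam [N] phi i.
Arguments orbit_span [R G] Gam [N] mu phi.
Arguments pre_gramian [R G Gam N] muQ Z phi a.
Arguments pre_gramian_adj [R G Gam N] muQ Z phi a.
Arguments gramian [R G Gam N] muQ Z phi a.
Arguments mixed_dual_gramian [R G Gam N] muQ Z phi psi a.

(* Main.v *)
(** Orthogonality of two Bessel families F, E with the same closed span says that
    the product of their two Gram matrices vanishes,
      sum_i <E_j, E_i> <F_i, F_k> = 0  for all j, k,
    because the closed span of E is the closure of the finite combinations of the
    E_j.  The same remark applied in a fiber shows that (ii), (iii) and, when the
    fiber family is total, the vanishing of the mixed dual Gramian are all the
    pointwise condition
      sum_t <Psi_j(a), Psi_t(a)> <Phi_t(a), Phi_k(a)> = 0,  Phi_t = Z phi_t.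
    The Zak transform is isometric and turns translation by g into multiplication
    by the character e_g; Parseval for the orthonormal basis (e_g) of L^2 of the
    dual group then identifies the global Gram product with the Fourier
    coefficients of the fiberwise one, so that one vanishes iff the other does
    for almost every a.  That the characters are orthonormal and total is read off
    from the isometry and the surjectivity of the Zak transform on functions
    carried by a single translate of the section.  The Bessel bound passes to almost
    every fiber: truncate a rational combination of the Phi_t to a set where its
    fiber norm exceeds the bound, and combine the global bound with Parseval. *)

(* The first obstacle is the order of quantifiers. Each fiber condition ranges over uncountably many
   coefficient families or functions once [a] is fixed, while Fubini yields one null set per object.
   Every such condition is therefore reduced to countably many: Gram entries are indexed by pairs
   from the countable [N], Bessel bounds are tested on combinations with rational complex
   coefficients, and totality in a fiber is tested on a countable family of functions on the
   quotient, whose density is inherited from totality upstairs. The second obstacle is convergence.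
   Sums run along finite subsets of an index type, so l^2 pairings are obtained by polarization from
   sums of nonnegative terms, and their exchange with integrals reduces to Tonelli. Values of the
   pre-Gramian exist only because L^2 is complete, which is proved here for fast Cauchy sequences.
   The third is that the Zak transform is given by a series only on part of L^2; its behaviour
   elsewhere is recovered by pairing with functions for which the series has a single term. *)
Require Import Defs.
From HB Require Import structures.
From mathcomp Require Import all_boot all_order all_algebra.
From mathcomp Require Import finmap complex.
From mathcomp Require Import all_classical all_reals all_analysis.
From mathcomp Require Import measurable_realfun.
From mathcomp Require Import ring lra.
From mathcomp Require summability.

Set Implicit Arguments.
Unset Strict Implicit.
Unset Printing Implicit Defensive.

Import Order.TTheory GRing.Theory Num.Theory.
Import numFieldNormedType.Exports.

Local Open Scope classical_set_scope.
Local Open Scope ring_scope.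

(** * Square-integrable complex functions *)

Section ComplexSquare.
Variable R : realType.
Implicit Types z w : R[i].

(** The squared modulus without a square root: measurability is immediate and identities are settled
    by [ring]. *)
Definition csq z : R := complex.Re z ^+ 2 + complex.Im z ^+ 2.

Lemma csq_ge0 z : 0 <= csq z.
Proof. by rewrite addr_ge0 ?sqr_ge0. Qed.

Lemma normc_sq z : Normc.normc z ^+ 2 = csq z.
Proof. by case: z => a b; rewrite /csq /= sqr_sqrtr // addr_ge0 ?sqr_ge0. Qed.

Lemma normc_ge0 z : 0 <= Normc.normc z.
Proof. by case: z => a b; exact: sqrtr_ge0. Qed.

Lemma normcE z : Normc.normc z = Num.sqrt (csq z).
Proof. by case: z. Qed.

Lemma mul_conjc z : z * conjc z = (csq z)%:C%C.
Proof. by case: z => a b; rewrite /csq; simpc; congr Complex; rewrite /=; ring. Qed.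

Lemma csqM z w : csq (z * w) = csq z * csq w.
Proof. by case: z w => a b [c e]; rewrite /csq /=; ring. Qed.

Lemma csq_conj z : csq (conjc z) = csq z.
Proof. by case: z => a b; rewrite /csq /=; ring. Qed.

Lemma csq0 : csq 0 = 0.
Proof. by rewrite /csq /=; ring. Qed.

Lemma csq_eq0 z : csq z = 0 -> z = 0.
Proof.
by move=> z0; apply: Normc.eq0_normc; rewrite normcE z0 sqrtr0.
Qed.

Lemma csqD z w : csq (z + w) <= 2 * (csq z + csq w).
Proof.
case: z w => a b [c e]; rewrite /csq /= -subr_ge0.
have -> : 2 * (a ^+ 2 + b ^+ 2 + (c ^+ 2 + e ^+ 2)) -
  ((a + c) ^+ 2 + (b + e) ^+ 2) = (a - c) ^+ 2 + (b - e) ^+ 2 by ring.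
by rewrite addr_ge0 ?sqr_ge0.
Qed.

Lemma Re_mul_conj_le z w : `|complex.Re (z * conjc w)| <= csq z + csq w.
Proof.
case: z w => a b [c e]; rewrite /csq /= ler_norml; apply/andP; split.
  have := sqr_ge0 (a + c); have := sqr_ge0 (b + e).
  have := sqr_ge0 (a - c); have := sqr_ge0 (b - e).
  by rewrite !expr2; nra.
have := sqr_ge0 (a + c); have := sqr_ge0 (b + e).
have := sqr_ge0 (a - c); have := sqr_ge0 (b - e).
by rewrite !expr2; nra.
Qed.

Lemma Im_mul_conj_le z w : `|complex.Im (z * conjc w)| <= csq z + csq w.
Proof.
case: z w => a b [c e]; rewrite /csq /= ler_norml; apply/andP; split.
  have := sqr_ge0 (a + e); have := sqr_ge0 (b + c).
  have := sqr_ge0 (a - e); have := sqr_ge0 (b - c).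
  by rewrite !expr2; nra.
have := sqr_ge0 (a + e); have := sqr_ge0 (b + c).
have := sqr_ge0 (a - e); have := sqr_ge0 (b - c).
by rewrite !expr2; nra.
Qed.

Lemma ReD z w : complex.Re (z + w) = complex.Re z + complex.Re w.
Proof. by case: z w => a b []. Qed.
Lemma ImD z w : complex.Im (z + w) = complex.Im z + complex.Im w.
Proof. by case: z w => a b []. Qed.
Lemma ReM z w : complex.Re (z * w) =
  complex.Re z * complex.Re w - complex.Im z * complex.Im w.
Proof. by case: z w => a b []. Qed.
Lemma ImM z w : complex.Im (z * w) =
  complex.Re z * complex.Im w + complex.Im z * complex.Re w.
Proof. by case: z w => a b []. Qed.
Lemma Re_conj z : complex.Re (conjc z) = complex.Re z.
Proof. by case: z. Qed.
Lemma Im_conj z : complex.Im (conjc z) = - complex.Im z.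
Proof. by case: z. Qed.
Lemma conjcM z w : conjc (z * w) = conjc z * conjc w.
Proof. exact: rmorphM. Qed.
Lemma conjcD z w : conjc (z + w) = conjc z + conjc w.
Proof. exact: rmorphD. Qed.
Lemma conjcB z w : conjc (z - w) = conjc z - conjc w.
Proof. exact: rmorphB. Qed.
Lemma conjc_sum (I : Type) (s : seq I) (F : I -> R[i]) :
  conjc (\sum_(i <- s) F i) = \sum_(i <- s) conjc (F i).
Proof. exact: rmorph_sum. Qed.
Lemma complex_eqP z w :
  complex.Re z = complex.Re w -> complex.Im z = complex.Im w -> z = w.
Proof. by case: z w => a b [c e] /= -> ->. Qed.

End ComplexSquare.

Section L2.
Context d (T : measurableType d) (R : realType).
Variable mu : {measure set T -> \bar R}.
Implicit Types f g h : T -> R[i].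

Lemma cmeasurable_cst (c : R[i]) : cmeasurable (fun _ : T => c).
Proof. by split; exact: measurable_cst. Qed.

Lemma cmeasurableD f g : cmeasurable f -> cmeasurable g ->
  cmeasurable (fun x => f x + g x).
Proof.
move=> [f1 f2] [g1 g2]; split.
  by under eq_fun do rewrite ReD; exact: measurable_funD.
by under eq_fun do rewrite ImD; exact: measurable_funD.
Qed.

Lemma cmeasurableM f g : cmeasurable f -> cmeasurable g ->
  cmeasurable (fun x => f x * g x).
Proof.
move=> [f1 f2] [g1 g2]; split.
  under eq_fun do rewrite ReM.
  by apply: measurable_funB; exact: measurable_funM.
under eq_fun do rewrite ImM.
by apply: measurable_funD; exact: measurable_funM.
Qed.

Lemma cmeasurable_conj f : cmeasurable f -> cmeasurable (fun x => conjc (f x)).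
Proof.
move=> [f1 f2]; split; first by under eq_fun do rewrite Re_conj.
by under eq_fun do rewrite Im_conj; exact: measurableT_comp.
Qed.

Lemma measurable_csq f : cmeasurable f -> measurable_fun setT (fun x => csq (f x)).
Proof.
by move=> [f1 f2]; apply: measurable_funD; exact: measurable_funX.
Qed.

Lemma measurable_ecsq f : cmeasurable f ->
  measurable_fun setT (fun x => (csq (f x))%:E).
Proof. by move=> mf; apply/measurable_EFinP; exact: measurable_csq. Qed.

Lemma cLnorm2E f : (cLnorm mu 2%:E f = (\int[mu]_x (csq (f x))%:E) `^ (2^-1))%E.
Proof.
rewrite /cLnorm unlock; congr (_ `^ _)%E; apply: eq_integral => x _.
by rewrite gee0_abs ?lee_fin ?normc_ge0// poweR_EFin powR_mulrn ?normc_ge0 // normc_sq.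
Qed.

Lemma sqr_poweR12 (y : \bar R) : (0 <= y -> (y `^ (2^-1)) ^+ 2 = y)%E.
Proof.
case: y => [r r0||] //.
  by rewrite poweR_EFin powR12_sqrt// expe2 -EFinM -expr2 sqr_sqrtr.
by move=> _; rewrite poweRyr ?invr_eq0 ?pnatr_eq0// expe2 mulyy.
Qed.

Lemma cLnorm2_sq f : (cLnorm mu 2%:E f ^+ 2 = \int[mu]_x (csq (f x))%:E)%E.
Proof.
rewrite cLnorm2E sqr_poweR12//.
by apply: integral_ge0 => x _; rewrite lee_fin csq_ge0.
Qed.

Lemma cL2P f : cL2 mu f <->
  cmeasurable f /\ (\int[mu]_x (csq (f x))%:E < +oo)%E.
Proof.
have I0 : (0 <= \int[mu]_x (csq (f x))%:E)%E.
  by apply: integral_ge0 => x _; rewrite lee_fin csq_ge0.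
split=> -[mf fi]; split=> //.
  by move: fi; rewrite cLnorm2E; apply: lty_poweRy; rewrite invr_eq0 pnatr_eq0.
by rewrite cLnorm2E poweR_lty.
Qed.

Lemma cL2_integrable f : cL2 mu f -> mu.-integrable setT (fun x => (csq (f x))%:E).
Proof.
move=> /cL2P[mf fi]; apply/integrableP; split; first exact: measurable_ecsq.
by under eq_integral do rewrite gee0_abs ?lee_fin ?csq_ge0//.
Qed.

Lemma cL2_dominated f (b : T -> R) : cmeasurable f ->
  mu.-integrable setT (EFin \o b) -> (forall x, csq (f x) <= b x) -> cL2 mu f.
Proof.
move=> mf ib fb; apply/cL2P; split=> //.
have /integrableP[_] : mu.-integrable setT (fun x => (csq (f x))%:E).
  apply: (le_integrable measurableT _ _ ib); first exact: measurable_ecsq.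
  move=> x _; rewrite /= lee_fin ger0_norm ?csq_ge0//.
  exact: le_trans (fb x) (ler_norm _).
by under eq_integral do rewrite gee0_abs ?lee_fin ?csq_ge0//.
Qed.

Lemma cL2_lin (a : R[i]) f g : cL2 mu f -> cL2 mu g ->
  cL2 mu (fun x => a * f x + g x).
Proof.
move=> Lf Lg; have /cL2P[mf _] := Lf; have /cL2P[mg _] := Lg.
apply: (@cL2_dominated _ (fun x => 2 * csq a * csq (f x) + 2 * csq (g x))).
- by apply: cmeasurableD => //; apply: cmeasurableM => //; exact: cmeasurable_cst.
- rewrite (_ : _ \o _ = (fun x => (2 * csq a)%:E * (csq (f x))%:E +
    2%:E * (csq (g x))%:E)%E); last by apply/funext => x; rewrite /= EFinD !EFinM.
  by apply: integrableD => //; apply: integrableZl => //; exact: cL2_integrable.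
- by move=> x; rewrite (le_trans (csqD _ _))// csqM mulrDr mulrA.
Qed.

Lemma cL2_0 : cL2 mu (fun=> 0).
Proof.
apply/cL2P; split; first exact: cmeasurable_cst.
by under eq_integral do rewrite csq0; rewrite integral0.
Qed.

Lemma cL2Z (a : R[i]) f : cL2 mu f -> cL2 mu (fun x => a * f x).
Proof.
move=> Lf; have := cL2_lin a Lf cL2_0.
by under eq_fun do rewrite addr0.
Qed.

Lemma cL2D f g : cL2 mu f -> cL2 mu g -> cL2 mu (fun x => f x + g x).
Proof.
move=> Lf Lg; have := cL2_lin 1 Lf Lg.
by under eq_fun do rewrite mul1r.
Qed.

Lemma cL2B f g : cL2 mu f -> cL2 mu g -> cL2 mu (fun x => f x - g x).
Proof.
move=> Lf Lg; have := cL2_lin (-1) Lg Lf.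
by under eq_fun do rewrite mulN1r addrC.
Qed.

Lemma cL2_sum (I : eqType) (s : seq I) (F : I -> T -> R[i]) :
  (forall i, i \in s -> cL2 mu (F i)) -> cL2 mu (fun x => \sum_(i <- s) F i x).
Proof.
elim: s => [_|i s IH H]; first by under eq_fun do rewrite big_nil; exact: cL2_0.
under eq_fun do rewrite big_cons; apply: cL2D; first by apply: H; rewrite mem_head.
by apply: IH => j js; apply: H; rewrite inE js orbT.
Qed.

Lemma cL2_comb (I : eqType) (s : seq I) (c : I -> R[i]) (F : I -> T -> R[i]) :
  (forall i, i \in s -> cL2 mu (F i)) ->
  cL2 mu (fun x => \sum_(i <- s) c i * F i x).
Proof. by move=> H; apply: cL2_sum => i /H; exact: cL2Z. Qed.

Lemma cL2_measurable f : cL2 mu f -> cmeasurable f.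
Proof. by case. Qed.

Definition cintegrable f := mu.-integrable setT (fun x => (complex.Re (f x))%:E) /\
  mu.-integrable setT (fun x => (complex.Im (f x))%:E).

Lemma cintegrable_measurable f : cintegrable f -> cmeasurable f.
Proof.
by move=> [/integrableP[m1 _] /integrableP[m2 _]]; split; exact/measurable_EFinP.
Qed.

Lemma cintegrable_le f (b : T -> R) : cmeasurable f ->
  mu.-integrable setT (EFin \o b) ->
  (forall x, `|complex.Re (f x)| <= b x) -> (forall x, `|complex.Im (f x)| <= b x) ->
  cintegrable f.
Proof.
move=> [m1 m2] ib b1 b2; split; apply: (le_integrable measurableT _ _ ib).
- exact/measurable_EFinP.
- by move=> x _; rewrite /= lee_fin (le_trans (b1 x))// ler_norm.
- exact/measurable_EFinP.
- by move=> x _; rewrite /= lee_fin (le_trans (b2 x))// ler_norm.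
Qed.

Lemma cL2_mul_conj f g : cL2 mu f -> cL2 mu g ->
  cintegrable (fun x => f x * conjc (g x)).
Proof.
move=> Lf Lg; apply: (@cintegrable_le _ (fun x => csq (f x) + csq (g x))).
- by apply: cmeasurableM; [|apply: cmeasurable_conj]; exact: cL2_measurable.
- rewrite (_ : _ \o _ = (fun x => (csq (f x))%:E + (csq (g x))%:E)%E)//.
  by apply: integrableD => //; exact: cL2_integrable.
- by move=> x; exact: Re_mul_conj_le.
- by move=> x; exact: Im_mul_conj_le.
Qed.

Lemma cintegrableZ a f : cintegrable f -> cintegrable (fun x => a * f x).
Proof.
move=> [f1 f2]; split.
  under eq_fun do rewrite ReM EFinB !EFinM.
  by apply: integrableB => //; exact: integrableZl.
under eq_fun do rewrite ImM EFinD !EFinM.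
by apply: integrableD => //; exact: integrableZl.
Qed.

Lemma cintegralD f g : cintegrable f -> cintegrable g ->
  cintegral mu (fun x => f x + g x) = cintegral mu f + cintegral mu g.
Proof.
move=> [f1 f2] [g1 g2]; apply: complex_eqP; rewrite /cintegral /=.
  by under eq_Rintegral do rewrite ReD; rewrite RintegralD.
by under eq_Rintegral do rewrite ImD; rewrite RintegralD.
Qed.

Lemma cintegralZ a f : cintegrable f ->
  cintegral mu (fun x => a * f x) = a * cintegral mu f.
Proof.
move=> [f1 f2]; apply: complex_eqP; rewrite ?ReM ?ImM /cintegral /=.
  under eq_Rintegral do rewrite ReM.
  rewrite RintegralB ?RintegralZl//; do 1?
  by under [X in _.-integrable _ X]eq_fun do rewrite /= EFinM; exact: integrableZl.
under eq_Rintegral do rewrite ImM.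
rewrite RintegralD ?RintegralZl//; do 1?
by under [X in _.-integrable _ X]eq_fun do rewrite /= EFinM; exact: integrableZl.
Qed.

Lemma cintegral_conj f : cintegrable f ->
  cintegral mu (fun x => conjc (f x)) = conjc (cintegral mu f).
Proof.
move=> [f1 f2]; apply: complex_eqP; rewrite ?Re_conj ?Im_conj /cintegral /=.
  by apply: eq_Rintegral => x _; rewrite Re_conj.
rewrite -mulN1r -RintegralZl//; apply: eq_Rintegral => x _.
by rewrite Im_conj mulN1r.
Qed.

Lemma ae_eq_cintegral f g : cmeasurable f -> cmeasurable g ->
  f = g %[ae mu] -> cintegral mu f = cintegral mu g.
Proof.
move=> [f1 f2] [g1 g2] fg; rewrite /cintegral /Rintegral.
congr (Complex (fine _) (fine _)); apply: ae_eq_integral => //;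
  do 1?exact/measurable_EFinP.
  by apply: filterS fg => x /= /[apply] ->.
by apply: filterS fg => x /= /[apply] ->.
Qed.

Lemma inner_lin a f g h : cL2 mu f -> cL2 mu g -> cL2 mu h ->
  inner mu (fun x => a * f x + g x) h = a * inner mu f h + inner mu g h.
Proof.
move=> Lf Lg Lh; rewrite /inner -cintegralZ; last exact: cL2_mul_conj.
rewrite -cintegralD; last 2 first.
- by apply: cintegrableZ; exact: cL2_mul_conj.
- exact: cL2_mul_conj.
by congr cintegral; apply/funext => x; rewrite mulrDl mulrA.
Qed.

Lemma inner_conj f g : cL2 mu f -> cL2 mu g ->
  inner mu g f = conjc (inner mu f g).
Proof.
move=> Lf Lg; rewrite /inner -cintegral_conj; last exact: cL2_mul_conj.
by congr cintegral; apply/funext => x; rewrite conjcM conjcK mulrC.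
Qed.

Lemma inner0l h : inner mu (fun=> 0) h = 0.
Proof.
rewrite /inner /cintegral; apply: complex_eqP => /=.
  by under eq_Rintegral do rewrite mul0r; rewrite Rintegral_cst// mul0r.
by under eq_Rintegral do rewrite mul0r; rewrite Rintegral_cst// mul0r.
Qed.

Lemma innerZ a f h : cL2 mu f -> cL2 mu h ->
  inner mu (fun x => a * f x) h = a * inner mu f h.
Proof.
move=> Lf Lh; have := inner_lin a Lf cL2_0 Lh.
by under eq_fun do rewrite addr0; rewrite inner0l addr0.
Qed.

Lemma innerZr a f h : cL2 mu f -> cL2 mu h ->
  inner mu h (fun x => a * f x) = conjc a * inner mu h f.
Proof.
move=> Lf Lh; rewrite (inner_conj (cL2Z a Lf) Lh) innerZ// conjcM -inner_conj//.
Qed.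

Lemma innerD f g h : cL2 mu f -> cL2 mu g -> cL2 mu h ->
  inner mu (fun x => f x + g x) h = inner mu f h + inner mu g h.
Proof.
move=> Lf Lg Lh; have := inner_lin 1 Lf Lg Lh.
by under eq_fun do rewrite mul1r; rewrite mul1r.
Qed.

Lemma innerB f g h : cL2 mu f -> cL2 mu g -> cL2 mu h ->
  inner mu (fun x => f x - g x) h = inner mu f h - inner mu g h.
Proof.
move=> Lf Lg Lh; have := inner_lin (-1) Lg Lf Lh.
under eq_fun do rewrite mulN1r addrC.
by rewrite mulN1r addrC.
Qed.

Lemma innerDr f g h : cL2 mu f -> cL2 mu g -> cL2 mu h ->
  inner mu h (fun x => f x + g x) = inner mu h f + inner mu h g.
Proof.
move=> Lf Lg Lh; rewrite (inner_conj (cL2D Lf Lg) Lh) innerD// conjcD -!inner_conj//.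
Qed.

Lemma innerBr f g h : cL2 mu f -> cL2 mu g -> cL2 mu h ->
  inner mu h (fun x => f x - g x) = inner mu h f - inner mu h g.
Proof.
move=> Lf Lg Lh; rewrite (inner_conj (cL2B Lf Lg) Lh) innerB// conjcB -!inner_conj//.
Qed.

Lemma inner_suml (I : eqType) (s : seq I) (c : I -> R[i]) (F : I -> T -> R[i]) h :
  (forall i, i \in s -> cL2 mu (F i)) -> cL2 mu h ->
  inner mu (fun x => \sum_(i <- s) c i * F i x) h =
  \sum_(i <- s) c i * inner mu (F i) h.
Proof.
move=> + Lh; elim: s => [_|i s IH H].
  by rewrite big_nil; under eq_fun do rewrite big_nil; exact: inner0l.
under eq_fun do rewrite big_cons; rewrite big_cons inner_lin// ?IH//.
- by move=> j js; apply: H; rewrite inE js orbT.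
- by apply: H; rewrite mem_head.
- by apply: cL2_comb => j js; apply: H; rewrite inE js orbT.
Qed.

Lemma inner_sumr (I : eqType) (s : seq I) (c : I -> R[i]) (F : I -> T -> R[i]) h :
  (forall i, i \in s -> cL2 mu (F i)) -> cL2 mu h ->
  inner mu h (fun x => \sum_(i <- s) c i * F i x) =
  \sum_(i <- s) conjc (c i) * inner mu h (F i).
Proof.
move=> HF Lh; rewrite (inner_conj (cL2_comb c HF) Lh) inner_suml//.
rewrite conjc_sum big_seq [RHS]big_seq; apply: eq_bigr => i /HF Li.
by rewrite conjcM -inner_conj//.
Qed.

(** Taking the norm from [inner] makes its expansion a matter of sesquilinearity. By [nsqE] an
    infinite integral gives the value 0. *)
Definition nsq f : R := complex.Re (inner mu f f).

Lemma nsqE f : nsq f = fine (\int[mu]_x (csq (f x))%:E)%E.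
Proof.
rewrite /nsq /inner /cintegral /= /Rintegral; congr fine.
by apply: eq_integral => x _; rewrite mul_conjc.
Qed.

Lemma inner_self f : inner mu f f = (nsq f)%:C%C.
Proof.
apply: complex_eqP => //; rewrite /inner /cintegral /=.
by under eq_Rintegral do rewrite mul_conjc/=; rewrite Rintegral_cst// mul0r.
Qed.

Lemma nsq_ge0 f : 0 <= nsq f.
Proof.
by rewrite nsqE fine_ge0// integral_ge0// => x _; rewrite lee_fin csq_ge0.
Qed.

Lemma nsq_EFin f : cL2 mu f -> ((nsq f)%:E = \int[mu]_x (csq (f x))%:E)%E.
Proof.
move=> /cL2P[mf fi]; rewrite nsqE fineK// ge0_fin_numE//.
by apply: integral_ge0 => x _; rewrite lee_fin csq_ge0.
Qed.

Definition nrm f : R := Num.sqrt (nsq f).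

Lemma nrm_ge0 f : 0 <= nrm f. Proof. exact: sqrtr_ge0. Qed.

Lemma nrm_sq f : nrm f ^+ 2 = nsq f.
Proof. by rewrite sqr_sqrtr ?nsq_ge0. Qed.

Lemma cLnorm_nrm f : cL2 mu f -> cLnorm mu 2%:E f = (nrm f)%:E.
Proof.
move=> Lf; rewrite cLnorm2E -nsq_EFin// poweR_EFin; congr EFin.
by rewrite powR12_sqrt// nsq_ge0.
Qed.

Lemma L2_dist_nrm f g : cL2 mu f -> cL2 mu g ->
  L2_dist mu f g = (nrm (fun x => f x - g x))%:E.
Proof. by move=> Lf Lg; rewrite /L2_dist cLnorm_nrm//; exact: cL2B. Qed.

Lemma nsqD f g : cL2 mu f -> cL2 mu g ->
  nsq (fun x => f x + g x) = nsq f + nsq g + 2 * complex.Re (inner mu f g).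
Proof.
move=> Lf Lg; rewrite /nsq innerD ?innerDr//; last exact: cL2D.
rewrite (inner_conj Lf Lg) !ReD Re_conj; ring.
Qed.

Lemma nsqZ a f : cL2 mu f -> nsq (fun x => a * f x) = csq a * nsq f.
Proof.
move=> Lf; rewrite /nsq innerZ ?innerZr//; last exact: cL2Z.
by rewrite mulrA mul_conjc ReM /= mul0r subr0.
Qed.

Lemma nrmZ a f : cL2 mu f -> nrm (fun x => a * f x) = Normc.normc a * nrm f.
Proof.
by move=> Lf; rewrite /nrm nsqZ// sqrtrM ?csq_ge0// normcE.
Qed.

Lemma cauchy_schwarz_sq f g : cL2 mu f -> cL2 mu g ->
  csq (inner mu f g) <= nsq f * nsq g.
Proof.
move=> Lf Lg; set z := inner mu f g.
(* The expression is the squared norm of [f - t z g]; the factor [z] aligns the phase of the cross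
   term, so a real parameter [t] is enough. *)
have H (t : R) : 0 <= nsq f - 2 * t * csq z + t ^+ 2 * csq z * nsq g.
  have -> : nsq f - 2 * t * csq z + t ^+ 2 * csq z * nsq g =
      nsq (fun x => f x + (- (t%:C%C) * z) * g x).
    rewrite nsqD ?nsqZ ?innerZr//; last exact: cL2Z.
    rewrite -/z /csq; case: (z) => p q /=; ring.
  exact: nsq_ge0.
have z0 := csq_ge0 z; have f0 := nsq_ge0 f; have g0 := nsq_ge0 g.
have [g00|gp] := eqVneq (nsq g) 0; last first.
  have gp' : 0 < nsq g by rewrite lt_def gp.
  have := H (nsq g)^-1; set u := _^-1.
  have e : u * nsq g = 1 by rewrite mulVf.
  have -> : nsq f - 2 * u * csq z + u ^+ 2 * csq z * nsq g = nsq f - u * csq z.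
    have -> : u ^+ 2 * csq z * nsq g = u * csq z * (u * nsq g) by ring.
    by rewrite e; ring.
  by rewrite subr_ge0 mulrC ler_pdivrMr// mulrC.
rewrite g00 mulr0; have [->//|zn] := eqVneq (csq z) 0.
have zp : 0 < csq z by rewrite lt_def zn.
(* When [nsq g = 0] the expression is affine in [t], and this value of [t] makes it negative. *)
have := H ((nsq f + 1) / csq z); rewrite g00 mulr0 addr0.
rewrite -mulrA divfK ?gt_eqF//; nra.
Qed.

Lemma cauchy_schwarz f g : cL2 mu f -> cL2 mu g ->
  Normc.normc (inner mu f g) <= nrm f * nrm g.
Proof.
move=> Lf Lg; rewrite normcE /nrm -sqrtrM ?nsq_ge0//.
by rewrite ler_wsqrtr// cauchy_schwarz_sq.
Qed.

Lemma nrmD f g : cL2 mu f -> cL2 mu g ->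
  nrm (fun x => f x + g x) <= nrm f + nrm g.
Proof.
move=> Lf Lg; rewrite -ler_sqr ?nnegrE ?addr_ge0 ?nrm_ge0//.
have -> : (nrm f + nrm g) ^+ 2 = nsq f + nsq g + 2 * (nrm f * nrm g).
  by rewrite -!nrm_sq; ring.
rewrite nrm_sq nsqD// lerD2l ler_wpM2l//.
have := cauchy_schwarz Lf Lg; apply: le_trans.
rewrite normcE; apply: (le_trans (ler_norm _)); rewrite -sqrtr_sqr.
by rewrite ler_wsqrtr// /csq lerDl sqr_ge0.
Qed.

Lemma nrmN f : cL2 mu f -> nrm (fun x => - f x) = nrm f.
Proof.
move=> Lf; have := nrmZ (-1) Lf; under eq_fun do rewrite mulN1r.
by move=> ->; rewrite normcN Normc.normc1 mul1r.
Qed.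

Lemma nrm_trans f g h : cL2 mu f -> cL2 mu g -> cL2 mu h ->
  nrm (fun x => f x - h x) <= nrm (fun x => f x - g x) + nrm (fun x => g x - h x).
Proof.
move=> Lf Lg Lh; have := nrmD (cL2B Lf Lg) (cL2B Lg Lh).
by under eq_fun do rewrite addrA subrK.
Qed.

Lemma nrm_distC f g : cL2 mu f -> cL2 mu g ->
  nrm (fun x => f x - g x) = nrm (fun x => g x - f x).
Proof.
by move=> Lf Lg; rewrite -nrmN; [under eq_fun do rewrite opprB|exact: cL2B].
Qed.

Lemma nrm_sum (I : eqType) (s : seq I) (F : I -> T -> R[i]) :
  (forall i, i \in s -> cL2 mu (F i)) ->
  nrm (fun x => \sum_(i <- s) F i x) <= \sum_(i <- s) nrm (F i).
Proof.
elim: s => [_|i s IH H].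
  under eq_fun do rewrite big_nil; rewrite big_nil /nrm /nsq inner0l /=.
  by rewrite sqrtr0.
under eq_fun do rewrite big_cons; rewrite big_cons.
have Hs j : j \in s -> cL2 mu (F j) by move=> js; apply: H; rewrite inE js orbT.
apply: le_trans (nrmD _ _) _; first by apply: H; rewrite mem_head.
  exact: cL2_sum.
by rewrite lerD2l IH.
Qed.

Lemma nsq_eq0 f : cL2 mu f -> nsq f = 0 -> f = (fun=> 0) %[ae mu].
Proof.
move=> Lf f0; have := nsq_EFin Lf; rewrite f0 => /esym e.
have := ae_eq_integral_abs mu measurableT (measurable_ecsq (cL2_measurable Lf)).
move=> [+ _]; under eq_integral do rewrite gee0_abs ?lee_fin ?csq_ge0//.
by move=> /(_ e); apply: filterS => x /= /[apply] -[] /csq_eq0.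
Qed.

Lemma ae_eq_inner f f' g g' : cL2 mu f -> cL2 mu f' -> cL2 mu g -> cL2 mu g' ->
  f = f' %[ae mu] -> g = g' %[ae mu] -> inner mu f g = inner mu f' g'.
Proof.
move=> Lf Lf' Lg Lg' ff gg; apply: ae_eq_cintegral.
- exact: (cintegrable_measurable (cL2_mul_conj Lf Lg)).
- exact: (cintegrable_measurable (cL2_mul_conj Lf' Lg')).
- by apply: filterS2 ff gg => x /= + + xT => -> // ->.
Qed.

Lemma ae_eq_nsq f f' : cL2 mu f -> cL2 mu f' ->
  f = f' %[ae mu] -> nsq f = nsq f'.
Proof. by move=> Lf Lf' ff; rewrite /nsq (ae_eq_inner Lf Lf' Lf Lf'). Qed.

Lemma ae_eq_nrm f f' : cL2 mu f -> cL2 mu f' ->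
  f = f' %[ae mu] -> nrm f = nrm f'.
Proof. by move=> Lf Lf' ff; rewrite /nrm (ae_eq_nsq Lf Lf'). Qed.

End L2.

(** * Square-summable families *)

Section Ell2.
Context (R : realType) (I : choiceType).
Implicit Types (a b c : I -> R[i]) (r : I -> R) (s : {fset I}).

Lemma sum_le_esum r s : (forall i, 0 <= r i) ->
  ((\sum_(i <- s) r i)%:E <= \esum_(i in [set: I]) (r i)%:E)%E.
Proof.
move=> r0; apply: esum_ge; exists [set` s]; first by split => //; exact: finite_fset.
by rewrite fsbig_finite//= set_fsetK sumEFin.
Qed.

Lemma esum_le_bound r (M : \bar R) :
  (forall s, ((\sum_(i <- s) r i)%:E <= M)%E) ->
  (\esum_(i in [set: I]) (r i)%:E <= M)%E.
Proof.
move=> H; apply: ge_ereal_sup => _ [X [finX _] <-].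
by rewrite fsbig_finite//= sumEFin.
Qed.

Lemma sum_fsetD (V : nmodType) (r : I -> V) s s0 : (s0 `<=` s)%fset ->
  \sum_(i <- s) r i = \sum_(i <- s0) r i + \sum_(i <- (s `\` s0)%fset) r i.
Proof.
move=> s0s; rewrite (big_fsetID _ (mem s0)) /=; congr (_ + _).
  have -> : [fset x in s | x \in s0]%fset = s0; last by [].
  apply/fsetP => x; rewrite !inE /=; apply/andP/idP => [[] //|xs].
  by split=> //; exact: (fsubsetP s0s).
have -> : [fset x in s | x \notin s0]%fset = (s `\` s0)%fset; last by [].
by apply/fsetP => x; rewrite !inE /= andbC.
Qed.

(** A finite supremum of finite sums is nearly attained on some finite set, and nonnegativity
    preserves this on every larger one. It is the source of all Cauchy estimates along finite
    subsets. *)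
Lemma esum_adherent r : (forall i, 0 <= r i) ->
  (\esum_(i in [set: I]) (r i)%:E < +oo)%E -> forall e : R, 0 < e ->
  exists s0 : {fset I}, forall s, (s0 `<=` s)%fset ->
    fine (\esum_(i in [set: I]) (r i)%:E)%E - e < \sum_(i <- s) r i <=
    fine (\esum_(i in [set: I]) (r i)%:E)%E.
Proof.
move=> r0 roo e e0; set S := esum _ _.
have S0 : (0 <= S)%E by apply: esum_ge0 => i _; rewrite lee_fin.
have Sfin : S \is a fin_num by rewrite ge0_fin_numE.
have [_ [X [finX _] <-]] := ub_ereal_sup_adherent e0 Sfin.
rewrite -[X in (X - _)%E]/S fsbig_finite//= sumEFin.
rewrite -{1}(fineK Sfin) -EFinB lte_fin => HX.
exists (fset_set X) => s Xs; apply/andP; split; last first.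
  by rewrite -lee_fin fineK// sum_le_esum.
apply: (lt_le_trans HX); rewrite (sum_fsetD _ Xs) lerDl.
by apply: sumr_ge0 => i _.
Qed.

Definition has_csum a (l : R[i]) := forall e : R, 0 < e ->
  exists s0 : {fset I}, forall s, (s0 `<=` s)%fset ->
    Normc.normc (\sum_(i <- s) a i - l) < e.

Lemma has_csum_unique a l l' : has_csum a l -> has_csum a l' -> l = l'.
Proof.
move=> al al'; apply/eqP; rewrite -subr_eq0; apply/eqP; apply: Normc.eq0_normc.
apply/eqP; rewrite eq_le normc_ge0 andbT; apply/ler_addgt0Pl => e e0.
rewrite addr0; have e2 : 0 < e / 2 by rewrite divr_gt0.
have [s H] := al _ e2; have [s' H'] := al' _ e2.
have := H (s `|` s')%fset (fsubsetUl _ _); have := H' (s `|` s')%fset (fsubsetUr _ _).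
set S := \sum_(_ <- _) _ => h1 h2.
have -> : l - l' = (S - l') + - (S - l) by ring.
apply: (le_trans (le_normcD _ _)); rewrite normcN (splitr e).
by rewrite lerD// ltW.
Qed.

Lemma has_csumZ a l z : has_csum a l -> has_csum (fun i => z * a i) (z * l).
Proof.
move=> al e e0.
have n0 : 0 < Normc.normc z + 1 by rewrite ltr_wpDl// normc_ge0.
have [s0 H] := al (e / (Normc.normc z + 1)) (divr_gt0 e0 n0).
exists s0 => s /H; rewrite ltr_pdivlMr// => h.
rewrite -mulr_sumr -mulrBr Normc.normcM mulrC.
apply: le_lt_trans h; rewrite ler_wpM2l ?normc_ge0// lerDl ler01 //.
Qed.

Lemma has_csumD a a' l l' : has_csum a l -> has_csum a' l' ->
  has_csum (fun i => a i + a' i) (l + l').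
Proof.
move=> al al' e e0; have e2 : 0 < e / 2 by rewrite divr_gt0.
have [s H] := al _ e2; have [s' H'] := al' _ e2.
exists (s `|` s')%fset => t; rewrite fsubUset => /andP[/H h /H' h'].
rewrite big_split /= opprD addrACA.
by apply: (le_lt_trans (le_normcD _ _)); rewrite (splitr e) ltrD.
Qed.

Lemma normc_le_ReIm (z : R[i]) :
  Normc.normc z <= `|complex.Re z| + `|complex.Im z|.
Proof.
rewrite normcE -ler_sqr ?nnegrE ?sqrtr_ge0 ?addr_ge0//.
rewrite sqr_sqrtr ?csq_ge0// sqrrD !real_normK ?num_real// /csq.
by rewrite addrAC lerDl mulrn_wge0// mulr_ge0.
Qed.

Definition sumsq a : R := fine (\esum_(i in [set: I]) (csq (a i))%:E)%E.

Lemma ell2E a : ell2 a <-> (\esum_(i in [set: I]) (csq (a i))%:E < +oo)%E.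
Proof. rewrite /ell2 /=; have -> // : (fun i => ((Normc.normc (a i)) ^+ 2)%:E) =
  (fun i => (csq (a i))%:E); by apply/funext => i; rewrite normc_sq. Qed.

Lemma sumsq_ge0 a : 0 <= sumsq a.
Proof. by rewrite fine_ge0// esum_ge0// => i _; rewrite lee_fin csq_ge0. Qed.

Lemma sumsqE a : ell2 a ->
  ((sumsq a)%:E = \esum_(i in [set: I]) (csq (a i))%:E)%E.
Proof.
move=> /ell2E ha; rewrite fineK// ge0_fin_numE//.
by rewrite esum_ge0// => i _; rewrite lee_fin csq_ge0.
Qed.

Lemma sum_le_sumsq a s : ell2 a -> \sum_(i <- s) csq (a i) <= sumsq a.
Proof.
by move=> ha; rewrite -lee_fin sumsqE// sum_le_esum// => i; exact: csq_ge0.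
Qed.

Lemma ell2_le_bound a (M : R) : (forall s, \sum_(i <- s) csq (a i) <= M) ->
  ell2 a /\ sumsq a <= M.
Proof.
move=> H; have h : (\esum_(i in [set: I]) (csq (a i))%:E <= M%:E)%E.
  by apply: esum_le_bound => s; rewrite lee_fin.
have ha : ell2 a by apply/ell2E; apply: le_lt_trans h (ltry _).
by split=> //; rewrite -lee_fin sumsqE.
Qed.

(** The shape [a + z b] serves polarization, with [z] among 1, -1, i and -i. *)
Lemma ell2_lin z a b : ell2 a -> ell2 b -> ell2 (fun i => a i + z * b i) /\
  sumsq (fun i => a i + z * b i) <= 2 * sumsq a + 2 * csq z * sumsq b.
Proof.
move=> ha hb; apply: ell2_le_bound => s.
apply: (@le_trans _ _ (\sum_(i <- s) (2 * csq (a i) + 2 * csq z * csq (b i)))).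
  apply: ler_sum => i _; apply: le_trans (csqD _ _) _.
  by rewrite csqM mulrDr mulrA.
rewrite big_split /= -!mulr_sumr lerD// ler_wpM2l ?sum_le_sumsq//.
by rewrite mulr_ge0// csq_ge0.
Qed.

Lemma has_csum_sq a b : ell2 a -> ell2 b ->
  forall e : R, 0 < e -> exists s0 : {fset I}, forall s, (s0 `<=` s)%fset ->
   `| \sum_(i <- s) csq (a i) - sumsq a | < e /\
   `| \sum_(i <- s) csq (b i) - sumsq b | < e.
Proof.
move=> ha hb e e0.
have [s h] := esum_adherent (fun i => csq_ge0 (a i)) ((ell2E a).1 ha) e0.
have [t k] := esum_adherent (fun i => csq_ge0 (b i)) ((ell2E b).1 hb) e0.
exists (s `|` t)%fset => u; rewrite fsubUset => /andP[/h /andP[h1 h2] /k /andP[k1 k2]].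
rewrite -/(sumsq a) in h1 h2; rewrite -/(sumsq b) in k1 k2.
by split; rewrite ltr_norml; apply/andP; split; lra.
Qed.

(* Polarization: the real and imaginary parts of [sum a conj(b)] are written as
   differences of sums of nonnegative terms. *)
Definition ell2_inner a b : R[i] :=
  Complex ((sumsq (fun i => a i + 1 * b i) - sumsq (fun i => a i + (-1) * b i)) / 4)
    ((sumsq (fun i => a i + 'i%C * b i) - sumsq (fun i => a i + (- 'i%C) * b i)) / 4).

Lemma polar_Re (z w : R[i]) : complex.Re (z * conjc w) =
  (csq (z + 1 * w) - csq (z + (-1) * w)) / 4.
Proof. by case: z w => x y [u v]; rewrite /csq /=; field. Qed.

Lemma polar_Im (z w : R[i]) : complex.Im (z * conjc w) =
  (csq (z + 'i%C * w) - csq (z + (- 'i%C) * w)) / 4.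
Proof. by case: z w => x y [u v]; rewrite /csq /=; field. Qed.

Lemma Re_sum (J : Type) (s : seq J) (F : J -> R[i]) :
  complex.Re (\sum_(i <- s) F i) = \sum_(i <- s) complex.Re (F i).
Proof. by elim: s => [|i s IH]; rewrite ?big_nil// !big_cons ReD IH. Qed.

Lemma Im_sum (J : Type) (s : seq J) (F : J -> R[i]) :
  complex.Im (\sum_(i <- s) F i) = \sum_(i <- s) complex.Im (F i).
Proof. by elim: s => [|i s IH]; rewrite ?big_nil// !big_cons ImD IH. Qed.

Lemma ell2_inner_sum a b : ell2 a -> ell2 b ->
  has_csum (fun i => a i * conjc (b i)) (ell2_inner a b).
Proof.
move=> ha hb e e0.
have H z := (ell2_lin z ha hb).1.
have [s h] := has_csum_sq (H 1) (H (-1)) e0.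
have [t k] := has_csum_sq (H 'i%C) (H (- 'i%C)) e0.
exists (s `|` t)%fset => u; rewrite fsubUset => /andP[/h [h1 h2] /k [k1 k2]].
apply: le_lt_trans (normc_le_ReIm _) _.
rewrite !raddfB /= Re_sum Im_sum.
under eq_bigr do rewrite polar_Re; under [X in _ + `|X - _|]eq_bigr do rewrite polar_Im.
rewrite -!mulr_suml !sumrB; move: h1 h2 k1 k2.
move: (\sum_(_ <- _) _) => s1; move: (\sum_(_ <- _) _) => s2.
move: (\sum_(_ <- _) _) => s3; move: (\sum_(_ <- _) _) => s4.
move: (sumsq _) (sumsq _) (sumsq _) (sumsq _) => q1 q2 q3 q4.
rewrite !ltr_norml => /andP[h1 h1'] /andP[h2 h2'] /andP[h3 h3'] /andP[h4 h4'].
(* Two errors below [e] divided by 4: each coordinate contributes at most [e / 2]. *)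
have A1 : `|(s1 - s2) / 4 - (q4 - q3) / 4| < e / 2.
  by rewrite ltr_norml; apply/andP; split; lra.
have A2 : `|(s3 - s4) / 4 - (q2 - q1) / 4| < e / 2.
  by rewrite ltr_norml; apply/andP; split; lra.
by rewrite (splitr e) ltrD.
Qed.

Lemma ell2_innerZl z a b : ell2 a -> ell2 b ->
  ell2_inner (fun i => z * a i) b = z * ell2_inner a b.
Proof.
move=> ha hb; have h0 : ell2 (fun _ : I => 0 : R[i]).
  apply/ell2E; rewrite esum1 ?ltry// => i _; by rewrite csq0.
have hz : ell2 (fun i => z * a i).
  by have := (ell2_lin z h0 ha).1; under eq_fun do rewrite add0r.
apply: (has_csum_unique (ell2_inner_sum hz hb)).
have := has_csumZ z (ell2_inner_sum ha hb).
by under eq_fun do rewrite mulrA.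
Qed.

Lemma ell2_inner_conj a b : ell2 a -> ell2 b ->
  ell2_inner b a = conjc (ell2_inner a b).
Proof.
move=> ha hb; apply: (has_csum_unique (ell2_inner_sum hb ha)) => e e0.
have [s H] := ell2_inner_sum ha hb e0; exists s => t /H.
rewrite [in X in X -> _]normcE -csq_conj -normcE conjcB conjc_sum.
by under [X in Normc.normc (X - _) < _ -> _]eq_bigr do rewrite conjcM conjcK mulrC.
Qed.

Lemma ell2Z z a : ell2 a -> ell2 (fun i => z * a i).
Proof.
move=> ha; have h0 : ell2 (fun _ : I => 0 : R[i]).
  apply/ell2E; rewrite esum1 ?ltry// => i _; by rewrite csq0.
by have := (ell2_lin z h0 ha).1; under eq_fun do rewrite add0r.
Qed.

Lemma ell2_innerZr z a b : ell2 a -> ell2 b ->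
  ell2_inner a (fun i => z * b i) = conjc z * ell2_inner a b.
Proof.
move=> ha hb; rewrite (ell2_inner_conj (ell2Z z hb) ha) ell2_innerZl//.
by rewrite conjcM -(ell2_inner_conj hb ha).
Qed.

Lemma ell2_innerD a a' b : ell2 a -> ell2 a' -> ell2 b ->
  ell2_inner (fun i => a i + a' i) b = ell2_inner a b + ell2_inner a' b.
Proof.
move=> ha ha' hb; have hs : ell2 (fun i => a i + a' i).
  by have := (ell2_lin 1 ha ha').1; under eq_fun do rewrite mul1r.
apply: (has_csum_unique (ell2_inner_sum hs hb)).
have := has_csumD (ell2_inner_sum ha hb) (ell2_inner_sum ha' hb).
by under eq_fun do rewrite -mulrDl.
Qed.

Lemma Re_le_normc (z : R[i]) : complex.Re z <= Normc.normc z.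
Proof.
apply: (le_trans (ler_norm _)); rewrite -sqrtr_sqr normcE.
by rewrite ler_wsqrtr// /csq lerDl sqr_ge0.
Qed.

Lemma csq_sum_le (J : Type) (s : seq J) (c e : J -> R[i]) :
  csq (\sum_(i <- s) c i * e i) <=
  (\sum_(i <- s) csq (c i)) * (\sum_(i <- s) csq (e i)).
Proof.
elim: s => [|i s IH]; first by rewrite !big_nil csq0 mul0r.
rewrite !big_cons; set S := \sum_(_ <- _) _ in IH *.
set A := \sum_(_ <- _) _ in IH *; set D := \sum_(_ <- _) csq (e _) in IH *.
have A0 : 0 <= A by apply: sumr_ge0 => j _; exact: csq_ge0.
have D0 : 0 <= D by apply: sumr_ge0 => j _; exact: csq_ge0.
rewrite -(normc_sq (c i)) -(normc_sq (e i)) -normc_sq; rewrite -normc_sq in IH.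
have := le_normcD (c i * e i) S; rewrite Normc.normcM.
move: (normc_ge0 (c i)) (normc_ge0 (e i)) (normc_ge0 S) (normc_ge0 (c i * e i + S)).
move: (Normc.normc (c i * e i + S)) => n.
move: (Normc.normc (c i)) (Normc.normc (e i)) (Normc.normc S) IH => x y u.
move=> uAD x0 y0 u0 n0 nle.
(* After squaring this is [u ^+ 2 <= A * D] together with [4 p q <= (p + q)^2] for [p = x^2 D] and
   [q = A y^2]. *)
have key : 2 * (x * y * u) <= x ^+ 2 * D + A * y ^+ 2.
  rewrite -ler_sqr ?nnegrE; last 2 first.
  - by rewrite !mulr_ge0.
  - by rewrite addr_ge0// mulr_ge0// sqr_ge0.
  apply: (@le_trans _ _ (4 * (x ^+ 2 * y ^+ 2 * (A * D)))).
    have -> : (2 * (x * y * u)) ^+ 2 = 4 * (x ^+ 2 * y ^+ 2 * u ^+ 2) by ring.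
    by rewrite ler_wpM2l// ler_wpM2l// mulr_ge0// sqr_ge0.
  rewrite -subr_ge0.
  have -> : (x ^+ 2 * D + A * y ^+ 2) ^+ 2 - 4 * (x ^+ 2 * y ^+ 2 * (A * D)) =
    (x ^+ 2 * D - A * y ^+ 2) ^+ 2 by ring.
  exact: sqr_ge0.
apply: (@le_trans _ _ ((x * y + u) ^+ 2)).
  by rewrite ler_sqr ?nnegrE// addr_ge0// mulr_ge0.
have -> : (x * y + u) ^+ 2 = x ^+ 2 * y ^+ 2 + 2 * (x * y * u) + u ^+ 2 by ring.
have -> : (x ^+ 2 + A) * (y ^+ 2 + D) =
  x ^+ 2 * y ^+ 2 + (x ^+ 2 * D + A * y ^+ 2) + A * D by ring.
by rewrite !lerD.
Qed.

Lemma ell2_inner_le a b : ell2 a -> ell2 b ->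
  Normc.normc (ell2_inner a b) <= Num.sqrt (sumsq a * sumsq b).
Proof.
move=> ha hb; apply/ler_addgt0Pr => e e0.
have [s /(_ s (fsubset_refl _))] := ell2_inner_sum ha hb e0.
set S := \sum_(_ <- _) _ => h.
have -> : ell2_inner a b = S - (S - ell2_inner a b) by rewrite opprB addrC addrNK.
apply: (le_trans (le_normcD _ _)); rewrite normcN lerD//; last exact: ltW.
rewrite normcE ler_wsqrtr//; apply: le_trans (csq_sum_le _ _ _) _.
rewrite ler_pM ?sum_le_sumsq//.
- by apply: sumr_ge0 => j _; exact: csq_ge0.
- by apply: sumr_ge0 => j _; exact: csq_ge0.
- by under eq_bigr do rewrite csq_conj; exact: sum_le_sumsq.
Qed.

End Ell2.

(** * Bessel families and Gram matrices *)

Section Families.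
Context d (T : measurableType d) (R : realType).
Variable mu : {measure set T -> \bar R}.
Context (I : choiceType).
Implicit Types (F E : I -> T -> R[i]) (f g h : T -> R[i]) (c : I -> R[i]).
Implicit Types (s : {fset I}).

Lemma L2_has_sumP F g : (forall i, cL2 mu (F i)) -> cL2 mu g ->
  L2_has_sum mu F g <-> forall e : R, 0 < e -> exists s0 : {fset I},
    forall s, (s0 `<=` s)%fset -> nrm mu (fun x => \sum_(i <- s) F i x - g x) < e.
Proof.
move=> HF Lg; have LF s : cL2 mu (fun x => \sum_(i <- s) F i x).
  by apply: cL2_sum.
split=> [[_ H] e e0|H].
  have := H [set y | (y < e%:E)%E]; case.
    rewrite /nbhs /= /ereal_nbhs /=; apply/nbhs_ballP; exists e => //= y.
    rewrite /ball /= sub0r normrN => hy; rewrite lte_fin.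
    exact: le_lt_trans (ler_norm _) hy.
  move=> s0 _ hs; exists s0 => s /hs /=.
  by rewrite L2_dist_nrm.
split=> // A; rewrite /nbhs /= /ereal_nbhs /= => /nbhs_ballP[e /= e0 He].
have [s0 hs] := H e e0; exists s0 => // s /hs /= hn.
have -> : A (L2_dist mu (fun x => \sum_(i <- s) F i x) g) =
   A (nrm mu (fun x => \sum_(i <- s) F i x - g x))%:E by rewrite L2_dist_nrm.
by apply: He; rewrite /ball /= sub0r normrN ger0_norm// nrm_ge0.
Qed.

Lemma closed_spanP F f : (forall i, cL2 mu (F i)) ->
  closed_span mu F f <-> cL2 mu f /\ forall e : R, 0 < e ->
    exists s c, nrm mu (fun x => f x - \sum_(i <- s) c i * F i x) < e.
Proof.
move=> HF; split=> -[Lf H]; split=> // e /H [s [c hs]]; exists s, c;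
  move: hs; rewrite L2_dist_nrm//; try exact: cL2_comb; by rewrite lte_fin.
Qed.

(** The map [i] may identify indices, so coefficients over a common image are added up. This is
    needed in a fiber, where all modulations of one [Psi t] become multiples of the same vector. *)
Lemma closed_span_comb F (J : choiceType) (i : J -> I) (s : {fset J}) (c : J -> R[i]) :
  (forall i, cL2 mu (F i)) ->
  closed_span mu F (fun x => \sum_(j <- s) c j * F (i j) x).
Proof.
move=> HF; have Ls : cL2 mu (fun x => \sum_(j <- s) c j * F (i j) x).
  by apply: cL2_comb.
apply/closed_spanP => //; split=> // e e0.
exists [fset i j | j in s]%fset, (fun k => \sum_(j <- s | i j == k) c j).
rewrite (_ : (fun x => _) = fun=> 0); first by rewrite /nrm /nsq inner0l /= sqrtr0.
apply/funext => x; apply/eqP; rewrite subr_eq0; apply/eqP.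
under [RHS]eq_bigr do rewrite mulr_suml.
rewrite (exchange_big_dep xpredT) //=.
rewrite big_seq [RHS]big_seq; apply: eq_bigr => j js.
rewrite big_mkcond (big_fsetD1 (i j)) /=; last by apply/imfsetP; exists j.
rewrite eqxx big1_fset ?addr0// => k; rewrite !inE => /andP[/negPf kn _] _.
by rewrite eq_sym kn.
Qed.

Lemma closed_span_mem F i : (forall i, cL2 mu (F i)) -> closed_span mu F (F i).
Proof.
move=> HF; have := closed_span_comb (fun j : I => j) [fset i]%fset (fun=> 1) HF.
by under eq_fun do rewrite big_seq_fset1 mul1r.
Qed.

Definition bessel_bound (B : R) F := forall f s, cL2 mu f ->
  \sum_(i <- s) csq (inner mu f (F i)) <= B * nsq mu f.

Lemma analysis_ell2 B F f : bessel_bound B F -> cL2 mu f ->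
  ell2 (analysis mu F f) /\ sumsq (analysis mu F f) <= B * nsq mu f.
Proof. by move=> HB Lf; apply: ell2_le_bound => s; exact: HB. Qed.

Lemma frame_sumE F f : frame_sum mu F f =
  (\esum_(i in [set: I]) (csq (inner mu f (F i)))%:E)%E.
Proof. by apply: eq_esum => i _; rewrite normc_sq. Qed.

Lemma bessel_boundP F : bessel mu F <-> exists2 B : R, 0 < B & bessel_bound B F.
Proof.
split=> -[B B0 H]; exists B => // f.
  move=> s Lf; have := H f Lf; rewrite frame_sumE cLnorm2_sq -nsq_EFin// -EFinM.
  rewrite -lee_fin; apply: le_trans.
  by apply: (@sum_le_esum _ _ (fun i => csq (inner mu f (F i)))) => i; exact: csq_ge0.
move=> Lf; rewrite frame_sumE cLnorm2_sq -nsq_EFin// -EFinM.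
by apply: esum_le_bound => s; rewrite lee_fin H.
Qed.

Definition synthesis_bound (B : R) F := forall s c,
  nsq mu (fun x => \sum_(i <- s) c i * F i x) <= B * \sum_(i <- s) csq (c i).

(** The only vector tested is the combination [g] itself, which lies in the span: expanding one
    factor of [<g, g>] and applying Cauchy-Schwarz gives [|g|^4 <= C B |g|^2], with [C] the squared
    norm of the coefficients. *)
Lemma span_bound_synthesis B F : 0 <= B -> (forall i, cL2 mu (F i)) ->
  (forall f s, closed_span mu F f ->
     \sum_(i <- s) csq (inner mu f (F i)) <= B * nsq mu f) ->
  synthesis_bound B F.
Proof.
move=> B0 HF H s c; set g := fun x => _; have Lg : cL2 mu g by apply: cL2_comb.
have Sg : closed_span mu F g.
  by have := closed_span_comb (fun j : I => j) s c HF.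
have := csq_sum_le s c (fun i => inner mu (F i) g).
rewrite -inner_suml// -/g inner_self.
have -> : csq (nsq mu g)%:C%C = nsq mu g ^+ 2 by rewrite /csq /= [0 ^+ 2]expr2 mul0r addr0.
set C := \sum_(i <- s) csq (c i).
have C0 : 0 <= C by apply: sumr_ge0 => i _; exact: csq_ge0.
have g0 := nsq_ge0 mu g.
have -> : \sum_(i <- s) csq (inner mu (F i) g) = \sum_(i <- s) csq (inner mu g (F i)).
  by apply: eq_bigr => i _; rewrite (inner_conj Lg (HF i)) csq_conj.
have := H g s Sg; set S := \sum_(i <- s) _ => h1 h2.
have h3 : nsq mu g ^+ 2 <= C * (B * nsq mu g).
  by apply: le_trans h2 _; rewrite ler_wpM2l.
have [->|gn] := eqVneq (nsq mu g) 0; first by rewrite mulr_ge0.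
have gp : 0 < nsq mu g by rewrite lt_def gn.
rewrite -(ler_pM2r gp) -expr2; apply: (le_trans h3).
by rewrite mulrA (mulrC C).
Qed.

(** Duality: the Bessel sum [S] equals the pairing of [f] with the combination whose coefficients
    are [<f, F_i>], hence [S^2 <= |f|^2 B S]. *)
Lemma synthesis_bessel B F : 0 <= B -> (forall i, cL2 mu (F i)) ->
  synthesis_bound B F -> bessel_bound B F.
Proof.
move=> B0 HF H f s Lf; set c := fun i => inner mu f (F i).
set S := \sum_(i <- s) _; have S0 : 0 <= S by apply: sumr_ge0 => i _; exact: csq_ge0.
have Lc : cL2 mu (fun x => \sum_(i <- s) c i * F i x) by apply: cL2_comb.
have := cauchy_schwarz_sq Lf Lc.
rewrite inner_sumr//.
have -> : \sum_(i <- s) conjc (c i) * inner mu f (F i) = S%:C%C.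
  rewrite rmorph_sum; apply: eq_bigr => i _.
  by rewrite mulrC; exact: mul_conjc.
have -> : csq S%:C%C = S ^+ 2 by rewrite /csq /= [0 ^+ 2]expr2 mul0r addr0.
have := H s c; rewrite -/S => h1 h2.
have [->|Sn] := eqVneq S 0; first by rewrite mulr_ge0// nsq_ge0.
have Sp : 0 < S by rewrite lt_def Sn.
rewrite -(ler_pM2r Sp) -expr2; apply: (le_trans h2).
rewrite (mulrC B) -mulrA ler_wpM2l// nsq_ge0//.
Qed.

Lemma bessel_synthesis B F : 0 <= B -> (forall i, cL2 mu (F i)) ->
  bessel_bound B F -> synthesis_bound B F.
Proof.
by move=> B0 HF H; apply: span_bound_synthesis => // f s [Lf _]; exact: H.
Qed.

(** A subspace frame bounds the analysis sums on the closed span only. Passing to the synthesis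
    bound and back extends the bound to all of L^2 with the same constant, in place of an orthogonal
    projection. *)
Lemma frame_bessel_bound F : (forall i, cL2 mu (F i)) ->
  subspace_frame mu (closed_span mu F) F -> exists2 B : R, 0 < B & bessel_bound B F.
Proof.
move=> HF [A [B [A0 AB H]]]; have B0 : 0 < B by exact: lt_le_trans A0 AB.
exists B => //; apply: synthesis_bessel => //; first exact: ltW.
apply: span_bound_synthesis => //; first exact: ltW.
move=> f s Sf; have [Lf _] := Sf; have /andP[_] := H f Sf.
rewrite frame_sumE cLnorm2_sq -nsq_EFin// -EFinM -lee_fin; apply: le_trans.
by apply: (@sum_le_esum _ _ (fun i => csq (inner mu f (F i)))) => i; exact: csq_ge0.
Qed.

Section Bessel.
Variables (B : R) (F : I -> T -> R[i]).
Hypotheses (B0 : 0 <= B) (HF : forall i, cL2 mu (F i)) (HB : bessel_bound B F).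

Lemma cL2_fcomb s c : cL2 mu (fun x => \sum_(i <- s) c i * F i x).
Proof. by apply: cL2_comb. Qed.

Lemma synthesis_cauchy c : ell2 c -> forall e : R, 0 < e ->
  exists s0 : {fset I}, forall s, (s0 `<=` s)%fset ->
  nrm mu (fun x => \sum_(i <- s) c i * F i x - \sum_(i <- s0) c i * F i x) < e.
Proof.
move=> hc e e0.
(* The tail of the coefficients is made small enough that [B] times it stays below [e^2]; [B + 1] is
   a nonzero denominator even if [B = 0]. *)
have e1 : 0 < e ^+ 2 / (B + 1) by rewrite divr_gt0 ?exprn_gt0// ltr_wpDl.
have [s0 h] := esum_adherent (fun i => csq_ge0 (c i)) ((ell2E c).1 hc) e1.
exists s0 => s s0s; have /andP[h1 _] := h s0 (fsubset_refl _).
have /andP[_ h2] := h s s0s.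
set g := fun x => _; have gE : g = fun x => \sum_(i <- (s `\` s0)%fset) c i * F i x.
  by apply/funext => x; rewrite /g (sum_fsetD _ s0s) addrC addKr.
rewrite gE -ltr_sqr ?nnegrE ?nrm_ge0// ?ltW// nrm_sq.
apply: le_lt_trans (bessel_synthesis B0 HF HB _ _) _.
move: h1 h2; rewrite (sum_fsetD _ s0s).
set S := \sum_(i <- (s `\` s0)%fset) _; set Q := fine _ => h1 h2.
have hS : S < e ^+ 2 / (B + 1).
  by move: h1 h2; set t := \sum_(i <- s0) _ => *; lra.
rewrite ltr_pdivlMr in hS; last by rewrite ltr_wpDl.
have S0 : 0 <= S by apply: sumr_ge0 => i _; exact: csq_ge0.
nra.
Qed.

Lemma has_sum_inner c g h : ell2 c -> cL2 mu h ->
  L2_has_sum mu (fun i x => c i * F i x) g ->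
  inner mu g h = ell2_inner c (analysis mu F h).
Proof.
move=> hc Lh Hs; have Lg := Hs.1.
have := (L2_has_sumP (fun i => cL2Z (c i) (HF i)) Lg).1 Hs => {}Hs.
have [ha _] := analysis_ell2 HB Lh.
apply: (has_csum_unique _ (ell2_inner_sum hc ha)) => e e0.
have n0 : 0 < nrm mu h + 1 by rewrite ltr_wpDl// nrm_ge0.
have [s0 H] := Hs _ (divr_gt0 e0 n0); exists s0 => s /H hs.
have Ls := cL2_fcomb s c.
have -> : \sum_(i <- s) c i * conjc (analysis mu F h i) - inner mu g h =
    inner mu (fun x => \sum_(i <- s) c i * F i x - g x) h.
  rewrite innerB// inner_suml//; congr (_ - _); apply: eq_bigr => i _.
  by rewrite /analysis -inner_conj.
apply: le_lt_trans (cauchy_schwarz (cL2B Ls Lg) Lh) _.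
move: hs; rewrite ltr_pdivlMr//; apply: le_lt_trans.
by rewrite ler_wpM2l ?nrm_ge0// lerDl.
Qed.

Lemma analysis_lin a f g : cL2 mu f -> cL2 mu g ->
  analysis mu F (fun x => a * f x + g x) =
  (fun i => a * analysis mu F f i + analysis mu F g i).
Proof. by move=> Lf Lg; apply/funext => i; rewrite /analysis inner_lin. Qed.

Lemma analysisB f g : cL2 mu f -> cL2 mu g ->
  analysis mu F (fun x => f x - g x) =
  (fun i => analysis mu F f i - analysis mu F g i).
Proof. by move=> Lf Lg; apply/funext => i; rewrite /analysis innerB. Qed.

Lemma ell2_inner_comb0 (J : eqType) (s : seq J) (a : J -> R[i])
    (H : J -> T -> R[i]) b :
  ell2 b -> (forall j, cL2 mu (H j)) ->
  (forall j, ell2_inner (analysis mu F (H j)) b = 0) ->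
  ell2_inner (analysis mu F (fun x => \sum_(j <- s) a j * H j x)) b = 0.
Proof.
move=> hb LH H0; elim: s => [|j s IH].
  under eq_fun do rewrite big_nil.
  have [h0 _] := analysis_ell2 HB (cL2_0 mu).
  have -> : analysis mu F (fun=> 0) = (fun i => 0 * analysis mu F (fun=> 0) i).
    by apply/funext => i; rewrite mul0r /analysis inner0l.
  by rewrite ell2_innerZl// mul0r.
under eq_fun do rewrite big_cons.
have Ls : cL2 mu (fun x => \sum_(j <- s) a j * H j x) by apply: cL2_comb.
have [hj _] := analysis_ell2 HB (LH j); have [hs _] := analysis_ell2 HB Ls.
rewrite analysis_lin// ell2_innerD//; last exact: ell2Z.
by rewrite ell2_innerZl// H0 mulr0 add0r.
Qed.

(** For the converse, compare a late partial sum [x] with a fixed one [x0] close to it. The products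
    [<x, x0>] tend to the pairing of [c] with the analysis of [x0], which vanishes since [x0]
    combines the [F k]. Then [|x|^2 = Re <x, x - x0> + Re <x, x0>] is small, and the argument stays
    within partial sums. *)
Lemma has_sum0P c : ell2 c ->
  L2_has_sum mu (fun i x => c i * F i x) (fun=> 0) <->
  forall k, ell2_inner c (analysis mu F (F k)) = 0.
Proof.
move=> hc; split=> [H k|H]; first by rewrite -(has_sum_inner hc (HF k) H) inner0l.
apply/L2_has_sumP; [by move=> i; exact: cL2Z|exact: cL2_0|].
under eq_forall do under eq_forall do under eq_exists do under eq_forall do
  under eq_fun do rewrite subr0.
(* Half of [e], because [t^2 <= t e1 + e1^2] forces [t < 2 e1]. *)
move=> e e0; pose e1 := e / 2; have e10 : 0 < e1 by rewrite divr_gt0.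
have [s0 h0] := synthesis_cauchy hc e10.
pose x0 := fun x => \sum_(i <- s0) c i * F i x.
have Lx0 : cL2 mu x0 by exact: cL2_fcomb.
have [ha _] := analysis_ell2 HB Lx0.
have z : ell2_inner c (analysis mu F x0) = 0.
  rewrite (ell2_inner_conj ha hc) ell2_inner_comb0 ?conjc0// => k.
  have [hk _] := analysis_ell2 HB (HF k).
  by rewrite (ell2_inner_conj hc hk) H conjc0.
have [s1 h1] := ell2_inner_sum hc ha (exprn_gt0 2 e10).
exists (s0 `|` s1)%fset => s; rewrite fsubUset => /andP[/h0 hs0 /h1].
rewrite z subr0; set x := fun x => \sum_(i <- s) c i * F i x.
have Lx : cL2 mu x by exact: cL2_fcomb.
have -> : \sum_(i <- s) c i * conjc (analysis mu F x0 i) = inner mu x x0.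
  rewrite inner_suml//; apply: eq_bigr => i _.
  by rewrite /analysis -inner_conj.
move=> hs1; rewrite -/x in hs0 *; have Ld := cL2B Lx Lx0.
have E1 : nsq mu x <= nrm mu x * e1 + e1 ^+ 2.
  have -> : nsq mu x = complex.Re (inner mu x (fun t => x t - x0 t)) +
                      complex.Re (inner mu x x0).
    by rewrite -ReD innerBr// subrK.
  rewrite lerD//; last exact: le_trans (Re_le_normc _) (ltW hs1).
  apply: le_trans (Re_le_normc _) _; apply: le_trans (cauchy_schwarz Lx Ld) _.
  by rewrite ler_wpM2l ?nrm_ge0// ltW.
rewrite -nrm_sq in E1; have t0 := nrm_ge0 mu x.
rewrite ltNge; apply/negP => ht; have : 2 * e1 <= nrm mu x by rewrite /e1; lra.
move: (nrm mu x) E1 t0 => t; nra.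
Qed.

End Bessel.

(** The functional [f |-> ell2_inner (analysis f) b] has norm at most [sqrt (B * sumsq b)], so its
    vanishing on the generators passes to the closed span. *)
Lemma ell2_inner_span0 B E b f : 0 <= B -> (forall i, cL2 mu (E i)) ->
  bessel_bound B E -> ell2 b ->
  (forall j, ell2_inner (analysis mu E (E j)) b = 0) ->
  closed_span mu E f -> ell2_inner (analysis mu E f) b = 0.
Proof.
move=> B0 HE HB hb H /closed_spanP -/(_ HE) [Lf Hf].
apply: Normc.eq0_normc; apply/eqP; rewrite eq_le normc_ge0 andbT.
apply/ler_addgt0Pr => e e0; rewrite add0r.
set K := Num.sqrt (B * sumsq b).
have K0 : 0 <= K by exact: sqrtr_ge0.
have K1 : 0 < K + 1 by rewrite ltr_wpDl.
have [s [c]] := Hf _ (divr_gt0 e0 K1); pose g := (fun x => \sum_(i <- s) c i * E i x); rewrite -/g => hfg.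
have Lg : cL2 mu g by apply: cL2_comb.
have [hf _] := analysis_ell2 HB Lf; have [hg _] := analysis_ell2 HB Lg.
have [hd dle] := analysis_ell2 HB (cL2B Lf Lg).
have -> : analysis mu E f = (fun i => analysis mu E (fun x => f x - g x) i +
    analysis mu E g i).
  by rewrite analysisB//; apply/funext => i; rewrite subrK.
rewrite ell2_innerD// (ell2_inner_comb0 HE HB)// addr0.
apply: le_trans (ell2_inner_le hd hb) _.
apply: (@le_trans _ _ (K * nrm mu (fun x => f x - g x))).
  rewrite /K /nrm -sqrtrM ?mulr_ge0 ?sumsq_ge0// ler_wsqrtr//.
  by rewrite -mulrA (mulrC (sumsq b)) mulrA ler_wpM2r// sumsq_ge0.
move: hfg; rewrite ltr_pdivlMr// => /ltW; apply: le_trans.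
by rewrite mulrC ler_wpM2l ?nrm_ge0// lerDl.
Qed.

(** The conjugation inside [ell2_inner] turns the row [<F_k, F_i>] into [<F_i, F_k>], so each
    equation is an entry of the product of the two Gram matrices. *)
Definition gramians_orthogonal F E := forall j k,
  ell2_inner (analysis mu E (E j)) (analysis mu F (F k)) = 0.

Lemma gramians_orthogonalP BF BE F E : 0 <= BF -> 0 <= BE ->
  (forall i, cL2 mu (F i)) -> (forall i, cL2 mu (E i)) ->
  bessel_bound BF F -> bessel_bound BE E ->
  (forall f, closed_span mu E f ->
     L2_has_sum mu (fun i x => inner mu f (E i) * F i x) (fun=> 0)) <->
  gramians_orthogonal F E.
Proof.
move=> BF0 BE0 HF HE bF bE; split=> [H j k|H f Sf].
  have [hj _] := analysis_ell2 bE (HE j).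
  by apply: (has_sum0P BF0 HF bF hj).1; apply: H; exact: closed_span_mem.
have [Lf _] := Sf; have [hf _] := analysis_ell2 bE Lf.
apply/(has_sum0P BF0 HF bF hf) => k; have [hk _] := analysis_ell2 bF (HF k).
exact: (ell2_inner_span0 BE0).
Qed.

End Families.

(** * Riesz-Fischer completeness *)

Section RieszFischer.
Context d (T : measurableType d) (R : realType).
Variable mu : {measure set T -> \bar R}.

Lemma measurable_sqrt : measurable_fun setT (@Num.sqrt R).
Proof. by apply: continuous_measurable_fun; exact: sqrt_continuous. Qed.

Lemma csq_real (x : R) : csq (x%:C%C) = x ^+ 2.
Proof. by rewrite /csq /= [0 ^+ 2]expr2 mul0r addr0. Qed.

Lemma measurable_normc (f : T -> R[i]) : cmeasurable f ->
  measurable_fun setT (fun x => Normc.normc (f x)).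
Proof.
move=> mf; under eq_fun do rewrite normcE.
by apply: (measurableT_comp measurable_sqrt); exact: measurable_csq.
Qed.

Lemma cvg_csq (u : nat -> R[i]) (z l : R[i]) :
  (fun n => complex.Re (u n)) @ \oo --> complex.Re l ->
  (fun n => complex.Im (u n)) @ \oo --> complex.Im l ->
  (fun n => csq (z - u n)) @ \oo --> csq (z - l).
Proof.
move=> h1 h2.
have E w : csq (z - w) = (complex.Re z - complex.Re w) * (complex.Re z - complex.Re w) +
    (complex.Im z - complex.Im w) * (complex.Im z - complex.Im w).
  by case: z w => a b [p q]; rewrite /csq /= !expr2.
rewrite E; under eq_fun do rewrite E.
by apply: cvgD; apply: cvgM; apply: cvgB => //; exact: cvg_cst.
Qed.

Lemma cvg_normc_series (u : nat -> R[i]) :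
  cvgn (series (fun n => Normc.normc (u n.+1 - u n))) ->
  cvgn (fun n => complex.Re (u n)) /\ cvgn (fun n => complex.Im (u n)).
Proof.
move=> H.
have K (v : R^nat) : (forall n, `|v n.+1 - v n| <= Normc.normc (u n.+1 - u n)) ->
    cvgn v.
  move=> hv; have hs : cvgn (series (telescope v)).
    apply: normed_cvg; apply: (series_le_cvg _ _ hv H) => n //.
    exact: normc_ge0.
  have -> : v = (fun n => v 0%N + series (telescope v) n).
    by apply/funext => n; exact: eq_sum_telescope.
  by apply: is_cvgD => //; exact: is_cvg_cst.
split; apply: K => n; rewrite normcE -sqrtr_sqr ler_wsqrtr// /csq.
  by rewrite raddfB /= lerDl sqr_ge0.
by rewrite [X in _ <= _ + X ^+ 2]raddfB /= lerDr sqr_ge0.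
Qed.

Variable u : nat -> T -> R[i].
Hypothesis Lu : forall n, cL2 mu (u n).
Hypothesis u_fast : forall n,
  nrm mu (fun x => u n.+1 x - u n x) <= (1 / 2 ^+ n)%R.

(** An upper limit exists and is measurable without any convergence; where the increments are
    summable it is the actual limit. *)
Let g (x : T) : R[i] :=
  Complex (fine (limn_esup (fun n => (complex.Re (u n x))%:E)))
          (fine (limn_esup (fun n => (complex.Im (u n x))%:E))).

Let mg : cmeasurable g.
Proof.
split; apply: measurableT_comp => //; apply: measurable_fun_limn_esup => n;
  apply/measurable_EFinP; by case: (cL2_measurable (Lu n)).
Qed.

Let cvg_g x : cvgn (series (fun n => Normc.normc (u n.+1 x - u n x))) ->
  (fun n => complex.Re (u n x)) @ \oo --> complex.Re (g x) /\
  (fun n => complex.Im (u n x)) @ \oo --> complex.Im (g x).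
Proof.
have K (v : R^nat) : cvgn v -> v @ \oo --> fine (limn_esup (EFin \o v)).
  move=> hv; have hE : EFin \o v @ \oo --> (limn v)%:E 
    by move/cvg_comp : hv; apply.
  by have [_ ->] := cvg_limn_einf_sup hE.
by move=> /(cvg_normc_series (u := fun n => u n x))[h1 h2]; split; exact: K.
Qed.

Let S N x := series (fun n => Normc.normc (u n.+1 x - u n x)) N.

Let S_ge0 N x : 0 <= S N x.
Proof. by apply: sumr_ge0 => i _; exact: normc_ge0. Qed.

Let mS N : measurable_fun setT (S N).
Proof.
rewrite /S /series; apply: measurable_sum => n.
exact/measurable_normc/cL2_measurable/cL2B.
Qed.

(** By the triangle inequality the sum of the increments has norm at most the sum of the
    [1 / 2 ^+ n], hence at most 2, and 4 is its square. *)
Let int_S N : (\int[mu]_x ((S N x) ^+ 2)%:E <= 4%:E)%E.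
Proof.
pose D n x : R[i] := (Normc.normc (u n.+1 x - u n x))%:C%C.
have csqD n x : csq (D n x) = csq (u n.+1 x - u n x).
  by rewrite csq_real normc_sq.
have Ld n : cL2 mu (fun x => u n.+1 x - u n x) by exact: cL2B.
have LD n : cL2 mu (D n).
  apply: (@cL2_dominated _ _ _ _ _ (fun x => csq (u n.+1 x - u n x))).
  - split; last exact: measurable_cst.
    exact/measurable_normc/cL2_measurable.
  - exact: cL2_integrable (Ld n).
  - by move=> x; rewrite csqD.
have nD n : nrm mu (D n) <= 1 / 2 ^+ n.
  apply: le_trans (u_fast n); rewrite /nrm !nsqE.
  by under eq_integral do rewrite csqD.
have LS : cL2 mu (fun x => \sum_(n <- index_iota 0 N) D n x) by apply: cL2_sum.
have E x : csq (\sum_(n <- index_iota 0 N) D n x) = (S N x) ^+ 2.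
  rewrite /D -rmorph_sum /= /csq /= [0 ^+ 2]expr2 mul0r addr0.
  by rewrite /S /series.
under eq_integral do rewrite -E.
rewrite -nsq_EFin// lee_fin -nrm_sq.
have -> : (4 : R) = 2 ^+ 2 by rewrite expr2; lra.
rewrite ler_sqr ?nnegrE ?nrm_ge0//.
apply: (le_trans (nrm_sum (fun i _ => LD i))).
apply: (@le_trans _ _ (\sum_(n <- index_iota 0 N) (1 / 2 ^+ n))).
  by apply: ler_sum => i _.
have -> : \sum_(n <- index_iota 0 N) (1 / 2 ^+ n) = 2 - 2 / 2 ^+ N :> R.
  elim: N {LS E} => [|N IH]; first by rewrite big_geq// expr0; lra.
  rewrite big_nat_recr//= IH exprS; have := @expf_neq0 R 2 N.
  by move=> H; field; apply: H.
by rewrite gerBl divr_ge0// exprn_ge0.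
Qed.

Let ae_cvg : {ae mu, forall x,
  cvgn (series (fun n => Normc.normc (u n.+1 x - u n x)))}.
Proof.
have nd x : nondecreasing_seq (fun N => S N x).
  apply: nondecreasing_series => n _ _; exact: normc_ge0.
have nd2 x : nondecreasing_seq (fun N => ((S N x) ^+ 2)%:E).
  by move=> m n mn; rewrite lee_fin ler_sqr ?nnegrE//; exact: nd.
have m2 N : measurable_fun setT (fun x => ((S N x) ^+ 2)%:E).
  by apply/measurable_EFinP; exact: measurable_funX (mS N).
have := monotone_convergence mu measurableT (g' := fun N x => ((S N x) ^+ 2)%:E)
   m2 (fun n x _ => _) (fun x _ => nd2 x).
move=> /(_ (fun n x => _)) mc.
have li : (\int[mu]_x limn (fun N => ((S N x) ^+ 2)%:E) <= 4%:E)%E.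
  rewrite mc; last by move=> n x; rewrite lee_fin sqr_ge0.
  apply: lime_le; last by apply: nearW => n; exact: int_S.
  apply: ereal_nondecreasing_is_cvgn => m n mn; apply: ge0_le_integral => //.
  - by move=> x _; rewrite lee_fin sqr_ge0.
  - by move=> x _; exact: nd2.
have ml : measurable_fun setT (fun x => limn (fun N => ((S N x) ^+ 2)%:E)).
  apply: (@emeasurable_fun_cvg _ _ _ _ _ _ m2) => x _.
  exact: ereal_nondecreasing_is_cvgn.
have il : mu.-integrable setT (fun x => limn (fun N => ((S N x) ^+ 2)%:E)).
  apply/integrableP; split=> //; under eq_integral.
    move=> x _; rewrite gee0_abs; last first.
      apply: lime_ge; first exact: ereal_nondecreasing_is_cvgn.
      by apply: nearW => n; rewrite lee_fin sqr_ge0.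
    over.
  exact: le_lt_trans li (ltry _).
have := integrable_ae measurableT il; apply: filterS => x /(_ I).
set L := limn _ => Lfin.
have L0 : (0 <= L)%E.
  apply: lime_ge; first exact: ereal_nondecreasing_is_cvgn.
  by apply: nearW => n; rewrite lee_fin sqr_ge0.
apply: nondecreasing_is_cvgn; first exact: nd.
(* If [t^2 <= L] with [t] and [L] nonnegative, then [t <= L + 1]. *)
exists (fine L + 1) => _ [N _ <-]; rewrite -/(S N x).
have : (((S N x) ^+ 2)%:E <= L)%E 
  by apply: lime_ge; [exact: ereal_nondecreasing_is_cvgn|exists N => // m /= /nd2].
rewrite -(fineK Lfin) lee_fin => h.
have l0 : 0 <= fine L by exact: fine_ge0.
have := S_ge0 N x; move: (S N x) h => t; nra.
Qed.

Let tail n m : nrm mu (fun x => u n x - u (n + m)%N x) <= 2 / 2 ^+ n.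
Proof.
(* The subtracted term absorbs the next increment exactly, which closes the induction on [m]. *)
suff H : nrm mu (fun x => u n x - u (n + m)%N x) <= 2 / 2 ^+ n - 2 / 2 ^+ (n + m).
  by apply: (le_trans H); rewrite gerBl divr_ge0// exprn_ge0.
elim: m => [|m IH].
  rewrite addn0 subrr (_ : (fun x => _) = fun=> 0).
    by rewrite /nrm /nsq inner0l /= sqrtr0.
  by apply/funext => x; rewrite subrr.
rewrite addnS; apply: le_trans (nrm_trans (Lu n) (Lu (n + m)) (Lu _)) _.
apply: le_trans (lerD IH _) _.
  by rewrite nrm_distC//; exact: u_fast.
have := @expf_neq0 R 2 (n + m); set q := 2 ^+ (n + m) => hq.
rewrite exprS -/q; have -> : 2 / (2 * q) = 1 / q.
  by field; apply: hq.
lra.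
Qed.

(** Fatou's lemma in [m], applied to the squared moduli of [u n - u (n + m)], transfers the tail
    estimate to the pointwise limit; it gives the rate and the square-integrability of the limit
    together. *)
Lemma riesz_fischer : exists2 h, cL2 mu h &
  forall n, nrm mu (fun x => u n x - h x) <= 2 / 2 ^+ n.
Proof.
have B n : (\int[mu]_x (csq (u n x - g x))%:E <= ((2 / 2 ^+ n) ^+ 2)%:E)%E.
  have mf m : measurable_fun setT (fun x => (csq (u n x - u (n + m)%N x))%:E).
    by apply: measurable_ecsq; exact: cL2_measurable (cL2B _ _).
  have -> : (\int[mu]_x (csq (u n x - g x))%:E =
     \int[mu]_x limn_einf (fun m => (csq (u n x - u (n + m)%N x))%:E))%E.
    apply: ge0_ae_eq_integral => //.
    - apply: measurable_ecsq; apply: cmeasurableD; first exact: cL2_measurable.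
      have := cmeasurableM (cmeasurable_cst T (-1)) mg.
      by under eq_fun do rewrite mulN1r.
    - rewrite /limn_einf; apply: measurableT_comp => //.
      apply: measurable_fun_limn_esup => m.
      exact: measurableT_comp (mf m).
    - by move=> x _; rewrite lee_fin csq_ge0.
    - move=> x _; rewrite limn_einf_lim; apply: lime_ge; first exact: is_cvg_einfs.
      apply: nearW => m; apply: le_ereal_inf_tmp => _ [k _ <-].
      by rewrite lee_fin csq_ge0.
    - apply: filterS ae_cvg => x /cvg_g[h1 h2] _.
      have h : (fun m => (csq (u n x - u (n + m)%N x))%:E) @ \oo -->
               (csq (u n x - g x))%:E.
        have H : (fun m => csq (u n x - u (n + m)%N x)) @ \oo --> csq (u n x - g x).
          have := cvg_csq (z := u n x) h1 h2.
          rewrite -(cvg_shiftn n); under eq_fun do rewrite addnC; exact.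
        by move/cvg_comp : H; apply.
      by have [-> _] := cvg_limn_einf_sup h.
  apply: le_trans (fatou _ _ mf _) _ => //.
    by move=> m x _; rewrite lee_fin csq_ge0.
  rewrite limn_einf_lim; apply: lime_le; first exact: is_cvg_einfs.
  apply: nearW => m; apply: ge_ereal_inf.
  exists (\int[mu]_x (csq (u n x - u (n + m)%N x))%:E)%E; first by exists m => /=.
  rewrite -nsq_EFin; last exact: cL2B.
  rewrite lee_fin -nrm_sq ler_sqr ?nnegrE ?nrm_ge0 ?divr_ge0 ?exprn_ge0//.
have Lug n : cL2 mu (fun x => u n x - g x).
  apply/cL2P; split; last exact: le_lt_trans (B n) (ltry _).
  apply: cmeasurableD; first exact: cL2_measurable.
  have := cmeasurableM (cmeasurable_cst T (-1)) mg.
  by under eq_fun do rewrite mulN1r.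
exists g.
  have := cL2B (Lu 0) (Lug 0%N).
  by under eq_fun do rewrite opprB addrC subrK.
move=> n; rewrite -ler_sqr ?nnegrE ?nrm_ge0 ?divr_ge0 ?exprn_ge0// nrm_sq.
by rewrite -lee_fin nsq_EFin.
Qed.

End RieszFischer.

(** * The fiberwise conditions *)

Section Synthesis.
Context d (T : measurableType d) (R : realType).
Variable mu : {measure set T -> \bar R}.
Context (I : choiceType).
Implicit Types (F E : I -> T -> R[i]) (f g h : T -> R[i]) (c : I -> R[i]).
Implicit Types (s : {fset I}).

(** The 3 leaves room for a distance [1 / 2 ^+ n] to an approximating sequence plus its rate
    [2 / 2 ^+ n] in [riesz_fischer]. *)
Lemma exists_pow2_lt (e : R) : 0 < e -> exists n, 3 / 2 ^+ n < e.
Proof.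
move=> e0; exists (Num.bound (3 / e)).
rewrite ltr_pdivrMr ?exprn_gt0// mulrC -ltr_pdivrMr//.
have := @archi_boundP R (3 / e); rewrite divr_ge0 ?ltW// => /(_ isT) h.
by apply: (lt_trans h); rewrite -natrX ltr_nat ltn_expl.
Qed.

Lemma L2_has_sum_unique F g g' : (forall i, cL2 mu (F i)) ->
  L2_has_sum mu F g -> L2_has_sum mu F g' -> g = g' %[ae mu].
Proof.
move=> HF Hg Hg'; have [Lg _] := Hg; have [Lg' _] := Hg'.
have H := (L2_has_sumP HF Lg).1 Hg; have H' := (L2_has_sumP HF Lg').1 Hg'.
have : nsq mu (fun x => g x - g' x) = 0.
  rewrite -nrm_sq (_ : nrm _ _ = 0) ?expr2 ?mul0r//.
  apply/eqP; rewrite eq_le nrm_ge0 andbT; apply/ler_addgt0Pr => e e0; rewrite add0r.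
  have e2 : 0 < e / 2 by rewrite divr_gt0.
  have [s hs] := H _ e2; have [t ht] := H' _ e2.
  have Ls : cL2 mu (fun x => \sum_(i <- (s `|` t)%fset) F i x) by apply: cL2_sum.
  apply: le_trans (nrm_trans Lg Ls Lg') _.
  rewrite nrm_distC// (splitr e) lerD// ltW//; first exact/hs/fsubsetUl.
  exact/ht/fsubsetUr.
move=> /(nsq_eq0 (cL2B Lg Lg')); apply: filterS => x /= /[apply] /eqP.
by rewrite subr_eq0 => /eqP.
Qed.

Lemma ae_eq_L2_has_sum F g g' : (forall i, cL2 mu (F i)) -> cL2 mu g' ->
  L2_has_sum mu F g -> g = g' %[ae mu] -> L2_has_sum mu F g'.
Proof.
move=> HF Lg' Hg gg; have [Lg _] := Hg; have H := (L2_has_sumP HF Lg).1 Hg.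
apply/L2_has_sumP => // e /H[s hs]; exists s => t /hs; apply: le_lt_trans.
have Lt : cL2 mu (fun x => \sum_(i <- t) F i x) by apply: cL2_sum.
rewrite (ae_eq_nrm (cL2B Lt Lg') (cL2B Lt Lg))//.
by apply: filterS gg => x /= /[apply] ->.
Qed.

Lemma has_sum_closed_span F c g : (forall i, cL2 mu (F i)) ->
  L2_has_sum mu (fun i x => c i * F i x) g -> closed_span mu F g.
Proof.
move=> HF Hg; have [Lg _] := Hg.
have H := (L2_has_sumP (fun i => cL2Z (c i) (HF i)) Lg).1 Hg.
apply/closed_spanP => //; split=> // e /H[s hs]; exists s, c.
by rewrite nrm_distC ?hs//; exact: cL2_comb.
Qed.

Section OneFamily.
Variables (B : R) (F : I -> T -> R[i]).
Hypotheses (B0 : 0 <= B) (HF : forall i, cL2 mu (F i)) (HB : bessel_bound mu B F).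

(** Convergence along finite subsets is reduced to a sequence: partial sums over an increasing chain
    of finite sets form a fast Cauchy sequence, and the Cauchy estimate brings every later finite
    set close to its limit. *)
Lemma bessel_has_sum c : ell2 c ->
  exists g, L2_has_sum mu (fun i x => c i * F i x) g.
Proof.
move=> hc; pose x s := fun t => \sum_(i <- s) c i * F i t.
have Lx s : cL2 mu (x s) by exact: cL2_comb.
have p0 n : 0 < 1 / 2 ^+ n.+1 :> R by rewrite divr_gt0// exprn_gt0.
have /choice[sq hsq] n : exists s0 : {fset I}, forall s, (s0 `<=` s)%fset ->
    nrm mu (fun t => x s t - x s0 t) < 1 / 2 ^+ n.+1.
  exact: (synthesis_cauchy B0 HF HB hc).
(* The chain is increasing and [t n] contains [sq n]; two sets beyond [sq n] give partial sums
   within twice [1 / 2 ^+ n.+1], which is the rate required of the sequence. *)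
pose t := fix t n := if n is m.+1 then (t m `|` sq n)%fset else sq 0%N.
have st n : (sq n `<=` t n)%fset by case: n => [|n] //=; exact: fsubsetUr.
have half n : 1 / 2 ^+ n.+1 + 1 / 2 ^+ n.+1 = 1 / 2 ^+ n :> R.
  have := @expf_neq0 R 2 n; rewrite exprS => H; field; apply: H.
  by rewrite pnatr_eq0.
have [] := @riesz_fischer _ _ _ mu (fun n => x (t n)) (fun n => Lx (t n)).
  move=> n; rewrite -half; apply: le_trans (nrm_trans _ (Lx (sq n)) _) _ => //.
  rewrite lerD// ltW//.
    by apply: hsq; apply: fsubset_trans (st n) _; exact: fsubsetUl.
  by rewrite nrm_distC//; apply: hsq; exact: st.
move=> g Lg hg; exists g; apply/L2_has_sumP => //.
  by move=> i; exact: cL2Z.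
move=> e /exists_pow2_lt[n hn]; exists (t n) => s ts.
apply: le_lt_trans hn; apply: le_trans (nrm_trans (Lx s) (Lx (t n)) Lg) _.
have -> : 3 / 2 ^+ n = 1 / 2 ^+ n + 2 / 2 ^+ n :> R by rewrite -mulrDl; congr (_ / _); lra.
rewrite lerD// -half; apply: le_trans (nrm_trans _ (Lx (sq n)) _) _ => //.
rewrite lerD// ltW//; first by apply: hsq; apply: fsubset_trans (st n) ts.
by rewrite nrm_distC//; apply: hsq; exact: st.
Qed.

Lemma synthesis_has_sum c : ell2 c ->
  L2_has_sum mu (fun i x => c i * F i x) (synthesis mu F c).
Proof.
move=> hc; rewrite /synthesis; case: xgetP => [g -> //|H].
by have [g Hg] := bessel_has_sum hc; have := H g.
Qed.

Lemma synthesis_cL2 c : ell2 c -> cL2 mu (synthesis mu F c).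
Proof. by move=> /synthesis_has_sum[]. Qed.

Definition delta (j : I) : I -> R[i] := fun i => if i == j then 1 else 0.

Lemma ell2_delta j : ell2 (delta j).
Proof.
apply: (ell2_le_bound (M := 1) _).1 => s.
have E i : csq (delta j i) = if i == j then 1 else 0.
  by rewrite /delta; case: eqP; rewrite ?csq0// /csq /= expr1n expr2 mul0r addr0.
under eq_bigr do rewrite E; rewrite -big_mkcond /=.
have [js|js] := boolP (j \in s); last first.
  rewrite big_seq_cond big1// => i /andP[is_ /eqP ij]; by rewrite -ij is_ in js.
rewrite big_mkcond (big_fsetD1 j)//= eqxx big1_fset ?addr0// => i.
by rewrite !inE => /andP[/negPf ->].
Qed.

Lemma synthesis_delta j : synthesis mu F (delta j) = F j %[ae mu].
Proof.
have H := synthesis_has_sum (ell2_delta j).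
have HF' i : cL2 mu (fun x => delta j i * F i x) by exact: cL2Z.
apply: (L2_has_sum_unique HF' H); apply/L2_has_sumP => // e e0.
exists [fset j]%fset => s /fsubsetP/(_ j); rewrite inE eqxx => /(_ isT) js.
rewrite (_ : (fun x => _) = fun=> 0); first by rewrite /nrm /nsq inner0l /= sqrtr0.
apply/funext => x; rewrite (big_fsetD1 j)//= {1}/delta eqxx mul1r.
rewrite big1_fset ?addr0 ?subrr// => i; rewrite !inE => /andP[/negPf ij _] _.
by rewrite /delta ij mul0r.
Qed.

Lemma ae_eq_analysis f g : cL2 mu f -> cL2 mu g -> f = g %[ae mu] ->
  analysis mu F f = analysis mu F g.
Proof.
move=> Lf Lg fg; apply/funext => i; apply: ae_eq_inner => //.
exact: aeW.
Qed.

Lemma synthesis_eq0 c : ell2 c ->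
  synthesis mu F c = (fun=> 0) %[ae mu] <->
  forall k, ell2_inner c (analysis mu F (F k)) = 0.
Proof.
move=> hc; rewrite -(has_sum0P B0 HF HB hc).
have Hs := synthesis_has_sum hc; have HF' i : cL2 mu (fun x => c i * F i x).
  exact: cL2Z.
split=> H; first exact: (ae_eq_L2_has_sum HF' (cL2_0 mu) Hs H).
exact: (L2_has_sum_unique HF' Hs H).
Qed.

(** With [synthesis_eq0] this says that [J^* J] and [J] have the same kernel, which is what makes
    the Gramian condition equivalent to the pre-Gramian one. *)
Lemma analysis_synthesis_eq0 c : ell2 c ->
  analysis mu F (synthesis mu F c) = (fun=> 0) <->
  forall k, ell2_inner c (analysis mu F (F k)) = 0.
Proof.
move=> hc; have Hs := synthesis_has_sum hc; split=> [H k|H].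
  by rewrite -(has_sum_inner HF HB hc (HF k) Hs); have /(congr1 (@^~ k)) := H.
apply/funext => k; rewrite /analysis (has_sum_inner HF HB hc (HF k) Hs).
exact: H.
Qed.

End OneFamily.

Variables (BF BE : R) (F E : I -> T -> R[i]).
Hypotheses (BF0 : 0 <= BF) (HF : forall i, cL2 mu (F i)) (bF : bessel_bound mu BF F).
Hypotheses (BE0 : 0 <= BE) (HE : forall i, cL2 mu (E i)) (bE : bessel_bound mu BE E).

Let analysis_synthesis_ell2 eta : ell2 eta ->
  ell2 (analysis mu E (synthesis mu E eta)).
Proof.
by move=> h; apply: (analysis_ell2 bE _).1; exact: (synthesis_cL2 BE0 HE bE).
Qed.

Let span0 eta k : ell2 eta -> gramians_orthogonal mu F E ->
  ell2_inner (analysis mu E (synthesis mu E eta)) (analysis mu F (F k)) = 0.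
Proof.
move=> he H; apply: (ell2_inner_span0 BE0 HE bE (analysis_ell2 bF (HF k)).1).
  by move=> j; exact: H.
exact: (has_sum_closed_span HE (synthesis_has_sum BE0 HE bE he)).
Qed.

Let delta_analysis j : analysis mu E (synthesis mu E (delta j)) = analysis mu E (E j).
Proof.
apply: ae_eq_analysis => //; first exact: (synthesis_cL2 BE0 HE bE (ell2_delta j)).
exact: (synthesis_delta BE0 HE bE).
Qed.

(** The sequence [delta j] extracts row [j] of the Gram matrix of [E]. Conversely a synthesized
    vector lies in the closed span of [E], where vanishing on the generators is enough. *)
Lemma pre_gramians_orthogonalP :
  (forall eta, ell2 eta ->
    synthesis mu F (analysis mu E (synthesis mu E eta)) = (fun=> 0) %[ae mu]) <->
  gramians_orthogonal mu F E.
Proof.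
split=> [H j k|H eta he].
  have := H _ (ell2_delta j); rewrite delta_analysis.
  by move=> /(synthesis_eq0 BF0 HF bF (analysis_ell2 bE (HE j)).1); exact.
by apply/(synthesis_eq0 BF0 HF bF (analysis_synthesis_ell2 he)) => k; exact: span0.
Qed.

Lemma gramian_productP :
  (forall eta, ell2 eta ->
    analysis mu F (synthesis mu F (analysis mu E (synthesis mu E eta))) = (fun=> 0)) <->
  gramians_orthogonal mu F E.
Proof.
split=> [H j k|H eta he].
  have := H _ (ell2_delta j); rewrite delta_analysis.
  by move=> /(analysis_synthesis_eq0 BF0 HF bF (analysis_ell2 bE (HE j)).1); exact.
apply/(analysis_synthesis_eq0 BF0 HF bF (analysis_synthesis_ell2 he)) => k.
exact: span0.
Qed.

Lemma mixed_dual_gramianP :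
  (forall f, cL2 mu f -> closed_span mu E f) ->
  (forall f, cL2 mu f ->
    synthesis mu F (analysis mu E f) = (fun=> 0) %[ae mu]) <->
  gramians_orthogonal mu F E.
Proof.
move=> dE; split=> [H j k|H f Lf].
  apply: (synthesis_eq0 BF0 HF bF (analysis_ell2 bE (HE j)).1).1; exact: H.
apply/(synthesis_eq0 BF0 HF bF (analysis_ell2 bE Lf).1) => k.
apply: (ell2_inner_span0 BE0 HE bE (analysis_ell2 bF (HF k)).1); last exact: dE.
by move=> j; exact: H.
Qed.

End Synthesis.

(** * Slices of square-integrable functions on a product *)

Section Fubini.
Context d1 d2 (T1 : measurableType d1) (T2 : measurableType d2) (R : realType).
Variable m1 : {sigma_finite_measure set T1 -> \bar R}.
Variable m2 : {sigma_finite_measure set T2 -> \bar R}.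
Local Notation m12 := (m1 \x m2)%E.
Implicit Types F H : T1 * T2 -> R[i].

Lemma ae_prod (P : T1 * T2 -> Prop) : {ae m12, forall p, P p} ->
  {ae m1, forall x, {ae m2, forall y, P (x, y)}}.
Proof.
move=> [A [mA A0 HA]].
have mf : measurable_fun setT (m2 \o xsection A) by exact: measurable_fun_xsection.
have E : (\int[m1]_x `|(m2 \o xsection A) x| = 0)%E.
  under eq_integral do rewrite gee0_abs//.
  exact: A0.
have := (ae_eq_integral_abs m1 measurableT mf).1 E.
apply: filterS => x /(_ I) /= hx; exists (xsection A x); split => //.
  exact: measurable_xsection.
by move=> y /= nP; rewrite /xsection /= inE; exact: HA.
Qed.

Lemma cmeasurable_section F x : cmeasurable F -> cmeasurable (fun y => F (x, y)).
Proof.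
move=> [mF1 mF2]; split.
  exact: (measurableT_comp mF1 (measurable_pair1 x)).
exact: (measurableT_comp mF2 (measurable_pair1 x)).
Qed.

Lemma cL2_section F : cL2 m12 F ->
  {ae m1, forall x, cL2 m2 (fun y => F (x, y))}.
Proof.
move=> LF; have := ae_integrable1 (cL2_integrable LF).
apply: filterS => x /integrableP[_ hx]; apply/cL2P; split.
  exact: cmeasurable_section (cL2_measurable LF).
by under eq_integral do rewrite -[(csq _)%:E]gee0_abs ?lee_fin ?csq_ge0//.
Qed.

Definition fiber_inner F H (x : T1) : R[i] :=
  inner m2 (fun y => F (x, y)) (fun y => H (x, y)).

(** The real inner integral agrees with the extended one only where the latter is finite, that is
    almost everywhere; both claims are carried across that null set. *)
Let fine_fubini (f : T1 * T2 -> R) : m12.-integrable setT (EFin \o f) ->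
  m1.-integrable setT (fun x => (\int[m2]_y f (x, y))%:E) /\
  \int[m1]_x (\int[m2]_y f (x, y)) = \int[m12]_p f p.
Proof.
move=> fi; have mf := measurable_int _ fi.
have Fi := integrable_fubini_F fi.
have E : ae_eq m1 setT (fubini_F m2 (EFin \o f)) (fun x => (\int[m2]_y f (x, y))%:E).
  have := integrable_ae measurableT Fi; apply: filterS => x /(_ I) hx _.
  by rewrite fineK.
have mF : measurable_fun setT (fun x => (\int[m2]_y f (x, y))%:E).
  apply/measurable_EFinP; apply: measurableT_comp => //.
  exact: measurable_int _ Fi.
have mF' := measurable_int _ Fi.
split.
  apply/integrableP; split=> //; have /integrableP[_] := Fi.
  congr (_ < _)%E; apply: ae_eq_integral => //.
  - exact: measurableT_comp.
  - exact: measurableT_comp.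
  - exact: ae_eq_abse.
rewrite /Rintegral -(integral12_prod_meas1 fi); congr fine.
by apply/esym/ae_eq_integral.
Qed.

Lemma cintegral_fubini F : cintegrable m12 F ->
  cintegrable m1 (fun x => cintegral m2 (fun y => F (x, y))) /\
  cintegral m1 (fun x => cintegral m2 (fun y => F (x, y))) = cintegral m12 F.
Proof.
move=> [F1 F2]; have [i1 e1] := fine_fubini F1; have [i2 e2] := fine_fubini F2.
by split; [split|rewrite /cintegral /= e1 e2].
Qed.

Lemma fiber_inner_integrable F H : cL2 m12 F -> cL2 m12 H ->
  cintegrable m1 (fiber_inner F H).
Proof.
by move=> LF LH; have [h _] := cintegral_fubini (cL2_mul_conj LF LH).
Qed.

Lemma inner_fiber F H : cL2 m12 F -> cL2 m12 H ->
  inner m12 F H = cintegral m1 (fiber_inner F H).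
Proof.
by move=> LF LH; have [_] := cintegral_fubini (cL2_mul_conj LF LH); exact: esym.
Qed.

Lemma nsq_fiber F : cL2 m12 F ->
  m1.-integrable setT (fun x => (nsq m2 (fun y => F (x, y)))%:E) /\
  nsq m12 F = \int[m1]_x (nsq m2 (fun y => F (x, y))).
Proof.
move=> LF; have [h _] := fiber_inner_integrable LF LF; split=> //.
by rewrite /nsq inner_fiber.
Qed.

Lemma cmeasurable_fst (k : T1 -> R[i]) : cmeasurable k ->
  cmeasurable (fun p : T1 * T2 => k p.1).
Proof.
by move=> [k1 k2]; split; [apply: measurableT_comp k1 _|apply: measurableT_comp k2 _].
Qed.

Lemma cmeasurable_snd (k : T2 -> R[i]) : cmeasurable k ->
  cmeasurable (fun p : T1 * T2 => k p.2).
Proof.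
by move=> [k1 k2]; split; [apply: measurableT_comp k1 _|apply: measurableT_comp k2 _].
Qed.

Lemma cL2_tensor (k : T1 -> R[i]) (h : T2 -> R[i]) : cL2 m1 k -> cL2 m2 h ->
  cL2 m12 (fun p => k p.1 * h p.2).
Proof.
move=> Lk Lh; have mF : cmeasurable (fun p : T1 * T2 => k p.1 * h p.2).
  apply: cmeasurableM.
    exact: cmeasurable_fst (cL2_measurable Lk).
  exact: cmeasurable_snd (cL2_measurable Lh).
apply/cL2P; split=> //.
rewrite fubini_tonelli1; first last.
- by move=> p; rewrite lee_fin csq_ge0.
- exact: measurable_ecsq.
rewrite /fubini_F /=.
have E x : (\int[m2]_y (csq (k x * h y))%:E = (nsq m2 h)%:E * (csq (k x))%:E)%E.
  under eq_integral do rewrite csqM EFinM.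
  rewrite ge0_integralZl_EFin//; last 3 first.
  - by move=> y _; rewrite lee_fin csq_ge0.
  - exact: measurable_ecsq (cL2_measurable Lh).
  - exact: csq_ge0.
  by rewrite -nsq_EFin// muleC.
under eq_integral do rewrite E.
rewrite ge0_integralZl_EFin//; last 3 first.
- by move=> y _; rewrite lee_fin csq_ge0.
- exact: measurable_ecsq (cL2_measurable Lk).
- exact: nsq_ge0.
by rewrite -nsq_EFin// -EFinM ltry.
Qed.

Lemma cL2_fst_mul (k : T1 -> R[i]) F (M : R) : cmeasurable k ->
  (forall x, csq (k x) <= M) -> cL2 m12 F -> cL2 m12 (fun p => k p.1 * F p).
Proof.
move=> mk kM LF; apply: (@cL2_dominated _ _ _ _ _ (fun p => M * csq (F p))).
- exact: cmeasurableM (cmeasurable_fst mk) (cL2_measurable LF).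
- rewrite (_ : _ \o _ = (fun p => M%:E * (csq (F p))%:E)%E)//.
  by apply: integrableZl => //; exact: cL2_integrable.
- by move=> p; rewrite csqM ler_wpM2r ?csq_ge0.
Qed.

End Fubini.

(** * Parseval identity *)

Section Countable.
Context d (T : measurableType d) (R : realType).
Variable mu : {measure set T -> \bar R}.

Lemma ae_forall_count (J : countType) (P : J -> T -> Prop) :
  (forall j, {ae mu, forall x, P j x}) -> {ae mu, forall x j, P j x}.
Proof.
move=> H; have : {ae mu, forall x, forall n, if pickle_inv n is Some j then P j x else True}.
  by apply: ae_foralln => n; case: pickle_inv => [j|]; [exact: H|exact: aeW].
by apply: filterS => x h j; have := h (choice.pickle j); rewrite pickleK_inv.
Qed.

Lemma esum_count (J : countType) (a : J -> \bar R) : (forall j, (0 <= a j)%E) ->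
  (\esum_(j in [set: J]) a j =
   \sum_(0 <= n <oo) (if pickle_inv n is Some j then a j else 0))%E.
Proof.
move=> a0; rewrite nneseries_esumT; last by move=> n; case: pickle_inv.
pose b n := (if pickle_inv n is Some j then a j else 0)%E.
have -> : (\esum_(j in [set: J]) a j = \esum_(j in [set: J]) b (choice.pickle j))%E.
  by apply: eq_esum => j _; rewrite /b pickleK_inv.
rewrite -(esum_image [set: J] (@choice.pickle J)); last first.
  by move=> x y _ _; exact: (pcan_inj pickleK_inv).
rewrite esum_mkcond; apply: eq_esum => n _; case: ifPn => // /negP hn.
rewrite /b; case E : (pickle_inv n) => [j|//]; exfalso; apply: hn.
apply/mem_set; exists j => //; have := pickle_invK (T := J) n.
by rewrite /= E.
Qed.

Lemma measurable_esum (J : countType) (f : J -> T -> \bar R) :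
  (forall j, measurable_fun setT (f j)) -> (forall j x, (0 <= f j x)%E) ->
  measurable_fun setT (fun x => \esum_(j in [set: J]) f j x)%E.
Proof.
move=> mf f0; under eq_fun do rewrite esum_count//.
apply: ge0_emeasurable_sum => [n x _ _|n _]; first by case: pickle_inv.
by case: pickle_inv => [j|]; [exact: mf|exact: measurable_cst].
Qed.

Lemma integral_esum (J : countType) (f : J -> T -> \bar R) :
  (forall j, measurable_fun setT (f j)) -> (forall j x, (0 <= f j x)%E) ->
  (\int[mu]_x (\esum_(j in [set: J]) f j x) = \esum_(j in [set: J]) (\int[mu]_x f j x))%E.
Proof.
move=> mf f0; rewrite (@esum_count J); last by move=> j; exact: integral_ge0.
under eq_integral do rewrite esum_count//.
rewrite integral_nneseries//; last 2 first.
- by move=> n; case: pickle_inv => [j|]; [exact: mf|exact: measurable_cst].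
- by move=> n x _; case: pickle_inv.
by apply: eq_eseriesr => n _; case: pickle_inv => // ; rewrite integral0.
Qed.

Lemma ge0_integral_le0 (f : T -> R) : (forall x, 0 <= f x) ->
  mu.-integrable setT (EFin \o f) -> \int[mu]_x f x <= 0 ->
  {ae mu, forall x, f x = 0}.
Proof.
move=> f0 fi h; have mf := measurable_int _ fi.
have E : (\int[mu]_x `|(EFin \o f) x| = 0)%E.
  under eq_integral do rewrite /= ger0_norm//.
  have : (\int[mu]_x (f x)%:E \is a fin_num)%E by exact: integrable_fin_num.
  move/fineK => <-; congr EFin; apply/eqP; rewrite eq_le h /=.
  exact: Rintegral_ge0.
have := (ae_eq_integral_abs mu measurableT mf).1 E.
by apply: filterS => x /(_ I) [].
Qed.

End Countable.

Section Orthonormal.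
Context d (T : measurableType d) (R : realType).
Variable mu : {measure set T -> \bar R}.
Context (I : choiceType).
Variable e : I -> T -> R[i].
Hypothesis Le : forall i, cL2 mu (e i).
Hypothesis e_orthonormal : forall i j, inner mu (e i) (e j) = if i == j then 1 else 0.
Hypothesis e_total : forall w, cL2 mu w -> (forall i, inner mu w (e i) = 0) ->
  w = (fun=> 0) %[ae mu].

Let e_bound : synthesis_bound mu 1 e.
Proof.
move=> s c; rewrite mul1r /nsq.
have Ls : cL2 mu (fun x => \sum_(i <- s) c i * e i x) by exact: cL2_comb.
rewrite inner_suml// Re_sum big_seq [leRHS]big_seq; apply: ler_sum => i is_.
rewrite inner_sumr// (big_fsetD1 i)//= e_orthonormal eqxx mulr1.
rewrite big1_fset ?addr0; first by rewrite mul_conjc.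
by move=> j; rewrite !inE => /andP[/negPf ji _] _; rewrite e_orthonormal eq_sym ji mulr0.
Qed.

Let e_bessel : bessel_bound mu 1 e.
Proof. exact: synthesis_bessel. Qed.

Lemma ell2_inner_self (J : choiceType) (c : J -> R[i]) : ell2 c ->
  ell2_inner c c = (sumsq c)%:C%C.
Proof.
move=> hc; apply: (has_csum_unique (ell2_inner_sum hc hc)) => r r0.
have [s0 hs] := has_csum_sq hc hc r0; exists s0 => s /hs[h _].
under eq_bigr do rewrite mul_conjc.
by rewrite -rmorph_sum -rmorphB normcE csq_real sqrtr_sqr.
Qed.

Lemma ell2_inner_delta (J : choiceType) (c : J -> R[i]) j : ell2 c ->
  ell2_inner c (delta R j) = c j.
Proof.
move=> hc; apply: (has_csum_unique (ell2_inner_sum hc (ell2_delta R j))) => r r0.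
exists [fset j]%fset => s /fsubsetP/(_ j); rewrite inE eqxx => /(_ isT) js.
rewrite (big_fsetD1 j)//= {1}/delta eqxx conjc1 mulr1 big1_fset ?addr0 ?subrr.
  by rewrite Normc.normc0.
by move=> i; rewrite !inE => /andP[/negPf ij _] _; rewrite /delta ij conjc0 mulr0.
Qed.

(** By completeness the Fourier series has a sum [g]. It has the coefficients of [u], so totality
    gives [g = u] almost everywhere, and pairing [g] with its own series computes the norm. *)
Lemma parseval u : cL2 mu u ->
  ell2 (analysis mu e u) /\ sumsq (analysis mu e u) = nsq mu u.
Proof.
move=> Lu; have [hc _] := analysis_ell2 e_bessel Lu; split=> //.
have [g Hg] := bessel_has_sum ler01 Le e_bessel hc; have [Lg _] := Hg.
have gE i : inner mu g (e i) = inner mu u (e i).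
  rewrite (has_sum_inner Le e_bessel hc (Le i) Hg).
  have -> : analysis mu e (e i) = delta R i.
    by apply/funext => j; rewrite /analysis e_orthonormal /delta eq_sym.
  by rewrite ell2_inner_delta.
have ug : g = u %[ae mu].
  have := e_total (cL2B Lg Lu) _; case.
    by move=> i; rewrite innerB// gE subrr.
  move=> A hA; exists A; case: hA => mA A0 hA; split=> // x /= hx; apply: hA => /= h.
  by apply: hx => xT; apply/eqP; rewrite -subr_eq0; apply/eqP; exact: h.
have Lu' := ae_eq_nsq Lg Lu ug; rewrite -Lu' /nsq.
have := has_sum_inner Le e_bessel hc Lg Hg.
have -> : analysis mu e g = analysis mu e u by apply/funext => i; exact: gE.
by rewrite ell2_inner_self// => ->.
Qed.

End Orthonormal.

(** * Modulated families and their fibers *)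

Section RationalApproximation.
Variable R : realType.

(** The approximation is taken from the side of 0, so that rational coefficients never exceed the
    original ones in modulus and a Bessel constant survives unchanged. *)
Lemma rat_approx (a e : R) : 0 < e ->
  exists q : rat, `|ratr q : R| <= `|a| /\ `|a - ratr q| < e.
Proof.
move=> e0; have [a0|a0|->] := ltgtP a 0; last first.
- by exists 0; rewrite rmorph0 subr0 normr0.
- have /rat_in_itvoo[q] : Num.max 0 (a - e) < a by rewrite gt_max a0 gtrBl.
  rewrite in_itv /= gt_max => /andP[/andP[q0 qe] qa]; exists q.
  by rewrite !gtr0_norm ?subr_gt0// ltW//; split=> //; rewrite ltrBlDr -ltrBlDl.
- have /rat_in_itvoo[q] : a < Num.min 0 (a + e) by rewrite lt_min a0 ltrDl.
  rewrite in_itv /= lt_min => /andP[qa /andP[q0 qe]]; exists q.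
  rewrite !ltr0_norm ?subr_lt0// lerN2 ltW//; split=> //.
  by rewrite opprB ltrBlDl.
Qed.

Definition rat_complex (q : rat * rat) : R[i] := Complex (ratr q.1) (ratr q.2).

Lemma rat_complex_approx (z : R[i]) (e : R) : 0 < e ->
  exists q, csq (rat_complex q) <= csq z /\ Normc.normc (z - rat_complex q) < e.
Proof.
move=> e0; have e2 : 0 < e / 2 by rewrite divr_gt0.
have [p [p1 p2]] := rat_approx (complex.Re z) e2.
have [q [q1 q2]] := rat_approx (complex.Im z) e2.
exists (p, q); split.
  rewrite /csq /= -(real_normK (num_real (ratr p))) -(real_normK (num_real (ratr q))).
  rewrite -(real_normK (num_real (complex.Re z))) -(real_normK (num_real (complex.Im z))).
  by rewrite lerD// ler_sqr ?nnegrE.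
apply: le_lt_trans (normc_le_ReIm _) _; rewrite !raddfB /= (splitr e).
by rewrite ltrD.
Qed.

End RationalApproximation.

Section FiniteMeasure.
Context d (T : measurableType d) (R : realType).
Variable mu : {measure set T -> \bar R}.

Lemma ae_bounded_cL2 (k : T -> R[i]) (M : R) : (mu setT < +oo)%E -> 0 <= M ->
  cmeasurable k -> {ae mu, forall x, csq (k x) <= M} -> cL2 mu k.
Proof.
move=> muT M0 mk kM; apply/cL2P; split=> //.
apply: (@le_lt_trans _ _ (\int[mu]_x M%:E)%E).
  apply: ae_ge0_le_integral => //.
  - by move=> x _; rewrite lee_fin csq_ge0.
  - exact: measurable_ecsq.
  - by apply: filterS kM => x h _; rewrite lee_fin.
by rewrite integral_cst// lte_mul_pinfty.
Qed.

Lemma bounded_cL2 (k : T -> R[i]) (M : R) : (mu setT < +oo)%E -> 0 <= M ->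
  cmeasurable k -> (forall x, csq (k x) <= M) -> cL2 mu k.
Proof. by move=> muT M0 mk kM; apply: (ae_bounded_cL2 (M := M)) => //; exact: aeW. Qed.

(** Coefficients are a list of rational pairs read through [index]: together with a finite set over
    a countable index type, such data form a countable type. *)
Lemma rational_comb_approx (I : choiceType) (s : {fset I}) (c : I -> R[i])
    (F : I -> T -> R[i]) (r : R) : (forall i, cL2 mu (F i)) -> 0 < r ->
  exists2 q : seq (rat * rat),
    \sum_(i <- s) csq (rat_complex R (nth (0, 0) q (index i s))) <=
      \sum_(i <- s) csq (c i) &
    nrm mu (fun x => \sum_(i <- s) c i * F i x -
      \sum_(i <- s) rat_complex R (nth (0, 0) q (index i s)) * F i x) < r.
Proof.
move=> LF r0; pose S := \sum_(i <- s) nrm mu (F i).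
have S0 : 0 <= S by apply: sumr_ge0 => i _; exact: nrm_ge0.
have S1 : 0 < S + 1 by rewrite ltr_wpDl.
have e0 := divr_gt0 r0 S1.
have /choice[q hq] i := rat_complex_approx (c i) e0.
exists [seq q i | i <- s].
  rewrite big_seq [leRHS]big_seq; apply: ler_sum => i si.
  by rewrite (nth_map i) ?index_mem// nth_index//; exact: (hq i).1.
set c' := fun i => rat_complex R (nth (0, 0) [seq q i | i <- s] (index i s)).
rewrite (_ : (fun x => _) = (fun x => \sum_(i <- s) (c i - c' i) * F i x)); last first.
  apply/funext => x; rewrite -sumrB; apply: eq_bigr => i _.
  by rewrite mulrBl.
apply: le_lt_trans (nrm_sum (fun i _ => cL2Z _ (LF i))) _.
apply: (@le_lt_trans _ _ (\sum_(i <- s) (r / (S + 1)) * nrm mu (F i))).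
  rewrite big_seq [leRHS]big_seq; apply: ler_sum => i si; rewrite nrmZ//.
  rewrite ler_wpM2r ?nrm_ge0// /c' (nth_map i) ?index_mem// nth_index// ltW//.
  exact: (hq i).2.
by rewrite -mulr_sumr -/S mulrAC ltr_pdivrMr// ltr_pM2l// ltrDl.
Qed.

End FiniteMeasure.

(** * Families modulated by a unimodular orthonormal basis *)

Section Modulation.
Context d1 d2 (T1 : measurableType d1) (T2 : measurableType d2) (R : realType).
Variable m1 : {sigma_finite_measure set T1 -> \bar R}.
Hypothesis m1T : m1 setT = 1%E.
Variable m2 : {sigma_finite_measure set T2 -> \bar R}.
Local Notation m12 := (m1 \x m2)%E.
Context (A : choiceType) (N : countType).
Variable e : A -> T1 -> R[i].
Hypothesis me : forall i, cmeasurable (e i).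
Hypothesis e1 : forall i x, csq (e i x) = 1.
Hypothesis e_orthonormal : forall i j, inner m1 (e i) (e j) = if i == j then 1 else 0.
Hypothesis e_total : forall w, cL2 m1 w -> (forall i, inner m1 w (e i) = 0) ->
  w = (fun=> 0) %[ae m1].
Implicit Types (F H : T1 * T2 -> R[i]) (Phi Psi : N -> T1 * T2 -> R[i]).

Let m1_fin : (m1 setT < +oo)%E.
Proof. by rewrite m1T ltry. Qed.

Let Le i : cL2 m1 (e i).
Proof. by apply: (bounded_cL2 (M := 1) m1_fin ler01 (me i)) => x; rewrite e1. Qed.

Definition modulate Phi (i : A * N) (p : T1 * T2) : R[i] := e i.1 p.1 * Phi i.2 p.

Lemma cL2_mod i F : cL2 m12 F -> cL2 m12 (fun p => e i p.1 * F p).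
Proof. by move=> LF; apply: (cL2_fst_mul (M := 1)) => // x; rewrite e1. Qed.

Lemma cL2_modulate Phi i : (forall t, cL2 m12 (Phi t)) -> cL2 m12 (modulate Phi i).
Proof. by move=> LP; exact: cL2_mod. Qed.

Lemma fiber_inner_mul (k l : T1 -> R[i]) F H : cL2 m12 F -> cL2 m12 H ->
  {ae m1, forall x, fiber_inner m2 (fun p => k p.1 * F p) (fun p => l p.1 * H p) x =
    k x * conjc (l x) * fiber_inner m2 F H x}.
Proof.
move=> LF LH; apply: filterS2 (cL2_section LF) (cL2_section LH) => x Lf Lh.
rewrite /fiber_inner /= innerZ//; last exact: cL2Z.
by rewrite innerZr// mulrA.
Qed.

Lemma inner_mul (k l : T1 -> R[i]) (M : R) F H :
  cmeasurable k -> (forall x, csq (k x) <= M) ->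
  cmeasurable l -> (forall x, csq (l x) <= M) ->
  cL2 m12 F -> cL2 m12 H ->
  inner m12 (fun p => k p.1 * F p) (fun p => l p.1 * H p) =
  cintegral m1 (fun x => k x * conjc (l x) * fiber_inner m2 F H x).
Proof.
move=> mk kM ml lM LF LH.
have LkF := cL2_fst_mul mk kM LF; have LlH := cL2_fst_mul ml lM LH.
rewrite (inner_fiber LkF LlH); apply: ae_eq_cintegral.
- exact: cintegrable_measurable (fiber_inner_integrable LkF LlH).
- apply: cmeasurableM; last exact: cintegrable_measurable (fiber_inner_integrable LF LH).
  by apply: cmeasurableM => //; exact: cmeasurable_conj.
- by apply: filterS (fiber_inner_mul k l LF LH) => x ->.
Qed.

(** * The Bessel bound in almost every fiber *)

Section FiberBessel.
Variables (B : R) (Phi : N -> T1 * T2 -> R[i]).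
Hypotheses (B0 : 0 <= B) (LPhi : forall t, cL2 m12 (Phi t)).
Hypothesis bPhi : bessel_bound m12 B (modulate Phi).

Implicit Types (s : {fset N}) (c : N -> R[i]).

Let comb s c p := \sum_(t <- s) c t * Phi t p.

Let Lcomb s c : cL2 m12 (comb s c).
Proof. exact: cL2_comb. Qed.

Let K s c x := nsq m2 (fun y => comb s c (x, y)).

Let mK s c : measurable_fun setT (K s c).
Proof.
have [h _] := nsq_fiber (Lcomb s c).
exact/measurable_EFinP/(measurable_int _ h).
Qed.

(** Cauchy-Schwarz over [s] separates the coefficients from the products with [modulate Phi (a, t)];
    the Bessel bound then handles the pairs [(a, t)] all at once. *)
Let bound_comb s c F (S : {fset A}) : cL2 m12 F ->
  \sum_(a <- S) csq (inner m12 F (fun p => e a p.1 * comb s c p)) <=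
  (\sum_(t <- s) csq (c t)) * (B * nsq m12 F).
Proof.
move=> LF.
have E a : inner m12 F (fun p => e a p.1 * comb s c p) =
    \sum_(t <- s) conjc (c t) * inner m12 F (modulate Phi (a, t)).
  rewrite -inner_sumr//; last by move=> t _; exact: cL2_modulate.
  congr inner; apply/funext => p; rewrite /comb mulr_sumr; apply: eq_bigr => t _.
  by rewrite /modulate /= mulrCA.
apply: (@le_trans _ _ (\sum_(a <- S) (\sum_(t <- s) csq (c t)) *
    (\sum_(t <- s) csq (inner m12 F (modulate Phi (a, t)))))).
  apply: ler_sum => a _; rewrite E; apply: le_trans (csq_sum_le _ _ _) _.
  by under [X in X * _ <= _]eq_bigr do rewrite csq_conj.
rewrite -mulr_sumr ler_wpM2l//.
  by apply: sumr_ge0 => t _; exact: csq_ge0.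
rewrite (pair_big_dep_cond _ S (fun=> s) xpredT (fun _ => xpredT)).
apply: le_trans (bPhi _ LF).
by under [X in X <= _]eq_bigr do rewrite -surjective_pairing.
Qed.

Let K_le_trunc s c (M : R) :
  {ae m1, forall x, ~~ (B * \sum_(t <- s) csq (c t) < K s c x <= M)}.
Proof.
set C := \sum_(t <- s) csq (c t).
have C0 : 0 <= C by apply: sumr_ge0 => t _; exact: csq_ge0.
have BC0 : 0 <= B * C by rewrite mulr_ge0.
(* The upper cutoff [M] makes [1_E K] bounded, hence square-integrable, so that Parseval applies to
   it. *)
pose E := [set x | B * C < K s c x <= M].
have mE : measurable E.
  have := mK s c measurableT (measurable_itv `]B * C, M]); rewrite setTI.
  by congr measurable; apply/seteqP; split=> x /=; rewrite in_itv.
pose k (x : T1) : R[i] := (\1_E x)%:C%C.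
have mk : cmeasurable k.
  by split; [exact: measurable_indic|exact: measurable_cst].
have k1 x : csq (k x) <= 1.
  by rewrite /k csq_real indicE; case: (_ \in _); rewrite ?expr1n// expr2 mulr0.
pose F p := k p.1 * comb s c p.
have LF : cL2 m12 F by exact: (cL2_fst_mul mk k1).
pose v x : R := \1_E x * K s c x.
pose u x : R[i] := (v x)%:C%C.
have mv : measurable_fun setT v.
  by apply: measurable_funM => //; exact: measurable_indic.
have Lu : cL2 m1 u.
  apply: (bounded_cL2 (M := `|M| ^+ 2) m1_fin); [by rewrite exprn_ge0|by split|].
  move=> x; rewrite /u csq_real /v indicE.
  have [/set_mem [/andP[h1 h2]]|_] := boolP (x \in E).
    have K0 : 0 <= K s c x by exact: nsq_ge0.
    rewrite mul1r ler_sqr ?nnegrE//; exact: le_trans h2 (ler_norm _).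
  by rewrite mul0r expr2 mulr0 exprn_ge0.
(* The products bounded by [bound_comb] are the Fourier coefficients of [u], so Parseval will give
   [int v^2 <= B C int v]. *)
have E1 a : inner m12 F (fun p => e a p.1 * comb s c p) = inner m1 u (e a).
  rewrite (inner_mul mk k1 (me a) _ (Lcomb s c) (Lcomb s c)); last by move=> x; rewrite e1.
  rewrite /inner; congr cintegral; apply/funext => x.
  by rewrite /fiber_inner inner_self /u /v /k rmorphM /= mulrAC.
have EK x : nsq m2 (fun y => F (x, y)) = v x.
  rewrite /v /F /k /= indicE; case: (x \in E) => /=.
    by rewrite mul1r; under eq_fun do rewrite mul1r.
  by rewrite mul0r; under eq_fun do rewrite mul0r; rewrite /nsq inner0l.
have [iF E2] := nsq_fiber LF.
have iv : m1.-integrable setT (EFin \o v).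
  by apply: eq_integrable iF => // x _; rewrite EK.
have {}E2 : nsq m12 F = \int[m1]_x v x by rewrite E2; apply: eq_Rintegral => x _.
have [hu pu] := parseval Le e_orthonormal e_total Lu.
have h : nsq m1 u <= C * (B * nsq m12 F).
  rewrite -pu; apply: (ell2_le_bound _).2 => S.
  by under eq_bigr do rewrite /analysis -E1; exact: bound_comb.
have iv2 : m1.-integrable setT (fun x => (v x ^+ 2)%:E).
  by apply: eq_integrable (cL2_integrable Lu) => // x _; rewrite csq_real.
have E3 : nsq m1 u = \int[m1]_x (v x ^+ 2).
  by rewrite nsqE; congr fine; apply: eq_integral => x _; rewrite csq_real.
have iZ : m1.-integrable setT (EFin \o (fun x => B * C * v x)).
  apply: (eq_integrable measurableT (fun x => (B * C)%:E * (v x)%:E)%E) => //.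
  exact: integrableZl.
(* On [E] one has [v > B C], so the integrand is nonnegative, while its integral is at most 0. It
   must vanish almost everywhere, which no point of [E] allows. *)
have : {ae m1, forall x, v x ^+ 2 - B * C * v x = 0}.
  apply: ge0_integral_le0.
  - move=> x; rewrite /v indicE; have [/set_mem [/andP[h1 h2]]|_] := boolP (x \in E).
      by rewrite mul1r expr2 -mulrBl mulr_ge0 ?subr_ge0 ?ltW// (le_lt_trans BC0).
    by rewrite mul0r mulr0 expr2 mulr0 subr0.
  - apply: (eq_integrable measurableT (fun x => (v x ^+ 2)%:E - (B * C * v x)%:E)%E) => //.
    exact: integrableB.
  - rewrite RintegralB// RintegralZl// -E2 -E3 subr_le0.
    by rewrite mulrAC mulrC.
apply: filterS => x; apply: contra_eqN => hx.
have xE : E x by exact: hx.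
move/andP: hx => [h1 h2]; rewrite /v indicE mem_set//= mul1r expr2 -mulrBl.
by rewrite gt_eqF// mulr_gt0 ?subr_gt0// (le_lt_trans BC0).
Qed.

Let K_le s c : {ae m1, forall x, K s c x <= B * \sum_(t <- s) csq (c t)}.
Proof.
have := ae_foralln (fun n => K_le_trunc s c n%:R).
apply: filterS => x h; rewrite leNgt; apply/negP => hlt.
have := h (Num.bound (K s c x)); rewrite hlt /= => /negP; apply.
by rewrite ltW// archi_boundP// nsq_ge0.
Qed.

Lemma fiber_bessel_bound :
  {ae m1, forall x, (forall t, cL2 m2 (fun y => Phi t (x, y))) /\
    bessel_bound m2 B (fun t y => Phi t (x, y))}.
Proof.
pose rc (i : {fset N} * seq (rat * rat)) t := rat_complex R (nth (0, 0) i.2 (index t i.1)).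
have H1 := ae_forall_count (fun i : {fset N} * seq (rat * rat) => K_le i.1 (rc i)).
have H2 := ae_forall_count (fun t => cL2_section (LPhi t)).
apply: filterS2 H1 H2 => x hK Lx; split=> //.
apply: synthesis_bessel => // s c.
set C := \sum_(t <- s) csq (c t).
have C0 : 0 <= C by apply: sumr_ge0 => t _; exact: csq_ge0.
pose f (c' : N -> R[i]) := fun y => \sum_(t <- s) c' t * Phi t (x, y).
have Lf c' : cL2 m2 (f c') by apply: cL2_comb.
rewrite -/(f c) -nrm_sq -(@sqr_sqrtr _ (B * C)) ?mulr_ge0//.
rewrite ler_sqr ?nnegrE ?nrm_ge0 ?sqrtr_ge0//.
apply/ler_addgt0Pr => r r0.
have [q q1 q2] := rational_comb_approx s c Lx r0.
pose c' := rc (s, q).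
have -> : f c = (fun y => f c' y + (f c y - f c' y)).
  by apply/funext => y; rewrite addrC subrK.
apply: le_trans (nrmD (Lf _) (cL2B (Lf _) (Lf _))) _.
rewrite lerD//; last exact: ltW.
(* The rational coefficients have squared sum at most [C], so the constant [B] is kept for arbitrary
   coefficients. *)
apply: ler_wsqrtr; apply: le_trans (hK (s, q)) _.
by rewrite ler_wpM2l.
Qed.

End FiberBessel.

(** * Exchanging the l^2 pairing with the integral *)

Section EllFiber.
Variables (u v : N -> T1 -> R[i]) (M : R).
Hypotheses (Lu : forall t, cL2 m1 (u t)) (Lv : forall t, cL2 m1 (v t)).
Hypothesis u_ell2 : {ae m1, forall x, ell2 (u^~ x) /\ sumsq (u^~ x) <= M}.
Hypothesis v_ell2 : {ae m1, forall x, ell2 (v^~ x) /\ sumsq (v^~ x) <= M}.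
Hypothesis M0 : 0 <= M.

Let an (w : N -> T1 -> R[i]) (i : A * N) := analysis m1 e (w i.2) i.1.

(** Parseval for each [t] and Tonelli over [t] equate the sum of all squared Fourier coefficients
    with the integral of the fiberwise squared norms. The form [u + z v] prepares for
    polarization. *)
Let sumsq_modulate z : let w t x := u t x + z * v t x in
  [/\ ell2 (an w), m1.-integrable setT (fun x => (sumsq (w^~ x))%:E) &
    sumsq (an w) = \int[m1]_x (sumsq (w^~ x))].
Proof.
move=> w; have Lw t : cL2 m1 (w t).
  by apply: cL2D => //; exact: cL2Z.
have mw t : measurable_fun setT (fun x => (csq (w t x))%:E).
  exact: measurable_ecsq (cL2_measurable (Lw t)).
have w0 t x : (0 <= (csq (w t x))%:E)%E by rewrite lee_fin csq_ge0.
have E : (\esum_(i in [set: A * N]) (csq (an w i))%:E =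
    \int[m1]_x (\esum_(t in [set: N]) (csq (w t x))%:E))%E.
  (* The factors are swapped so that the inner sum runs over the Fourier index, where Parseval
     applies. *)
  rewrite (reindex_esum [set: N * A] _ (fun i => (i.2, i.1))); last first.
    split => //; first by move=> [a b] [a' b'] _ _ /= [-> ->].
    by move=> [a b] _; exists (b, a).
  have := @esum_esum R N A setT (fun=> setT)
    (fun t a => (csq (analysis m1 e (w t) a))%:E).
  have -> : [set: N] `*`` (fun=> [set: A]) = setT by apply/seteqP; split.
  move=> <-; last by move=> t a _ _; rewrite lee_fin csq_ge0.
  rewrite integral_esum//; apply: eq_esum => t _.
  have [hc pc] := parseval Le e_orthonormal e_total (Lw t).
  by rewrite -sumsqE// pc nsq_EFin.
have ae_w : {ae m1, forall x, ell2 (w^~ x) /\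
    sumsq (w^~ x) <= 2 * M + 2 * csq z * M}.
  apply: filterS2 u_ell2 v_ell2 => x [h1 k1] [h2 k2].
  have [h3 k3] := ell2_lin z h1 h2; split=> //; apply: (le_trans k3).
  by rewrite lerD// ler_wpM2l// mulr_ge0// csq_ge0.
have ae_E : ae_eq m1 setT (fun x => \esum_(t in [set: N]) (csq (w t x))%:E)%E
    (fun x => (sumsq (w^~ x))%:E).
  by apply: filterS ae_w => x [h _] _; rewrite sumsqE.
have mS : measurable_fun setT (fun x => \esum_(t in [set: N]) (csq (w t x))%:E)%E.
  exact: measurable_esum.
have mS' : measurable_fun setT (fun x => (sumsq (w^~ x))%:E).
  by apply/measurable_EFinP; apply: measurableT_comp.
have E' : (\esum_(i in [set: A * N]) (csq (an w i))%:E =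
    \int[m1]_x (sumsq (w^~ x))%:E)%E.
  by rewrite E; apply: ae_eq_integral.
have fin : (\int[m1]_x (sumsq (w^~ x))%:E < +oo)%E.
  apply: (@le_lt_trans _ _ (\int[m1]_x (2 * M + 2 * csq z * M)%:E)%E).
    apply: ae_ge0_le_integral => //.
    - by move=> x _; rewrite lee_fin sumsq_ge0.
    - by move=> x _; rewrite lee_fin addr_ge0// !mulr_ge0// csq_ge0.
    - by apply: filterS ae_w => x [_ h] _; rewrite lee_fin.
  rewrite integral_cst// lte_mul_pinfty// lee_fin.
  by rewrite addr_ge0// !mulr_ge0// csq_ge0.
split; first by apply/ell2E; rewrite E'.
- apply/integrableP; split=> //.
  by under eq_integral do rewrite gee0_abs ?lee_fin ?sumsq_ge0//.
- by rewrite /sumsq E'.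
Qed.

(** Both pairings are the same combination of four squared norms, so the four instances of
    [sumsq_modulate] suffice and only sums of nonnegative terms are exchanged with an integral. *)
Lemma ell2_inner_fiber : cintegrable m1 (fun x => ell2_inner (u^~ x) (v^~ x)) /\
  ell2_inner (an u) (an v) = cintegral m1 (fun x => ell2_inner (u^~ x) (v^~ x)).
Proof.
have anE z : (fun i => an u i + z * an v i) = an (fun t x => u t x + z * v t x).
  apply/funext => i; rewrite /an /analysis innerD ?innerZ//; exact: cL2Z.
have [h1 i1 s1] := sumsq_modulate 1; have [h2 i2 s2] := sumsq_modulate (-1).
have [h3 i3 s3] := sumsq_modulate 'i%C; have [h4 i4 s4] := sumsq_modulate (- 'i%C).
have int f g : m1.-integrable setT (fun x => (f x)%:E) ->
    m1.-integrable setT (fun x => (g x)%:E) ->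
    m1.-integrable setT (fun x => ((f x - g x) / 4)%:E) /\
    \int[m1]_x ((f x - g x) / 4) = (\int[m1]_x f x - \int[m1]_x g x) / 4.
  move=> fi gi; have fgi : m1.-integrable setT (EFin \o (fun x => f x - g x)).
    apply: (eq_integrable measurableT (fun x => (f x)%:E - (g x)%:E)%E) => //.
    exact: integrableB.
  split; last by rewrite RintegralZr// RintegralB.
  apply: (eq_integrable measurableT (fun x => (4^-1)%:E * ((f x) - (g x))%:E)%E).
    by move=> x _; rewrite mulrC EFinM.
  exact: integrableZl.
have [a1 b1] := int _ _ i1 i2; have [a2 b2] := int _ _ i3 i4.
split; first by split.
rewrite /ell2_inner !anE /cintegral /= b1 b2.
by rewrite -s1 -s2 -s3 -s4.
Qed.

End EllFiber.

Section FiberGramian.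
Variables (B : R) (Phi : N -> T1 * T2 -> R[i]).
Hypotheses (B0 : 0 <= B) (LPhi : forall t, cL2 m12 (Phi t)).
Hypothesis bPhi : bessel_bound m12 B (modulate Phi).

Lemma fiber_gramian_ell2 j : {ae m1, forall x,
  ell2 (fun t => fiber_inner m2 (Phi j) (Phi t) x) /\
  sumsq (fun t => fiber_inner m2 (Phi j) (Phi t) x) <= B ^+ 2}.
Proof.
apply: filterS (fiber_bessel_bound B0 LPhi bPhi) => x [Lx bx].
have [h1 h2] := analysis_ell2 bx (Lx j); split=> //; apply: (le_trans h2).
rewrite expr2 ler_wpM2l//.
(* The one-term Bessel inequality for [Phi j] itself reads [q^2 <= B q], hence [q <= B]; this is the
   second factor of [B ^+ 2]. *)
have := bx _ [fset j]%fset (Lx j); rewrite big_seq_fset1 inner_self csq_real.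
have := nsq_ge0 m2 (fun y => Phi j (x, y)); set q := nsq _ _ => q0.
have [->|qn] := eqVneq q 0; first by [].
by rewrite expr2 ler_pM2r// lt_def qn.
Qed.

Lemma fiber_gramian_cL2 j t : cL2 m1 (fiber_inner m2 (Phi j) (Phi t)).
Proof.
apply: (ae_bounded_cL2 (M := B ^+ 2) m1_fin); first by rewrite exprn_ge0.
  exact: cintegrable_measurable (fiber_inner_integrable (LPhi j) (LPhi t)).
apply: filterS (fiber_gramian_ell2 j) => x [h]; apply: le_trans.
by have := sum_le_sumsq [fset t]%fset h; rewrite big_seq_fset1.
Qed.

(** Moving the modulations onto the first variable exhibits a row of the global Gram matrix as the
    Fourier coefficients of a fiberwise row multiplied by [e a]. *)
Lemma analysis_modulate a j : analysis m12 (modulate Phi) (modulate Phi (a, j)) =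
  (fun i => analysis m1 e (fun x => e a x * fiber_inner m2 (Phi j) (Phi i.2) x) i.1).
Proof.
apply/funext => -[b t]; rewrite /analysis /modulate /=.
rewrite (inner_mul (me a) (M := 1) _ (me b) _ (LPhi j) (LPhi t)) => [|x|x];
  rewrite ?e1//.
by rewrite /inner; congr cintegral; apply/funext => x; rewrite mulrAC.
Qed.

End FiberGramian.

(** * Global against fiberwise Gram products *)

Section Gramians.
Variables (BF BE : R) (Phi Psi : N -> T1 * T2 -> R[i]).
Hypotheses (BF0 : 0 <= BF) (LPhi : forall t, cL2 m12 (Phi t)).
Hypothesis bPhi : bessel_bound m12 BF (modulate Phi).
Hypotheses (BE0 : 0 <= BE) (LPsi : forall t, cL2 m12 (Psi t)).
Hypothesis bPsi : bessel_bound m12 BE (modulate Psi).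
Hypothesis e_unit : exists i, forall x, e i x = 1.

Let w j k x := ell2_inner (fun t => fiber_inner m2 (Psi j) (Psi t) x)
                          (fun t => fiber_inner m2 (Phi k) (Phi t) x).

(** One constant dominating the rows of both Gramians, as [ell2_inner_fiber] takes a common
    bound. *)
Let M := BE ^+ 2 + BF ^+ 2.

Let M0 : 0 <= M.
Proof. by rewrite addr_ge0// exprn_ge0. Qed.

Let gPsi j : {ae m1, forall x, ell2 (fun t => fiber_inner m2 (Psi j) (Psi t) x) /\
  sumsq (fun t => fiber_inner m2 (Psi j) (Psi t) x) <= M}.
Proof.
apply: filterS (fiber_gramian_ell2 BE0 LPsi bPsi j) => x [h k]; split=> //.
by apply: (le_trans k); rewrite lerDl exprn_ge0.
Qed.

Let gPhi k : {ae m1, forall x, ell2 (fun t => fiber_inner m2 (Phi k) (Phi t) x) /\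
  sumsq (fun t => fiber_inner m2 (Phi k) (Phi t) x) <= M}.
Proof.
apply: filterS (fiber_gramian_ell2 BF0 LPhi bPhi k) => x [h h']; split=> //.
by apply: (le_trans h'); rewrite lerDr exprn_ge0.
Qed.

Let w_cL2 j k : cL2 m1 (w j k).
Proof.
have [h _] := ell2_inner_fiber (fiber_gramian_cL2 BE0 LPsi bPsi j)
  (fiber_gramian_cL2 BF0 LPhi bPhi k) (gPsi j) (gPhi k) M0.
apply: (ae_bounded_cL2 (M := M * M) m1_fin); first by rewrite mulr_ge0.
  exact: cintegrable_measurable h.
apply: filterS2 (gPsi j) (gPhi k) => x [h1 h2] [h3 h4].
rewrite -normc_sq -(@sqr_sqrtr _ (M * M)) ?mulr_ge0// ler_sqr ?nnegrE ?normc_ge0 ?sqrtr_ge0//.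
apply: le_trans (ell2_inner_le h1 h3) _; apply: ler_wsqrtr.
by rewrite ler_pM ?sumsq_ge0.
Qed.

Let global_entry a b j k :
  ell2_inner (analysis m12 (modulate Psi) (modulate Psi (a, j)))
             (analysis m12 (modulate Phi) (modulate Phi (b, k))) =
  cintegral m1 (fun x => e a x * w j k x * conjc (e b x)).
Proof.
rewrite (analysis_modulate LPsi) (analysis_modulate LPhi).
pose u t x := e a x * fiber_inner m2 (Psi j) (Psi t) x.
pose v t x := e b x * fiber_inner m2 (Phi k) (Phi t) x.
have mulL c g : cL2 m1 g -> cL2 m1 (fun x => e c x * g x).
  move=> Lg; apply: (cL2_dominated _ (cL2_integrable Lg)).
    exact: cmeasurableM (me c) (cL2_measurable Lg).
  by move=> x; rewrite csqM e1 mul1r.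
have ellM c (g : N -> R[i]) x : ell2 g /\ sumsq g <= M ->
    ell2 (fun t => e c x * g t) /\ sumsq (fun t => e c x * g t) <= M.
  have -> : sumsq (fun t => e c x * g t) = sumsq g.
    by congr fine; apply: eq_esum => t _; rewrite csqM e1 mul1r.
  by move=> [h h']; split=> //; exact: ell2Z.
have Lu t : cL2 m1 (u t) by apply: mulL; exact: (fiber_gramian_cL2 BE0 LPsi bPsi).
have Lv t : cL2 m1 (v t) by apply: mulL; exact: (fiber_gramian_cL2 BF0 LPhi bPhi).
have hu : {ae m1, forall x, ell2 (u^~ x) /\ sumsq (u^~ x) <= M}.
  by apply: filterS (gPsi j) => x; exact: ellM.
have hv : {ae m1, forall x, ell2 (v^~ x) /\ sumsq (v^~ x) <= M}.
  by apply: filterS (gPhi k) => x; exact: ellM.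
have [i1 ->] := ell2_inner_fiber Lu Lv hu hv M0.
apply: ae_eq_cintegral; first exact: cintegrable_measurable i1.
  apply: cmeasurableM; last exact: cmeasurable_conj.
  exact: cmeasurableM (me a) (cL2_measurable (w_cL2 j k)).
apply: filterS2 (gPsi j) (gPhi k) => x [h1 _] [h2 _] _.
rewrite /u /v ell2_innerZl//; last exact: ell2Z.
by rewrite ell2_innerZr// mulrA mulrAC.
Qed.

Lemma gramians_orthogonal_fiberP :
  gramians_orthogonal m12 (modulate Phi) (modulate Psi) <->
  {ae m1, forall x, gramians_orthogonal m2 (fun t y => Phi t (x, y))
                                          (fun t y => Psi t (x, y))}.
Proof.
split=> [H|H [a j] [b k]].
  have [i0 hi0] := e_unit.
  have : {ae m1, forall x jk, w jk.1 jk.2 x = 0}.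
    apply: ae_forall_count => -[j k] /=.
    have := e_total (w_cL2 j k) _; case.
      (* As [e i0] is constant 1, the entries with first index [i0] run through all Fourier
         coefficients of [w j k]. *)
      move=> b; have := H (i0, j) (b, k); rewrite global_entry => <-.
      by rewrite /inner; congr cintegral; apply/funext => x; rewrite hi0 mul1r.
    by move=> S [mS S0 hS]; exists S; split=> // x /= hx; apply: hS => /= h; exact/hx/h.
  by apply: filterS => x h j k; exact: (h (j, k)).
rewrite global_entry; transitivity (cintegral m1 (fun=> 0 : R[i])).
  apply: ae_eq_cintegral; last 2 first.
  - exact: cmeasurable_cst.
  - apply: filterS H => x h _; have := h j k.
    by rewrite -[ell2_inner _ _]/(w j k x) => ->; rewrite mulr0 mul0r.
  apply: cmeasurableM; last exact: cmeasurable_conj.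
  exact: cmeasurableM (me a) (cL2_measurable (w_cL2 j k)).
by have := inner0l m1 (fun=> 0); rewrite /inner; under eq_fun do rewrite mul0r.
Qed.

End Gramians.

End Modulation.

(** * Totality in almost every fiber *)

Section ClosedSpan.
Context d (T : measurableType d) (R : realType).
Variable mu : {measure set T -> \bar R}.
Context (I : choiceType).
Implicit Types (F : I -> T -> R[i]) (f g : T -> R[i]).

Lemma closed_span_closed F f : (forall i, cL2 mu (F i)) -> cL2 mu f ->
  (forall r : R, 0 < r -> exists2 g, closed_span mu F g &
     nrm mu (fun x => f x - g x) < r) -> closed_span mu F f.
Proof.
move=> HF Lf H; apply/closed_spanP => //; split=> // r r0.
have r2 : 0 < r / 2 by rewrite divr_gt0.
have [g Sg fg] := H _ r2; have [Lg /(_ _ r2) [s [c gc]]] := (closed_spanP g HF).1 Sg.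
exists s, c; apply: le_lt_trans (nrm_trans Lf Lg _) _; first exact: cL2_comb.
by rewrite (splitr r) ltrD.
Qed.

Lemma rational_span F f : (forall i, cL2 mu (F i)) -> closed_span mu F f ->
  forall r : R, 0 < r -> exists (s : {fset I}) (q : seq (rat * rat)),
  nrm mu (fun x => f x -
    \sum_(i <- s) rat_complex R (nth (0, 0) q (index i s)) * F i x) < r.
Proof.
move=> HF Sf r r0; have r2 : 0 < r / 2 by rewrite divr_gt0.
have [Lf /(_ _ r2) [s [c fc]]] := (closed_spanP f HF).1 Sf.
have [q _ cq] := rational_comb_approx s c HF r2.
have Lc c' : cL2 mu (fun x => \sum_(i <- s) c' i * F i x) by exact: cL2_comb.
exists s, q; apply: le_lt_trans (nrm_trans Lf (Lc c) (Lc _)) _.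
by rewrite (splitr r) ltrD.
Qed.

End ClosedSpan.

Section FiberSpan.
Context d1 d2 (T1 : measurableType d1) (T2 : measurableType d2) (R : realType).
Variable m1 : {sigma_finite_measure set T1 -> \bar R}.
Hypothesis m1T : m1 setT = 1%E.
Variable m2 : {sigma_finite_measure set T2 -> \bar R}.
Local Notation m12 := (m1 \x m2)%E.
Context (A : choiceType) (N : countType).
Variable e : A -> T1 -> R[i].
Hypothesis me : forall i, cmeasurable (e i).
Hypothesis e1 : forall i x, csq (e i x) = 1.
Variable en : nat -> A.
Hypothesis en_surj : forall a, exists n, en n = a.
Variable Psi : N -> T1 * T2 -> R[i].
Hypothesis LPsi : forall t, cL2 m12 (Psi t).
Hypothesis Psi_total : forall F, cL2 m12 F -> closed_span m12 (modulate e Psi) F.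

(** Since [m1] has total mass 1, extending [h] constantly in the first variable is an isometric
    embedding; global totality is applied to the extended functions. *)
Lemma cL2_snd (h : T2 -> R[i]) : cL2 m2 h -> cL2 m12 (fun p => h p.2).
Proof.
move=> Lh; have L1 : cL2 m1 (fun=> 1).
  have fin : (m1 setT < +oo)%E by rewrite m1T ltry.
  have mc : cmeasurable (fun _ : T1 => 1 : R[i]) by exact: cmeasurable_cst.
  apply: (bounded_cL2 (M := 1) fin ler01 mc) => _.
  by rewrite /csq /= expr1n expr2 mul0r addr0.
by have := cL2_tensor L1 Lh; under eq_fun do rewrite mul1r.
Qed.

Let nrm_lift (h : T2 -> R[i]) : cL2 m2 h -> nrm m12 (fun p => h p.2) = nrm m2 h.
Proof.
move=> Lh; rewrite /nrm; have [_ ->] := nsq_fiber (cL2_snd Lh).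
have -> : \int[m1]_x nsq m2 (fun y => h (x, y).2) = \int[m1]_x nsq m2 h by [].
congr Num.sqrt; apply: etrans (Rintegral_cst m1 measurableT (nsq m2 h)) _.
exact: etrans (congr1 (fun z => nsq m2 h * fine z) m1T) (mulr1 _).
Qed.

Let Lmod i : cL2 m12 (modulate e Psi i).
Proof. exact: cL2_modulate. Qed.

(** Slicing a combination of the modulated family at [x] gives a combination of the [Psi t] with
    coefficients [c_i e_a(x)]. It remains to make the sliced errors small at almost every [x]. *)
Let fiber_mem h : cL2 m2 h ->
  {ae m1, forall x, closed_span m2 (fun t y => Psi t (x, y)) h}.
Proof.
move=> Lh; have LH := cL2_snd Lh.
have p0 n : 0 < 1 / 2 ^+ n :> R by rewrite divr_gt0// exprn_gt0.
have /choice[sc hsc] n : exists sc : {fset A * N} * (A * N -> R[i]),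
    nrm m12 (fun p => h p.2 - \sum_(i <- sc.1) sc.2 i * modulate e Psi i p) < 1 / 2 ^+ n.
  have [_ /(_ _ (p0 n))[s [c hs]]] := (closed_spanP _ Lmod).1 (Psi_total LH).
  by exists (s, c).
pose D n p := h p.2 - \sum_(i <- (sc n).1) (sc n).2 i * modulate e Psi i p.
have LD n : cL2 m12 (D n) by apply: cL2B => //; exact: cL2_comb.
pose q n x := nsq m2 (fun y => D n (x, y)).
have iq n : m1.-integrable setT (fun x => (q n x)%:E) by exact: (nsq_fiber (LD n)).1.
have mq n : measurable_fun setT (fun x => (q n x)%:E) by exact: measurable_int (iq n).
(* The infimum over all [n] of the fiber errors has integral below every [r > 0], hence is 0 almost
   everywhere; this replaces the choice of an almost everywhere convergent subsequence. *)
pose f x := einfs (fun n => (q n x)%:E) 0.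
have mf : measurable_fun setT f by exact: measurable_fun_einfs.
have f0 x : (0 <= f x)%E.
  by apply: le_ereal_inf_tmp => _ [n _ <-]; rewrite lee_fin nsq_ge0.
have intf : (\int[m1]_x `|f x| = 0)%E.
  apply/eqP; rewrite eq_le; apply/andP; split; last exact: integral_ge0.
  apply/lee_addgt0Pr => r r0; rewrite add0e.
  have [n hn] := exists_pow2_lt r0.
  apply: (@le_trans _ _ (\int[m1]_x (q n x)%:E)%E).
    apply: ge0_le_integral => //.
    - exact: measurableT_comp.
    - by move=> x _; rewrite gee0_abs//; apply: ge_ereal_inf; exists (q n x)%:E => //; exists n.
  rewrite -(fineK (integrable_fin_num _ (iq n)))// lee_fin.
  rewrite -[fine _]/(\int[m1]_x q n x) -(nsq_fiber (LD n)).2 -nrm_sq.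
  apply: le_trans (ltW hn).
  have := ltW (hsc n); rewrite -/(D n) => hD.
  apply: (@le_trans _ _ (1 / 2 ^+ n)); last by rewrite ler_pM2r ?invr_gt0 ?exprn_gt0//; lra.
  apply: (@le_trans _ _ (nrm m12 (D n) * 1)); last by rewrite mulr1.
  rewrite expr2 ler_wpM2l ?nrm_ge0//; apply: (le_trans hD).
  by rewrite ler_pdivrMr ?exprn_gt0// mul1r exprn_ege1// ler1n.
have := (ae_eq_integral_abs m1 measurableT mf).1 intf.
apply: filterS2 (ae_forall_count (fun t => cL2_section (LPsi t))) => x Lx /(_ I) fx.
apply: closed_span_closed => // r r0.
have : (f x < (r ^+ 2)%:E)%E by rewrite fx lte_fin exprn_gt0.
move=> /ereal_inf_lt[_ [n _ <-]]; rewrite lte_fin => qr.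
exists (fun y => \sum_(i <- (sc n).1) ((sc n).2 i * e i.1 x) * Psi i.2 (x, y)).
  exact: (closed_span_comb snd (sc n).1 (fun i => (sc n).2 i * e i.1 x) Lx).
rewrite -ltr_sqr ?nnegrE ?nrm_ge0 ?ltW// nrm_sq; apply: le_lt_trans qr.
rewrite le_eqVlt; apply/orP; left; apply/eqP; congr nsq; apply/funext => y.
by rewrite /D; congr (_ - _); apply: eq_bigr => i _; rewrite /modulate mulrA.
Qed.

(** The null set of [fiber_mem] depends on [h]. It is made uniform by a countable dense family in
    L^2 of the second factor, obtained from rational combinations on the product. *)
Lemma fiber_span_total : {ae m1, forall x, forall h, cL2 m2 h ->
  closed_span m2 (fun t y => Psi t (x, y)) h}.
Proof.
(* Indexing by naturals through [en] makes finite sets of indices countable in number; repetitions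
   do no harm. *)
pose E (i : nat * N) := modulate e Psi (en i.1, i.2).
have LE i : cL2 m12 (E i) by exact: Lmod.
have /choice[inv invE] := en_surj.
have E_total F : cL2 m12 F -> closed_span m12 E F.
  move=> LF; apply: closed_span_closed => // r r0.
  have [_ /(_ _ r0)[s [c hs]]] := (closed_spanP _ Lmod).1 (Psi_total LF).
  exists (fun p => \sum_(i <- s) c i * modulate e Psi i p) => //.
  have := closed_span_comb (fun i : A * N => (inv i.1, i.2)) s c LE.
  by congr closed_span; apply/funext => p; apply: eq_bigr => -[a t] _; rewrite /E /= invE.
pose J := ({fset (nat * N)} * seq (rat * rat) * nat)%type.
pose dj (j : J) p := \sum_(i <- j.1.1) rat_complex R (nth (0, 0) j.1.2 (index i j.1.1)) * E i p.
have Ld j : cL2 m12 (dj j) by exact: cL2_comb.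
(* For each combination and precision, [hh] picks a function whose extension is that close, or 0 if
   there is none. Any [h] near the same combination is then within [2 / 2 ^+ n] of the chosen
   function. *)
pose good (j : J) h := cL2 m2 h /\ nrm m12 (fun p => h p.2 - dj j p) < 1 / 2 ^+ j.2.
pose hh (j : J) := xget (fun=> 0) (good j).
have Lhh j : cL2 m2 (hh j).
  by rewrite /hh; case: xgetP => [h _ []|_] //; exact: cL2_0.
apply: filterS2 (ae_forall_count (fun j => fiber_mem (Lhh j)))
  (ae_forall_count (fun t => cL2_section (LPsi t))) => x Sx Lx h Lh.
apply: closed_span_closed => // r /exists_pow2_lt[n hn].
have p0 : 0 < 1 / 2 ^+ n :> R by rewrite divr_gt0// exprn_gt0.
have [s [q hs]] := rational_span LE (E_total _ (cL2_snd Lh)) p0.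
pose j : J := (s, q, n); exists (hh j) => //.
have [_ gj] : good j (hh j) by rewrite /hh; apply: xgetPex; exists h; split.
have LB := cL2B Lh (Lhh j).
rewrite -(nrm_lift LB); apply: le_lt_trans hn.
apply: le_trans (nrm_trans (cL2_snd Lh) (Ld j) (cL2_snd (Lhh j))) _.
apply: (@le_trans _ _ (1 / 2 ^+ n + 1 / 2 ^+ n)).
  by rewrite lerD ?ltW// nrm_distC//; exact: cL2_snd.
by rewrite -mulrDl ler_pM2r ?invr_gt0 ?exprn_gt0//; lra.
Qed.

End FiberSpan.

(** * Borel sets and characters *)

Section BorelMeasurability.

Lemma measurable_bigcup_countable d (T : measurableType d) (U : choiceType)
    (D : set U) (F : U -> set T) : countable D ->
  (forall i, D i -> measurable (F i)) -> measurable (\bigcup_(i in D) F i).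
Proof.
move=> /countable_injP[f fI] mF.
pose i n := xget None [set o | if o is Some i then D i /\ f i = n else False].
have -> : \bigcup_(i in D) F i = \bigcup_n (if i n is Some j then F j else set0).
  apply/seteqP; split=> x.
    move=> [j Dj Fj]; exists (f j) => //; rewrite /i.
    case: xgetP => [[k|] _ //= [Dk fk]|/(_ (Some j))]; last by case.
    by have <- : j = k by apply: fI; rewrite ?inE.
  move=> [n _]; rewrite /i; case: xgetP => [[k|] _ //= [Dk fk] Fx|_ //].
  by exists k.
apply: bigcup_measurable => n _; rewrite /i.
by case: xgetP => [[k|] _ //= [Dk fk]|_]; [exact: mF|exact: measurable0].
Qed.

Lemma continuous_borel (X Y : ptopologicalType) (f : X -> Y) : continuous f ->
  measurable_fun [set: borel X] (f : borel X -> borel Y).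
Proof.
move=> /continuousP cf.
apply: (@measurability _ _ (borel X) (borel Y) setT f (@open Y)) => //.
by move=> _ [U oU <-]; rewrite setTI; apply: sub_sigma_algebra; exact: cf.
Qed.

(** In a Hausdorff space [g x] differs from [x] iff disjoint basic open sets separate them, and
    there are countably many pairs of basic sets. *)
Lemma measurable_fixpoints (G : ptopologicalType) (g : borel G -> borel G) :
  hausdorff_space G -> @second_countable G ->
  measurable_fun [set: borel G] g -> measurable ([set x | g x = x] : set (borel G)).
Proof.
move=> hG [Bs cB [Bo Bb]] mg.
have -> : [set x | g x = x] = ~` \bigcup_(UV in [set UV : set G * set G |
    (Bs UV.1 /\ Bs UV.2) /\ UV.1 `&` UV.2 = set0]) (g @^-1` UV.1 `&` UV.2).
  apply/seteqP; split=> x /=.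
    move=> gx [[U V] /= [_ UV0] [Ux Vx]].
    have : (U `&` V) x by split=> //; rewrite -gx.
    by rewrite UV0.
  move=> h; apply: hG => P Q nP nQ; apply: contrapT => PQ; apply: h.
  have [U [BU Ux] UP] := Bb _ _ nP; have [V [BV Vx] VQ] := Bb _ _ nQ.
  exists (U, V) => //=; split=> //; apply/seteqP; split=> // y [Uy Vy].
  by apply: PQ; exists y; split; [exact: UP|exact: VQ].
apply: measurableC; apply: measurable_bigcup_countable.
  apply: (sub_countable _ (countableX cB cB)); apply: subset_card_le.
  by move=> [U V] [].
move=> [U V] /= [[BU BV] _]; apply: measurableI.
  have mU : measurable (U : set (borel G)) by apply: sub_sigma_algebra; exact: Bo.
  by have := mg measurableT _ mU; rewrite setTI.
by apply: sub_sigma_algebra; exact: Bo.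
Qed.

(** Choosing for each point of [D] a basic open set that meets [D] only there defines an injection
    into the countable basis. *)
Lemma countable_discrete (G : topologicalType) (D : set G) :
  @second_countable G -> (forall x : D, open [set x]) -> countable D.
Proof.
move=> [Bs cB [Bo Bb]] dD.
have H (x : G) : D x -> exists U, [/\ Bs U, U x & U `&` D `<=` [set x]].
  move=> Dx; pose x' : D := SigSub (mem_set Dx).
  have [V oV Ve] := dD x'.
  have Vx : V x by have : (set_val @^-1` V) x' by rewrite Ve.
  have [U [BU Ux] UV] := Bb _ _ (open_nbhs_nbhs (conj oV Vx)).
  exists U; split=> // y [Uy Dy]; pose y' : D := SigSub (mem_set Dy).
  have : (set_val @^-1` V) y' by exact: UV.
  by rewrite Ve => /(congr1 set_val).
have [f Hf] : {f : G -> set G & forall x, D x ->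
    [/\ Bs (f x), (f x) x & f x `&` D `<=` [set x]]}.
  apply: (@choice _ _ (fun x U => D x -> [/\ Bs U, U x & U `&` D `<=` [set x]])).
  move=> x; have [Dx|nDx] := pselect (D x); last by exists set0.
  by have [U hU] := H x Dx; exists U.
have fI : {in D &, injective f}.
  move=> x y /set_mem Dx /set_mem Dy fxy.
  have [_ xx _] := Hf x Dx; have [_ _ h] := Hf y Dy.
  by apply: h; split=> //; rewrite -fxy.
apply: (sub_countable _ cB).
apply: card_le_trans (_ : (f @` D #<= Bs)%card).
  by rewrite (card_le_eql (card_esym (inj_card_eq fI))).
by apply: subset_card_le => _ [x Dx <-]; have [] := Hf x Dx.
Qed.

End BorelMeasurability.

(** * Evaluation characters on the dual group *)

Section Characters.
Context (R : realType) (G : topologicalGroupType)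
  (Gam : closedDiscreteAbelianSubgroup G).
Local Notation gT := (subgroup_type Gam).

Lemma subgroup_enum : @second_countable G ->
  exists en : nat -> gT, forall g, exists n, en n = g.
Proof.
move=> scG; have := countable_discrete scG (@subgroup_discrete _ Gam).
move=> /countable_injP[f fI].
pose en n : gT := xget 1%g [set g | f (val g) = n].
exists en => g; exists (f (val g)); rewrite /en.
case: xgetP => [h _ /= fh|/(_ g)]; last by case.
by apply: val_inj; apply: fI => //; exact: valP.
Qed.

Lemma Re_continuous : continuous (@complex.Re R : R[i]^o -> R).
Proof.
move=> z A /nbhs_ballP[r /= r0 rA]; exists r%:C%C; first by rewrite /= ltcR.
move=> w /=; rewrite normc_def ltcR => h; apply: rA; rewrite /ball /=.
apply: le_lt_trans h; rewrite -raddfB -sqrtr_sqr.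
by rewrite ler_wsqrtr// lerDl sqr_ge0.
Qed.

Lemma Im_continuous : continuous (@complex.Im R : R[i]^o -> R).
Proof.
move=> z A /nbhs_ballP[r /= r0 rA]; exists r%:C%C; first by rewrite /= ltcR.
move=> w /=; rewrite normc_def ltcR => h; apply: rA; rewrite /ball /=.
apply: le_lt_trans h; rewrite -raddfB -sqrtr_sqr.
by rewrite ler_wsqrtr// lerDr sqr_ge0.
Qed.

Lemma char_eval_continuous (g : gT) :
  continuous (fun a : dual R Gam => char_eval a g : R[i]^o).
Proof.
apply/continuousP => O oO.
have cg : compact [set g] by exact: compact_set1.
have oW := @compact_open_open gT R[i]^o [set g] O cg oO.
have cv : continuous (set_val : dual R Gam -> {compact-open, gT -> R[i]^o}).
  exact: initial_continuous.
move/continuousP : cv => /(_ _ oW); congr open.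
apply/seteqP; split=> a /=; first by move=> h; apply: h; exists g.
by move=> h _ [_ -> <-].
Qed.

(** The inverse matches the factor [alpha (gamma^-1)] of the Zak series. *)
Definition character_fun (g : gT) (a : borel (dual R Gam)) : R[i] :=
  char_eval a (g^-1)%g.

Lemma cmeasurable_character g : cmeasurable (character_fun g).
Proof.
have H (f : R[i]^o -> R) : continuous f ->
    measurable_fun setT (fun a => f (character_fun g a)).
  move=> cf; have c : continuous (fun a : dual R Gam => f (char_eval a (g^-1)%g)).
    by move=> a; apply: continuous_comp; [exact: char_eval_continuous|exact: cf].
  apply: (measurability _ (@RGenOpens.measurableE R)) => _ [_ [a [b ->]] <-].
  rewrite setTI; apply: sub_sigma_algebra.
  by move/continuousP : c; apply; exact: interval_open.
by split; apply: H; [exact: Re_continuous|exact: Im_continuous].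
Qed.

Lemma csq_character g a : csq (character_fun g a) = 1.
Proof.
have [_ a1 _] := charP a; have := a1 (g^-1)%g; rewrite normc_def.
move=> /(congr1 (@complex.Re R)) /= h.
by rewrite -[csq _]sqr_sqrtr ?csq_ge0// [Num.sqrt _]h expr1n.
Qed.

Lemma character_fun1 a : character_fun 1%g a = 1.
Proof. by rewrite /character_fun invg1; exact: char_eval1. Qed.

Lemma character_funM g h a : character_fun (g * h)%g a =
  character_fun g a * character_fun h a.
Proof.
have [_ _ aM] := charP a; rewrite /character_fun invgM aM mulrC //.
Qed.

End Characters.

(** * The Zak transform *)

Section Isometry.
Context d1 d2 (T1 : measurableType d1) (T2 : measurableType d2) (R : realType).
Variables (mu1 : {measure set T1 -> \bar R}) (mu2 : {measure set T2 -> \bar R}).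
Variable U : (T1 -> R[i]) -> T2 -> R[i].
Hypothesis U_L2 : forall f, cL2 mu1 f -> cL2 mu2 (U f).
Hypothesis U_nsq : forall f, cL2 mu1 f -> nsq mu2 (U f) = nsq mu1 f.
Hypothesis U_lin : forall a f g, cL2 mu1 f -> cL2 mu1 g ->
  U (fun x => a * f x + g x) = (fun x => a * U f x + U g x) %[ae mu2].

(** Expanding the squared norm of [a f + g] on both sides isolates the real part of [a <f, g>]; the
    values 1 and i of [a] determine the inner product. *)
Lemma isometry_inner f g : cL2 mu1 f -> cL2 mu1 g ->
  inner mu2 (U f) (U g) = inner mu1 f g.
Proof.
move=> Lf Lg; have Uf := U_L2 Lf; have Ug := U_L2 Lg.
have H a : complex.Re (a * inner mu2 (U f) (U g)) = complex.Re (a * inner mu1 f g).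
  have Laf := cL2Z a Lf; have LUaf := cL2Z a Uf.
  have := U_nsq (cL2_lin a Lf Lg).
  rewrite (ae_eq_nsq (U_L2 (cL2_lin a Lf Lg)) (cL2_lin a Uf Ug) (U_lin a Lf Lg)).
  rewrite !nsqD// !nsqZ// !U_nsq// !innerZ// => /addrI/mulfI; apply.
  by rewrite pnatr_eq0.
apply: complex_eqP; first by have := H 1; rewrite !mul1r.
by have := H 'i%C; rewrite !ReM /= !mul0r !mul1r !add0r => /oppr_inj.
Qed.

(** [U] acts on functions rather than on classes; its compatibility with equality almost everywhere
    is a consequence of preserving inner products. *)
Lemma isometry_ae f g : cL2 mu1 f -> cL2 mu1 g -> f = g %[ae mu1] ->
  U f = U g %[ae mu2].
Proof.
move=> Lf Lg fg; have Uf := U_L2 Lf; have Ug := U_L2 Lg.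
have e : nsq mu2 (fun x => U f x - U g x) = 0.
  rewrite /nsq innerB ?innerBr//; last exact: cL2B.
  rewrite !isometry_inner// (ae_eq_inner Lf Lg Lf Lg fg fg).
  rewrite (ae_eq_inner Lf Lg Lg Lg fg) ?(ae_eq_inner Lg Lg Lf Lg _ fg)//.
  - by rewrite !subrr.
  - exact: aeW.
  - exact: aeW.
have := nsq_eq0 (cL2B Uf Ug) e; apply: filterS => x /= /[apply] /eqP.
by rewrite subr_eq0 => /eqP.
Qed.

End Isometry.

Section Indicator.
Context d (T : measurableType d) (R : realType).
Variable mu : {measure set T -> \bar R}.

Definition cindic (A : set T) (x : T) : R[i] := (\1_A x)%:C%C.

Lemma csq_cindic A x : csq (cindic A x) = \1_A x.
Proof.
by rewrite /cindic csq_real indicE; case: (_ \in _); rewrite ?expr1n// expr2 mulr0.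
Qed.

Lemma normc_cindic A x : Normc.normc (cindic A x) = \1_A x.
Proof.
by rewrite normcE csq_cindic indicE; case: (_ \in _); rewrite ?sqrtr1 ?sqrtr0.
Qed.

Lemma cmeasurable_cindic A : measurable A -> cmeasurable (cindic A).
Proof. by move=> mA; split; [exact: measurable_indic|exact: measurable_cst]. Qed.

Lemma cL2_cindic A : measurable A -> (mu A < +oo)%E ->
  cL2 mu (cindic A) /\ nsq mu (cindic A) = fine (mu A).
Proof.
move=> mA Aoo; have E : (\int[mu]_x (csq (cindic A x))%:E = mu A)%E.
  by under eq_integral do rewrite csq_cindic; rewrite integral_indic// setIT.
by rewrite nsqE E; split=> //; apply/cL2P; split; [exact: cmeasurable_cindic|rewrite E].
Qed.

End Indicator.

Section Zak.
Context (R : realType) (G : topologicalGroupType)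
  (Gam : closedDiscreteAbelianSubgroup G).
Hypotheses (G_hausdorff : hausdorff_space G) (G_sc : @second_countable G).
Variables (mu : {measure set (borel G) -> \bar R})
  (nu : probability (borel (dual R Gam)) R)
  (muQ : {sigma_finite_measure set (borel (cosets Gam)) -> \bar R}).
Local Notation gT := (subgroup_type Gam).
Variable Xi : cosets Gam -> G.
Hypothesis Xi_section : borel_section Xi.
Hypothesis weil : is_quotient_measure mu muQ Xi.
Local Notation m12 := (nu \x muQ)%E.
Local Notation proj := (coset_proj Gam).
Local Notation e_ := (@character_fun R G Gam).

Lemma coset_projM (g : gT) x : proj (val g * x)%g = proj x.
Proof.
apply/eqquotP; apply/asboolP; exists g^-1%g.
by rewrite mulgA -valM mulVg val1 mul1g.
Qed.

Lemma subgroup_valV (g : gT) : val (g^-1)%g = ((val g)^-1)%g.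
Proof. by apply: (mulgI (val g)); rewrite -valM !mulgV val1. Qed.

Lemma coset_decomp x : exists g : gT, x = (val g * Xi (proj x))%g.
Proof.
have /eqquotP/asboolP[g ->] : proj (Xi (proj x)) = proj x by exact: Xi_section.2.
by exists g; rewrite coset_projM Xi_section.2.
Qed.

(** The translate by [g] of the range of the section; these sets partition [G]. Writing it as a
    fixed-point set gives measurability without taking the image of a Borel map. *)
Definition sheet (g : gT) : set G := [set x | (val g * Xi (proj x))%g = x].

Lemma sheet_Xi g h q : sheet g (val h * Xi q)%g <-> g = h.
Proof.
rewrite /sheet /= coset_projM Xi_section.2; split=> [/mulIg/val_inj//|->//].
Qed.

Lemma measurable_mull (g : G) :
  measurable_fun [set: borel G] (fun x : borel G => (g * x)%g : borel G).
Proof.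
apply: continuous_borel => x; apply: (@continuous_comp _ _ _ (fun x => (g, x))
  (fun xy : G * G => (xy.1 * xy.2)%g)); last exact: mulg_continuous.
by apply: cvg_pair; [exact: cvg_cst|exact: cvg_id].
Qed.

Lemma measurable_proj :
  measurable_fun [set: borel G] (proj : borel G -> borel (cosets Gam)).
Proof. by apply: continuous_borel; exact: pi_continuous. Qed.

Lemma measurable_sheet g : measurable (sheet g : set (borel G)).
Proof.
apply: measurable_fixpoints => //.
apply: (measurableT_comp (measurable_mull (val g))).
exact: (measurableT_comp Xi_section.1 measurable_proj).
Qed.

(** In Weil's formula a translation by an element of the subgroup only permutes the terms of the
    inner sum. *)
Lemma ge0_integral_translate (g : gT) (f : borel G -> \bar R) :
  measurable_fun setT f -> (forall x, (0 <= f x)%E) ->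
  (\int[mu]_x f ((val g)^-1 * x)%g = \int[mu]_x f x)%E.
Proof.
move=> mf f0; have mfg : measurable_fun setT (fun x : borel G => f ((val g)^-1 * x)%g).
  exact: (measurableT_comp mf (measurable_mull _)).
rewrite (weil mfg)// (weil mf)//; apply: eq_integral => q _.
rewrite (reindex_esum [set: gT] _ (fun h => g * h)%g); last first.
  split=> //; first by move=> h k _ _ /mulgI.
  by move=> h _; exists (g^-1 * h)%g => //; rewrite mulgA mulgV mul1g.
by apply: eq_esum => h _; rewrite valM !mulgA mulVg mul1g.
Qed.

Lemma cmeasurable_translate g (f : G -> R[i]) : cmeasurable (f : borel G -> R[i]) ->
  cmeasurable (translate g f : borel G -> R[i]).
Proof.
move=> [f1 f2]; split.
  exact: (measurableT_comp f1 (measurable_mull _)).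
exact: (measurableT_comp f2 (measurable_mull _)).
Qed.

Lemma cL2_translate (g : gT) (f : G -> R[i]) : cL2 mu f ->
  cL2 mu (translate (val g) f) /\ nsq mu (translate (val g) f) = nsq mu f.
Proof.
move=> Lf; have [mf fi] := (cL2P mu f).1 Lf.
have E := ge0_integral_translate g (measurable_ecsq mf).
split.
  apply/cL2P; split; first exact: cmeasurable_translate.
  by rewrite /translate E// => x; rewrite lee_fin csq_ge0.
by rewrite !nsqE; congr fine; apply: E => x; rewrite lee_fin csq_ge0.
Qed.

Lemma inner_translate (g : gT) (f h : G -> R[i]) : cL2 mu f -> cL2 mu h ->
  inner mu (translate (val g) f) (translate (val g) h) = inner mu f h.
Proof.
move=> Lf Lh.
apply: (@isometry_inner _ _ (borel G) (borel G) _ mu mu (translate (val g))) => //.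
- by move=> k /(cL2_translate g)[].
- by move=> k /(cL2_translate g)[].
- by move=> a k l _ _; exact: aeW.
Qed.

Lemma cL1P (f : G -> R[i]) : cL1 mu f <-> cmeasurable (f : borel G -> R[i]) /\
  (\int[mu]_x (Normc.normc (f x))%:E < +oo)%E.
Proof.
rewrite /cL1 /cLnorm /= Lnorm1.
by under eq_integral do rewrite gee0_abs ?lee_fin ?normc_ge0//.
Qed.

(* Functions carried by a single translate of the section: the Zak series of
   such a function has at most one nonzero term. *)
Definition test (g : gT) (t : G -> R[i]) :=
  [/\ cL1 mu t, cL2 mu t & forall x, t x != 0 -> sheet g x].

Lemma test_eq0 g t h q : test g t -> h != g -> t (val h * Xi q)%g = 0.
Proof.
move=> [_ _ supp] hg; apply/eqP; apply: contraNT hg => /supp/sheet_Xi ->.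
exact: eqxx.
Qed.

Lemma esum_single (a : gT -> \bar R) g : (0 <= a g)%E ->
  (forall h, h != g -> a h = 0%E) -> (\esum_(h in [set: gT]) a h = a g)%E.
Proof.
move=> a0 H; rewrite -[RHS](esum_set1 a0) [RHS]esum_mkcond; apply: eq_esum => h _.
by case: ifPn => // hg; apply: H; apply: contraNneq hg => ->; rewrite inE.
Qed.

Lemma test_cL2 g t : test g t -> cL2 muQ (fun q => t (val g * Xi q)%g).
Proof.
move=> Ht; have [_ Lt _] := Ht; have [mt ti] := (cL2P mu t).1 Lt.
have mX : measurable_fun [set: borel (cosets Gam)]
    (fun q : borel (cosets Gam) => (val g * Xi q)%g : borel G).
  exact: (measurableT_comp (measurable_mull _) Xi_section.1).
apply/cL2P; split; first by case: mt => m1 m2; split;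
  [exact: (measurableT_comp m1 mX)|exact: (measurableT_comp m2 mX)].
move: ti; rewrite weil; last 2 first.
- exact: measurable_ecsq.
- by move=> x; rewrite lee_fin csq_ge0.
congr (_ < _)%E; apply: eq_integral => q _; apply: esum_single.
  by rewrite lee_fin csq_ge0.
by move=> h hg; rewrite (test_eq0 _ Ht hg) csq0.
Qed.

Lemma test_translate (g h : gT) t : test h t -> test (g^-1 * h)%g (translate (val g^-1)%g t).
Proof.
move=> [L1 L2 supp]; split.
- have [mt ti] := (cL1P t).1 L1; apply/cL1P; split; first exact: cmeasurable_translate.
  rewrite /translate.
  have := @ge0_integral_translate g^-1%g (fun x => (Normc.normc (t x))%:E).
  move=> -> //; last by move=> x; rewrite lee_fin normc_ge0.
  by apply/measurable_EFinP; exact: measurable_normc.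
- by have [] := cL2_translate g^-1%g L2.
- move=> x; rewrite /translate subgroup_valV invgK => /supp; rewrite /sheet /= coset_projM.
  by move=> H; rewrite -mulgA H mulgA mulVg mul1g.
Qed.

(** The test functions are truncations of [f] itself to one sheet and to a level set of its modulus:
    there [<f, t> = |t|^2]. Countably many of these sets cover the points where [f] is nonzero. *)
Lemma test_total f : cL2 mu f ->
  (forall g t, test g t -> inner mu f t = 0) -> f = (fun=> 0) %[ae mu].
Proof.
move=> Lf H; have mf := cL2_measurable Lf.
pose A g n : set (borel G) := sheet g `&` [set x | n.+1%:R^-1 <= csq (f x)].
have mA g n : measurable (A g n).
  apply: measurableI; first exact: measurable_sheet.
  have := measurable_csq mf measurableT (measurable_itv `[n.+1%:R^-1, +oo[).
  by rewrite setTI; congr measurable; apply/seteqP; split=> x /=; rewrite in_itv /= andbT.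
pose t g n x : R[i] := (\1_(A g n) x)%:C%C * f x.
have tE g n x : t g n x = if x \in A g n then f x else 0.
  by rewrite /t indicE; case: (x \in A g n); rewrite ?mul1r ?mul0r.
have mt g n : cmeasurable (t g n : borel G -> R[i]).
  apply: cmeasurableM => //; split; last exact: measurable_cst.
  exact: measurable_indic.
have Lt g n : cL2 mu (t g n).
  apply: (cL2_dominated (mt g n) (cL2_integrable Lf)) => x.
  by rewrite tE; case: ifP => // _; rewrite csq0 csq_ge0.
have Tt g n : test g (t g n).
  split=> //.
    apply/cL1P; split=> //.
    (* For [y = |f|] on the level set, [1 <= (n + 1) y^2], so [2 y <= y^2 + 1 <= (n + 2) y^2]: the
       truncation is dominated by an integrable function. *)
    have : mu.-integrable setT (fun x => (n.+2%:R)%:E * (csq (f x))%:E)%E.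
      by apply: integrableZl => //; exact: cL2_integrable.
    move=> /integrableP[mi]; apply: le_lt_trans; apply: ge0_le_integral => //.
    - by move=> x _; rewrite lee_fin normc_ge0.
    - by apply/measurable_EFinP; exact: measurable_normc.
    - exact: measurableT_comp.
    - move=> x _; rewrite -EFinM gee0_abs ?lee_fin ?mulr_ge0 ?csq_ge0// tE.
      case: ifPn => [/set_mem[_ /= hx]|_]; last by rewrite Normc.normc0 mulr_ge0 ?csq_ge0.
      have n0 : 0 < n.+1%:R :> R by rewrite ltr0n.
      rewrite -[n.+1%:R^-1]mul1r ler_pdivrMr// in hx.
      rewrite -normc_sq in hx *; rewrite -natr1 mulrDl mul1r.
      have := sqr_ge0 (Normc.normc (f x) - 1); rewrite sqrrB1 -mulr_natl.
      have := normc_ge0 (f x); move: (Normc.normc (f x)) hx => y hx y0 h; nra.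
  by move=> x; rewrite tE; case: ifPn => [/set_mem[]//|_]; rewrite eqxx.
have t0 g n : {ae mu, forall x, t g n x = 0}.
  have : nsq mu (t g n) = 0.
    rewrite /nsq -[RHS](congr1 (@complex.Re R) (H g _ (Tt g n))).
    congr complex.Re; rewrite /inner; congr cintegral; apply/funext => x.
    by rewrite tE; case: ifP => // _; rewrite conjc0 !mulr0.
  by move=> /(nsq_eq0 (Lt g n)); apply: filterS => x /= h; exact: h.
have [en en_surj] := subgroup_enum Gam G_sc.
have := ae_forall_count (fun i : nat * nat => t0 (en i.1) i.2).
apply: filterS => x h _; apply: contrapT => /eqP fx.
have [g xg] := coset_decomp x; have [m mg] := en_surj g.
have c0 : 0 < csq (f x).
  by rewrite lt_def csq_ge0 andbT; apply: contraNneq fx => /csq_eq0 ->.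
have := h (m, Num.bound (csq (f x))^-1) => /=; rewrite tE mg ifT ?(negPf fx)//.
  by move/eqP; rewrite (negPf fx).
apply/mem_set; split; first by rewrite /sheet /= -xg.
rewrite /= invf_ple ?posrE// ltW//.
apply: (lt_trans (archi_boundP _)); first by rewrite invr_ge0 ltW.
by rewrite ltr_nat.
Qed.

Local Notation P := (borel (dual R Gam) * borel (cosets Gam))%type.
Variable Z : (G -> R[i]) -> P -> R[i].
Hypothesis Z_zak : is_zak_transform mu nu muQ Xi Z.

Lemma zak_nsq f : cL2 mu f -> nsq m12 (Z f) = nsq mu f.
Proof.
move=> Lf; rewrite !nsqE -!cLnorm2_sq; congr (fine (_ ^+ 2)%E).
exact: (zak_isometry Z_zak).
Qed.

Lemma zak_inner f h : cL2 mu f -> cL2 mu h ->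
  inner m12 (Z f) (Z h) = inner mu f h.
Proof.
move=> Lf Lh; apply: isometry_inner => //.
- exact: (zak_L2 Z_zak).
- exact: zak_nsq.
- exact: (zak_linear Z_zak).
Qed.

Lemma zak_ae f h : cL2 mu f -> cL2 mu h -> f = h %[ae mu] -> Z f = Z h %[ae m12].
Proof.
exact: (@isometry_ae _ _ _ _ _ mu m12 Z (zak_L2 Z_zak) zak_nsq (zak_linear Z_zak)).
Qed.

Lemma zak_surj (F : P -> R[i]) : cL2 m12 F ->
  exists2 f, cL2 mu f & Z f = F %[ae m12].
Proof. exact: (zak_onto Z_zak). Qed.

Lemma zak_test g t : test g t ->
  {ae m12, forall p, Z t p = e_ g p.1 * t (val g * Xi p.2)%g}.
Proof.
move=> Ht; have [L1 L2 _] := Ht; apply: filterS (zak_formula Z_zak L1 L2) => p.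
have PF : ProperFilter (@summability.totally gT) := summability.totally_filter.
move=> h; apply: (@cvg_unique R[i]^o _ _ _ _ _ h); first exact: norm_hausdorff.
apply: cvg_near_cst; exists [fset g]%fset => // s /= /fsubsetP/(_ g).
rewrite inE eqxx => /(_ isT) gs.
rewrite (big_fsetD1 g)//= big1_fset ?addr0 1?mulrC//.
move=> k; rewrite !inE => /andP[kg _] _.
by rewrite (test_eq0 _ Ht kg) mul0r.
Qed.

Lemma cL2_character g : cL2 nu (e_ g).
Proof.
have fin : (nu setT < +oo)%E by rewrite probability_setT ltry.
apply: (bounded_cL2 (M := 1) fin) => //; first exact: cmeasurable_character.
by move=> a; rewrite csq_character.
Qed.

Lemma cL2_character_mul g F : cL2 m12 F -> cL2 m12 (fun p => e_ g p.1 * F p).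
Proof.
move=> LF; apply: (cL2_fst_mul (M := 1)) => //.
  exact: cmeasurable_character.
by move=> a; rewrite csq_character.
Qed.

(** Surjectivity gives [h] with [Z h = e_g Z f]. On test functions the covariance is visible from
    the one-term series, so by unimodularity of [e_g] the functions [h] and the translate of [f]
    have equal products with every test function, hence agree. *)
Lemma zak_translate g f : cL2 mu f ->
  Z (translate (val g) f) = (fun p => e_ g p.1 * Z f p) %[ae m12].
Proof.
move=> Lf; have LZ := zak_L2 Z_zak Lf; have LF := cL2_character_mul g LZ.
have [h Lh hF] := zak_surj LF.
have [Lgf _] := cL2_translate g Lf; have LZh := zak_L2 Z_zak Lh.
have Lgh := cL2B Lh Lgf.
suff hE : h = translate (val g) f %[ae mu].
  apply: filterS2 hF (zak_ae Lh Lgf hE) => p /= h1 h2 pT.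
  by rewrite -h2// h1.
have := test_total Lgh _; case.
  move=> k t Tt; have [_ Lt _] := Tt.
  have Tt' := test_translate g Tt; set t' := translate _ t in Tt'.
  have [_ Lt' _] := Tt'; have LZt' := zak_L2 Z_zak Lt'; have LZt := zak_L2 Z_zak Lt.
  have tE : t = translate (val g) t'.
    apply/funext => x; rewrite /t' /translate subgroup_valV invgK.
    by rewrite mulgA mulgV mul1g.
  have ZtE : Z t = (fun p => e_ g p.1 * Z t' p) %[ae m12].
    apply: filterS2 (zak_test Tt) (zak_test Tt') => p /= -> -> _.
    rewrite mulrA -character_funM mulgA mulgV mul1g.
    by rewrite /t' /translate subgroup_valV invgK !mulgA mulgV mul1g.
  rewrite innerB//; apply/eqP; rewrite subr_eq0; apply/eqP.
  rewrite {2}tE inner_translate// -!zak_inner//.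
  rewrite (ae_eq_inner LZh LF LZt (cL2_character_mul g LZt') hF ZtE).
  rewrite /inner; congr cintegral; apply/funext => p.
  rewrite conjcM mulrACA mul_conjc csq_character.
  by rewrite -[RHS]mul1r.
move=> S [mS S0 hS]; exists S; split=> // x /= hx; apply: hS => /= hh.
by apply: hx => xT; apply/eqP; rewrite -subr_eq0; apply/eqP; exact: hh.
Qed.

Hypothesis mu_neq0 : mu [set: G] != 0%E.

(** If the quotient had measure 0, Weil's formula for the constant 1 would make [mu] vanish;
    sigma-finiteness then supplies a piece of finite nonzero measure. *)
Lemma quotient_finite_set : exists A : set (borel (cosets Gam)),
  [/\ measurable A, muQ A != 0%E & (muQ A < +oo)%E].
Proof.
have muQT : muQ setT != 0%E.
  apply: contraNneq mu_neq0 => Q0.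
  have E := weil (measurable_cst (1%E : \bar R)) (fun _ => lee01).
  have <- : (\int[mu]_x 1%E = mu setT)%E.
    by apply: etrans (integral_cst mu measurableT 1%E) _; rewrite mul1e.
  rewrite E; apply/eqP; apply: etrans (integral_cst muQ measurableT (\esum_(g in [set: gT]) 1)%E) _.
  by apply: etrans (congr1 (fun z => _ * z)%E Q0) _; rewrite mule0.
have [F FT Foo] := sigma_finiteT muQ.
apply: contrapT => H; move/eqP : muQT; apply.
apply/(negligibleP _ measurableT); rewrite FT; apply: negligible_bigcup => n.
have [mF Fn] := Foo n; apply/(negligibleP _ mF); apply/eqP; apply: contrapT => /negP F0.
by apply: H; exists (F n).
Qed.

Lemma character_orthonormal g h :
  inner nu (e_ g) (e_ h) = if g == h then 1 else 0.
Proof.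
have [->|gh] := eqVneq.
  rewrite inner_self nsqE; under eq_integral do rewrite csq_character.
  congr (_%:C%C); have -> // : (\int[nu]_x 1%:E = 1)%E.
  apply: etrans (integral_cst nu measurableT 1%E) _.
  by rewrite mul1e; exact: probability_setT.
have [A [mA A0 Aoo]] := quotient_finite_set.
(* The part of a sheet above [A]. Weil's formula gives it the measure of [A], and the Zak transform
   of its indicator is [e_k] tensor the indicator of [A]; distinct sheets are disjoint, so
   [<e_g, e_h>] times the measure of [A] is 0. *)
pose S k : set (borel G) := sheet k `&` proj @^-1` A.
have mS k : measurable (S k).
  apply: measurableI; first exact: measurable_sheet.
  by have := measurable_proj measurableT mA; rewrite setTI.
pose t k : G -> R[i] := cindic R (S k).
have SXi k q : \1_(S k) (val k * Xi q)%g = \1_A q :> R.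
  rewrite !indicE; congr (_ %:R); apply: congr1.
  apply/idP/idP => /set_mem.
    by move=> [_]; rewrite /= coset_projM Xi_section.2 => ?; exact: mem_set.
  move=> Aq; apply: mem_set; split; first exact/sheet_Xi.
  by rewrite /= coset_projM Xi_section.2.
pose a : borel (cosets Gam) -> R[i] := cindic R A.
have tXi k q : t k (val k * Xi q)%g = a q by rewrite /t /a /cindic SXi.
have muS k : mu (S k) = muQ A.
  rewrite -[A in RHS]setIT -(integral_indic muQ measurableT mA).
  rewrite -[S k]setIT -(integral_indic mu measurableT (mS k)).
  rewrite weil; last 2 first.
  - by apply/measurable_EFinP; exact: measurable_indic.
  - by move=> x; rewrite lee_fin indicE.
  apply: eq_integral => q _; rewrite (esum_single (g := k)) ?SXi//.
  move=> l lk; rewrite indicE memNset// => -[/sheet_Xi kl _].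
  by rewrite kl eqxx in lk.
have SAoo k : (mu (S k) < +oo)%E by rewrite muS.
have Lt k : cL2 mu (t k) by have [] := cL2_cindic (mS k) (SAoo k).
have Tt k : test k (t k).
  split=> //.
  - apply/cL1P; split; first exact: cmeasurable_cindic.
    under eq_integral do rewrite normc_cindic.
    by rewrite integral_indic// setIT.
  - move=> x; rewrite /t /cindic indicE; have [/set_mem[]//|_] := boolP (x \in _).
    by rewrite eqxx.
have [LA nA] := cL2_cindic mA Aoo; rewrite -/a in LA nA.
have nuT : nu setT = 1%E by exact: probability_setT.
have LF : cL2 m12 (fun p => a p.2) by exact: (cL2_snd nuT LA).
have E0 : inner m12 (Z (t g)) (Z (t h)) = 0.
  rewrite zak_inner// -[RHS](inner0l mu (fun=> 0)) /inner; congr cintegral.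
  apply/funext => x; rewrite mul0r /t /cindic !indicE.
  have [/set_mem[gx _]|_] := boolP (x \in S g); last by rewrite mul0r.
  have [/set_mem[hx _]|_] := boolP (x \in S h); last by rewrite conjc0 mulr0.
  move: gh; have [k xk] := coset_decomp x; move: gx hx; rewrite xk.
  by move=> /sheet_Xi -> /sheet_Xi ->; rewrite eqxx.
have ZE k : Z (t k) = (fun p => e_ k p.1 * a p.2) %[ae m12].
  by apply: filterS (zak_test (Tt k)) => p /= -> _; rewrite tXi.
have LZ k := zak_L2 Z_zak (Lt k).
have := E0; rewrite (ae_eq_inner (LZ g) (cL2_character_mul g LF) (LZ h)
  (cL2_character_mul h LF) (ZE g) (ZE h)).
have cb k b : csq (e_ k b) <= 1 by rewrite csq_character.
rewrite (inner_mul (cmeasurable_character R g) (cb g) (cmeasurable_character R h)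
  (cb h) LF LF).
rewrite /fiber_inner /= inner_self.
have -> : (fun x => e_ g x * conjc (e_ h x) * (nsq muQ a)%:C%C) =
   (fun x => (nsq muQ a)%:C%C * (e_ g x * conjc (e_ h x))).
  by apply/funext => x; rewrite mulrC.
rewrite cintegralZ; last exact: cL2_mul_conj (cL2_character g) (cL2_character h).
move=> /eqP; rewrite mulf_eq0 => /orP[|/eqP//].
move=> /eqP/(congr1 (@complex.Re R)) /=; rewrite nA => fA0; case/eqP: A0.
by rewrite -(fineK (_ : muQ A \is a fin_num)) ?fA0// ge0_fin_numE.
Qed.

(** Write [w] tensor the indicator of [A] as [Z f]. Its product with the transform of a test
    function factors through some [<w, e_g>], so [f = 0] and the tensor vanishes; as [A] has nonzero
    measure, so does [w]. *)
Lemma character_total w : cL2 nu w -> (forall g, inner nu w (e_ g) = 0) ->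
  w = (fun=> 0) %[ae nu].
Proof.
move=> Lw H; have [A [mA A0 Aoo]] := quotient_finite_set.
pose a : borel (cosets Gam) -> R[i] := cindic R A.
have [LA _] := cL2_cindic mA Aoo; rewrite -/a in LA.
have LF := cL2_tensor Lw LA; have [f Lf Zf] := zak_surj LF.
have LZ := zak_L2 Z_zak Lf.
have f0 : f = (fun=> 0) %[ae mu].
  apply: test_total => // g t Tt; have [_ Lt _] := Tt; have Lk := test_cL2 Tt.
  have LZt := zak_L2 Z_zak Lt.
  have Le := cL2_tensor (cL2_character g) Lk.
  rewrite -zak_inner// (ae_eq_inner LZ LF LZt Le Zf); last first.
    by apply: filterS (zak_test Tt) => p /= -> _.
  rewrite inner_fiber//.
  have -> : fiber_inner muQ (fun p => w p.1 * a p.2)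
      (fun p => e_ g p.1 * t (val g * Xi p.2)%g) =
      (fun x => inner muQ a (fun q => t (val g * Xi q)%g) * (w x * conjc (e_ g x))).
    apply/funext => x; rewrite /fiber_inner /= innerZ//; last exact: cL2Z.
    by rewrite innerZr// mulrA mulrC.
  rewrite cintegralZ; last exact: cL2_mul_conj (cL2_character g).
  by rewrite [cintegral _ _]H mulr0.
have F0 : nsq m12 (fun p => w p.1 * a p.2) = 0.
  rewrite -(ae_eq_nsq LZ LF Zf) zak_nsq// (ae_eq_nsq Lf (cL2_0 mu) f0).
  by rewrite /nsq inner0l.
have aeF : {ae m12, forall p, w p.1 * a p.2 = 0}.
  by apply: filterS (nsq_eq0 LF F0) => p; exact.
apply: filterS (ae_prod aeF) => x hx _; apply: contrapT => /eqP wx.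
move/eqP : A0; apply; apply/(negligibleP _ mA).
case: hx => S [mS S0 hS]; exists S; split=> // q Aq; apply: hS => /=.
rewrite /a /cindic indicE mem_set//= mulr1 => w0; by rewrite w0 eqxx in wx.
Qed.

End Zak.

(** * Transfer along the Zak transform *)

Section Transfer.
Context d1 d2 (T1 : measurableType d1) (T2 : measurableType d2) (R : realType).
Variables (mu1 : {measure set T1 -> \bar R}) (mu2 : {measure set T2 -> \bar R}).
Context (I : choiceType) (O : I -> T1 -> R[i]) (M : I -> T2 -> R[i]).
Hypotheses (LO : forall i, cL2 mu1 (O i)) (LM : forall i, cL2 mu2 (M i)).
Hypothesis OM : forall i j, inner mu2 (M i) (M j) = inner mu1 (O i) (O j).

(** The distance to a combination depends only on a norm, on products with the family and on its
    Gram matrix. Working with these numbers absorbs the fact that Zak images equal modulated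
    families only almost everywhere. *)
Lemma nsq_sub_comb f F (s : seq I) (c : I -> R[i]) : cL2 mu1 f -> cL2 mu2 F ->
  nsq mu2 F = nsq mu1 f -> (forall i, inner mu2 F (M i) = inner mu1 f (O i)) ->
  nsq mu2 (fun x => F x - \sum_(i <- s) c i * M i x) =
  nsq mu1 (fun x => f x - \sum_(i <- s) c i * O i x).
Proof.
move=> Lf LF nF iF.
have LsO : cL2 mu1 (fun x => \sum_(i <- s) c i * O i x) by exact: cL2_comb.
have LsM : cL2 mu2 (fun x => \sum_(i <- s) c i * M i x) by exact: cL2_comb.
rewrite /nsq !innerB ?innerBr//; [|exact: cL2B|exact: cL2B].
rewrite (inner_conj LF LsM) (inner_conj Lf LsO) !inner_self nF.
rewrite !inner_sumr//; under eq_bigr do rewrite iF.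
congr (complex.Re (_ - (_ - _%:C%C))); rewrite /nsq; congr complex.Re.
rewrite !inner_suml//; apply: eq_bigr => i _; congr (_ * _).
by rewrite !inner_sumr//; apply: eq_bigr => j _; rewrite OM.
Qed.

Hypothesis lift : forall F, cL2 mu2 F -> exists f, [/\ cL2 mu1 f,
  nsq mu2 F = nsq mu1 f & forall i, inner mu2 F (M i) = inner mu1 f (O i)].

Lemma bessel_bound_transfer B : bessel_bound mu1 B O -> bessel_bound mu2 B M.
Proof.
move=> H F s LF; have [f [Lf -> iF]] := lift LF.
by under eq_bigr do rewrite iF; exact: H.
Qed.

Lemma closed_span_transfer :
  (forall f, cL2 mu1 f -> closed_span mu1 O f) ->
  forall F, cL2 mu2 F -> closed_span mu2 M F.
Proof.
move=> H F LF; have [f [Lf nF iF]] := lift LF.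
apply/closed_spanP => //; split=> // r r0.
have [_ /(_ _ r0)[s [c hs]]] := (closed_spanP f LO).1 (H f Lf).
by exists s, c; rewrite /nrm (nsq_sub_comb s c Lf LF nF iF).
Qed.

End Transfer.

Lemma ae_iff d (T : measurableType d) (R : realType) (mu : {measure set T -> \bar R})
    (P Q : T -> Prop) : {ae mu, forall x, P x <-> Q x} ->
  {ae mu, forall x, P x} <-> {ae mu, forall x, Q x}.
Proof.
by move=> PQ; split=> H; apply: filterS2 PQ H => x [pq qp]; [exact: pq|exact: qp].
Qed.

(** * The equivalences for orbit families *)

Theorem theorem3p5 (R : realType) (G : topologicalGroupType)
  (G_hausdorff : hausdorff_space G)
  (G_locally_compact : locally_compact [set: G])
  (G_second_countable : @second_countable G)
  (mu : {measure set (borel G) -> \bar R}) (mu_haar : left_haar mu)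
  (Gam : closedDiscreteAbelianSubgroup G)
  (nu : probability (borel (dual R Gam)) R) (nu_haar : left_haar nu)
  (muQ : {sigma_finite_measure set (borel (cosets Gam)) -> \bar R})
  (Xi : cosets Gam -> G) (Xi_section : borel_section Xi)
  (muQ_quotient : is_quotient_measure mu muQ Xi)
  (Z : (G -> R[i]) -> (dual R Gam * cosets Gam -> R[i]))
  (Z_zak : is_zak_transform mu nu muQ Xi Z)
  (N : countType) (phi psi : N -> G -> R[i])
  (phi_L2 : forall t, cL2 mu (phi t)) (psi_L2 : forall t, cL2 mu (psi t))
  (phi_frame :
     subspace_frame mu (orbit_span Gam mu phi) (orbit_family Gam phi))
  (psi_frame :
     subspace_frame mu (orbit_span Gam mu psi) (orbit_family Gam psi))
  (eq_span : orbit_span Gam mu phi = orbit_span Gam mu psi) :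
  [/\ orthogonal_pair mu (orbit_family Gam phi) (orbit_family Gam psi) <->
      {ae nu, forall a, forall eta, ell2 eta ->
         pre_gramian muQ Z phi a
           (pre_gramian_adj muQ Z psi a (pre_gramian muQ Z psi a eta))
         = (fun=> 0) %[ae muQ]},
      orthogonal_pair mu (orbit_family Gam phi) (orbit_family Gam psi) <->
      {ae nu, forall a, forall eta, ell2 eta ->
         gramian muQ Z phi a (gramian muQ Z psi a eta) = (fun=> 0)} &
      orbit_span Gam mu phi = cL2 mu ->
      (orthogonal_pair mu (orbit_family Gam phi) (orbit_family Gam psi) <->
       {ae nu, forall a, forall f, cL2 muQ f ->
          mixed_dual_gramian muQ Z phi psi a f = (fun=> 0) %[ae muQ]})].
Proof.
pose P := (borel (dual R Gam) * borel (cosets Gam))%type.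
(* The same map, with the Borel product as the source of its values so that the product measure
   lemmas apply. *)
pose Zp : (G -> R[i]) -> P -> R[i] := Z.
have Zz : is_zak_transform mu nu muQ Xi Zp by exact: Z_zak.
have nuT : nu setT = 1%E by exact: probability_setT.
have mu0 := haar_neq0 mu_haar.
pose e := @character_fun R G Gam.
have me g : cmeasurable (e g) := cmeasurable_character R g.
have e1 g a : csq (e g a) = 1 := csq_character g a.
have e_orth := character_orthonormal G_hausdorff G_second_countable Xi_section
  muQ_quotient Zz mu0.
have e_tot := character_total G_hausdorff G_second_countable Xi_section
  muQ_quotient Zz mu0.
have LZ (f : N -> G -> R[i]) : (forall t, cL2 mu (f t)) ->
    forall t, cL2 (nu \x muQ)%E (Zp (f t)).
  by move=> Lf t; exact: (zak_L2 Zz).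
have LO (f : N -> G -> R[i]) : (forall t, cL2 mu (f t)) ->
    forall i, cL2 mu (orbit_family Gam f i).
  by move=> Lf i; have [] := cL2_translate muQ_quotient i.1 (Lf i.2).
have LM (f : N -> G -> R[i]) : (forall t, cL2 mu (f t)) ->
    forall i, cL2 (nu \x muQ)%E (modulate e (fun t => Zp (f t)) i).
  by move=> Lf i; apply: cL2_character_mul; exact: LZ.
have ZE (f : N -> G -> R[i]) : (forall t, cL2 mu (f t)) -> forall i,
    Zp (orbit_family Gam f i) = modulate e (fun t => Zp (f t)) i %[ae (nu \x muQ)%E].
  move=> Lf i; exact: (zak_translate G_hausdorff G_second_countable Xi_section
    muQ_quotient Zz).
have OM (f : N -> G -> R[i]) : (forall t, cL2 mu (f t)) -> forall i j,
    inner (nu \x muQ)%E (modulate e (fun t => Zp (f t)) i)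
      (modulate e (fun t => Zp (f t)) j) =
    inner mu (orbit_family Gam f i) (orbit_family Gam f j).
  move=> Lf i j; rewrite -(zak_inner Zz (LO f Lf i) (LO f Lf j)).
  by apply: ae_eq_inner; try exact: LM; try exact: (zak_L2 Zz (LO f Lf _));
    apply: ae_eq_sym; exact: ZE.
have lift (f : N -> G -> R[i]) : (forall t, cL2 mu (f t)) -> forall F,
    cL2 (nu \x muQ)%E F -> exists h, [/\ cL2 mu h,
      nsq (nu \x muQ)%E F = nsq mu h & forall i,
      inner (nu \x muQ)%E F (modulate e (fun t => Zp (f t)) i) =
      inner mu h (orbit_family Gam f i)].
  move=> Lf F LF; have [h Lh hF] := zak_surj Zz LF; exists h.
  have LZh := zak_L2 Zz Lh; split=> // [|i].
    by rewrite -(ae_eq_nsq LZh LF hF) (zak_nsq Zz).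
  rewrite -(zak_inner Zz Lh (LO f Lf i)).
  apply: ae_eq_inner => //; [exact: LM|exact: (zak_L2 Zz (LO f Lf i))| |];
    apply: ae_eq_sym => //; exact: ZE.
have [BF BF0 bF] := frame_bessel_bound (LO phi phi_L2) phi_frame.
have [BE BE0 bE] := frame_bessel_bound (LO psi psi_L2) psi_frame.
have bF' := bessel_bound_transfer (lift phi phi_L2) bF.
have bE' := bessel_bound_transfer (lift psi psi_L2) bE.
have pairE : orthogonal_pair mu (orbit_family Gam phi) (orbit_family Gam psi) <->
    gramians_orthogonal mu (orbit_family Gam phi) (orbit_family Gam psi).
  rewrite -(gramians_orthogonalP (ltW BF0) (ltW BE0) (LO phi phi_L2)
    (LO psi psi_L2) bF bE).
  (* The Gram criterion quantifies over the span of the second family, the definition of an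
     orthogonal pair over that of the first. *)
  have -> : closed_span mu (orbit_family Gam psi) = closed_span mu (orbit_family Gam phi).
    exact/esym/eq_span.
  split=> [[]//|H]; split=> //; first by apply/bessel_boundP; exists BF.
  by apply/bessel_boundP; exists BE.
have transferE : gramians_orthogonal mu (orbit_family Gam phi) (orbit_family Gam psi) <->
    gramians_orthogonal (nu \x muQ)%E (modulate e (fun t => Zp (phi t)))
      (modulate e (fun t => Zp (psi t))).
  have anE (f : N -> G -> R[i]) i : (forall t, cL2 mu (f t)) ->
      analysis (nu \x muQ)%E (modulate e (fun t => Zp (f t)))
        (modulate e (fun t => Zp (f t)) i) =
      analysis mu (orbit_family Gam f) (orbit_family Gam f i).
    by move=> Lf; apply/funext => j; exact: OM.
  by split=> H j k; have := H j k; rewrite !anE.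
have e_unit : exists g, forall a, e g a = 1.
  by exists 1%g => a; exact: character_fun1.
have fiberE := gramians_orthogonal_fiberP nuT me e1 e_orth e_tot (ltW BF0)
  (LZ phi phi_L2) bF' (ltW BE0) (LZ psi psi_L2) bE' e_unit.
have fibF := fiber_bessel_bound nuT me e1 e_orth e_tot (ltW BF0) (LZ phi phi_L2) bF'.
have fibE := fiber_bessel_bound nuT me e1 e_orth e_tot (ltW BE0) (LZ psi psi_L2) bE'.
split.
- apply: (iff_trans pairE); apply: (iff_trans transferE); apply: (iff_trans fiberE).
  (* What remains is a pointwise equivalence in the fibers where both Bessel bounds hold. *)
  apply: iff_sym; apply: ae_iff.
  apply: filterS2 fibF fibE => a [LF bFa] [LE bEa].
  exact: (pre_gramians_orthogonalP (ltW BF0) LF bFa (ltW BE0) LE bEa).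
- apply: (iff_trans pairE); apply: (iff_trans transferE); apply: (iff_trans fiberE).
  apply: iff_sym; apply: ae_iff.
  apply: filterS2 fibF fibE => a [LF bFa] [LE bEa].
  exact: (gramian_productP (ltW BF0) LF bFa (ltW BE0) LE bEa).
- move=> phi_total.
  apply: (iff_trans pairE); apply: (iff_trans transferE); apply: (iff_trans fiberE).
  apply: iff_sym; apply: ae_iff.
  have psi_total f : cL2 mu f -> closed_span mu (orbit_family Gam psi) f.
    by move=> Lf; rewrite -[closed_span _ _]/(orbit_span Gam mu psi) -eq_span phi_total.
  (* Totality of the orbit of [psi] passes to its modulated Zak images, and [fiber_span_total] then
     descends to almost every fiber. *)
  have Psi_total := closed_span_transfer (LO psi psi_L2) (LM psi psi_L2)
    (OM psi psi_L2) (lift psi psi_L2) psi_total.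
  have [en en_surj] := subgroup_enum Gam G_second_countable.
  have fibT := fiber_span_total nuT me e1 en_surj (LZ psi psi_L2) Psi_total.
  apply: filterS3 fibF fibE fibT => a [LF bFa] [LE bEa] dE.
  exact: (mixed_dual_gramianP (ltW BF0) LF bFa (ltW BE0) LE bEa dE).
Qed.
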